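(* Let $\xi,\eta$ be formal parameters, $\sigma=\ln(1+\xi e_{13})$, and for $\gamma\in\mathbb C$ let $h(\gamma)=h_{13}+\gamma h_\perp$ and $$\mathcal F(\gamma)=\exp\!\Big(\xi\,e_{12}\otimes e_{23}\,e^{\frac12(3\gamma-1)\sigma}\Big)\exp(h(\gamma)\otimes\sigma),$$ the extended Jordanian twist of $U(\mathfrak{sl}(3))$. Then: (i) For $\gamma=+1$ the element $$\mathcal F_{\mathcal J_{P+}}=\exp\!\Big(-\tfrac23\,h_\perp\otimes\ln\big((1+\eta\,e_{21})\,e^{2\sigma}\big)\Big)$$ is a solution of the twist equations for the twisted Hopf algebra $U_{\mathcal F(1)}(\mathfrak{sl}(3))$, and hence $\mathcal F_{\mathfrak P+}=\mathcal F_{\mathcal J_{P+}}\mathcal F(1)$ is a solution of the twist equations for $U(\mathfrak{sl}(3))$. (ii) For $\gamma=-1$ the element $$\mathcal F_{\mathcal J_{P-}}=\exp\!\Big(\tfrac23\,h_\perp\otimes\ln\big((1+\eta\,(e_{32}-\xi\,h(-1)\,e_{12}))\,e^{2\sigma}\big)\Big)$$ is a solution of the twist equations for the twisted Hopf algebra $U_{\mathcal F(-1)}(\mathfrak{sl}(3))$, and hence $\mathcal F_{\mathfrak P-}=\mathcal F_{\mathcal J_{P-}}\mathcal F(-1)$ is a solution of the twist equations for $U(\mathfrak{sl}(3))$.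
   Context: $\mathfrak{sl}(3)$ is the complex Lie algebra of traceless $3\times3$ matrices; $e_{ab}$ are the matrix units, $h_{13}=\frac12(e_{11}-e_{33})$, $h_\perp=\frac12(e_{11}-2e_{22}+e_{33})$. $U(\mathfrak{sl}(3))$ has its usual Hopf structure (primitive generators); everything takes place over $\mathbb C[[\xi,\eta]]$ with $(\xi,\eta)$-adically completed tensor products, so all logarithms and exponentials are formal power series. For a Hopf algebra with coproduct $\Delta$ and counit $\epsilon$, a solution of the twist equations is an invertible element $\mathcal F$ of the completed tensor square with $\mathcal F_{12}(\Delta\otimes\mathrm{id})(\mathcal F)=\mathcal F_{23}(\mathrm{id}\otimes\Delta)(\mathcal F)$ and $(\epsilon\otimes\mathrm{id})(\mathcal F)=(\mathrm{id}\otimes\epsilon)(\mathcal F)=1$. The twisted Hopf algebra has the same multiplication, unit and counit and the coproduct $\Delta_{\mathcal F}=\mathcal F\Delta(\cdot)\mathcal F^{-1}$. The element $\mathcal F(\gamma)$ above is a solution of the twist equations for $U(\mathfrak{sl}(3))$ for every $\gamma$, and $U_{\mathcal F(\gamma)}(\mathfrak{sl}(3))$ denotes the resulting twisted Hopf algebra. *)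

(* Defs.v *)
From HB Require Import structures.
From mathcomp Require Import all_boot all_order all_algebra.
From mathcomp Require Import complex ring zify.
From mathcomp Require Import boolp classical_sets reals.

Set Implicit Arguments.
Unset Strict Implicit.
Unset Printing Implicit Defensive.

Import GRing.Theory.
Local Open Scope ring_scope.
Local Open Scope quotient_scope.

HB.mixin Record Lmodule_isLie (K : fieldType) L of GRing.Lmodule K L := {
  bracket : L -> L -> L;
  bracketDl : forall a x x' y,
    bracket (a *: x + x') y = a *: bracket x y + bracket x' y;
  bracketDr : forall a x y y',
    bracket x (a *: y + y') = a *: bracket x y + bracket x y';
  bracketxx : forall x, bracket x x = 0;
  jacobi : forall x y z,
    bracket x (bracket y z) + bracket y (bracket z x)
      + bracket z (bracket x y) = 0
}.

#[short(type="lieAlgType")]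
HB.structure Definition LieAlgebra (K : fieldType) :=
  {L of GRing.Lmodule K L & Lmodule_isLie K L}.

Definition traceless {K : fieldType} {n : nat} : {pred 'M[K]_n} :=
  [pred M : 'M[K]_n | \tr M == 0].

Record sl (K : fieldType) (n : nat) :=
  Sl { sl_val :> 'M[K]_n; sl_valP : sl_val \in traceless }.

Section SlLie.
Variables (K : fieldType) (n : nat).

Fact traceless_submod : subsemimod_closed (@traceless K n).
Proof.
split; last by move=> a M /eqP M0; rewrite inE mxtraceZ M0 mulr0.
split; first by rewrite inE mxtrace0.
by move=> M N /eqP M0 /eqP N0; rewrite inE mxtraceD M0 N0 addr0.
Qed.

HB.instance Definition _ :=
  GRing.isSubmodClosed.Build K 'M[K]_n (@traceless K n) traceless_submod.
HB.instance Definition _ := [isSub for @sl_val K n].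
HB.instance Definition _ := [Choice of sl K n by <:].
HB.instance Definition _ := [SubChoice_isSubLmodule of sl K n by <:].

Fact comm_traceless (x y : 'M[K]_n) : x *m y - y *m x \in traceless.
Proof. by rewrite inE linearB /= mxtrace_mulC subrr. Qed.

Definition sl_bracket (x y : sl K n) : sl K n :=
  Sl (comm_traceless (sl_val x) (sl_val y)).

Fact sl_bracketDl a (x x' y : sl K n) :
  sl_bracket (a *: x + x') y = a *: sl_bracket x y + sl_bracket x' y.
Proof.
apply: val_inj => /=.
by rewrite mulmxDl mulmxDr -scalemxAl -scalemxAr scalerBr opprD addrACA.
Qed.

Fact sl_bracketDr a (x y y' : sl K n) :
  sl_bracket x (a *: y + y') = a *: sl_bracket x y + sl_bracket x y'.
Proof.
apply: val_inj => /=.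
by rewrite mulmxDl mulmxDr -scalemxAl -scalemxAr scalerBr opprD addrACA.
Qed.

Fact sl_bracketxx (x : sl K n) : sl_bracket x x = 0.
Proof. by apply: val_inj; rewrite /= subrr. Qed.

Fact sl_jacobi (x y z : sl K n) :
  sl_bracket x (sl_bracket y z) + sl_bracket y (sl_bracket z x)
    + sl_bracket z (sl_bracket x y) = 0.
Proof.
apply: val_inj => /=; move: (sl_val x) (sl_val y) (sl_val z) => {x y z} x y z.
rewrite !mulmxBl !mulmxBr !mulmxA !opprB.
set a := x *m y *m z; set b := x *m z *m y; set c := y *m z *m x.
set d := z *m y *m x; set e := y *m x *m z; set f := z *m x *m y.
move: a b c d e f => a b c d e f.
by apply/matrixP => i j; rewrite !mxE; ring.
Qed.

HB.instance Definition _ := Lmodule_isLie.Build K (sl K n)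
  sl_bracketDl sl_bracketDr sl_bracketxx sl_jacobi.

End SlLie.

(* The universal enveloping algebra [uea L] is the quotient of the free        *)
(* associative unital algebra on the set [L] by the linearity of [ugen] and    *)
(* ugen [x, y] = ugen x * ugen y - ugen y * ugen x.                            *)
Inductive uterm (K L : Type) :=
| UGen of L
| UCst of K
| UAdd of uterm K L & uterm K L
| UMul of uterm K L & uterm K L.
Arguments UGen {K L}.
Arguments UCst {K L}.

Section UEA.
Variables (K : fieldType) (L : lieAlgType K).
Implicit Types (s t : uterm K L) (x y : L) (a b : K).

HB.instance Definition _ := gen_eqMixin (uterm K L).
HB.instance Definition _ := gen_choiceMixin (uterm K L).

Inductive urel : uterm K L -> uterm K L -> Prop :=
| ur_refl s : urel s s
| ur_sym s t : urel s t -> urel t s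
| ur_trans s t r : urel s t -> urel t r -> urel s r
| ur_congD s s' t t' : urel s s' -> urel t t' -> urel (UAdd s t) (UAdd s' t')
| ur_congM s s' t t' : urel s s' -> urel t t' -> urel (UMul s t) (UMul s' t')
| ur_addC s t : urel (UAdd s t) (UAdd t s)
| ur_addA s t u : urel (UAdd s (UAdd t u)) (UAdd (UAdd s t) u)
| ur_add0 s : urel (UAdd (UCst 0) s) s
| ur_mulA s t u : urel (UMul s (UMul t u)) (UMul (UMul s t) u)
| ur_mul1 s : urel (UMul (UCst 1) s) s
| ur_mulDl s t u : urel (UMul (UAdd s t) u) (UAdd (UMul s u) (UMul t u))
| ur_mulDr s t u : urel (UMul u (UAdd s t)) (UAdd (UMul u s) (UMul u t))
| ur_mul0 s : urel (UMul (UCst 0) s) (UCst 0)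
| ur_cstD a b : urel (UCst (a + b)) (UAdd (UCst a) (UCst b))
| ur_cstM a b : urel (UCst (a * b)) (UMul (UCst a) (UCst b))
| ur_cstC a s : urel (UMul (UCst a) s) (UMul s (UCst a))
| ur_lin a x y :
    urel (UGen (a *: x + y)) (UAdd (UMul (UCst a) (UGen x)) (UGen y))
| ur_lie x y :
    urel (UGen (bracket x y))
      (UAdd (UMul (UGen x) (UGen y))
         (UMul (UCst (-1)) (UMul (UGen y) (UGen x)))).

Definition urelb : rel (uterm K L) := fun s t => `[< urel s t >].

Fact urelb_refl : reflexive urelb.
Proof. by move=> s; apply/asboolP; exact: ur_refl. Qed.
Fact urelb_sym : symmetric urelb.
Proof. by move=> s t; apply/asboolP/asboolP => /ur_sym. Qed.
Fact urelb_trans : transitive urelb.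
Proof.
by move=> t s u /asboolP st /asboolP tu; apply/asboolP; exact: ur_trans tu.
Qed.

Canonical urel_equiv := EquivRel urelb urelb_refl urelb_sym urelb_trans.

Definition uea : Type := {eq_quot urel_equiv}.
HB.instance Definition _ := Choice.on uea.

Definition ucls (s : uterm K L) : uea := \pi_({eq_quot urel_equiv}) s.
Definition urep (u : uea) : uterm K L := repr (u : {eq_quot urel_equiv}).

Lemma urepK : cancel urep ucls.
Proof. by move=> u; rewrite /ucls reprK. Qed.

Lemma ucls_eq s t : ucls s = ucls t <-> urel s t.
Proof.
split=> [/eqmodP /asboolP //|st].
by apply/eqmodP; apply/asboolP.
Qed.

Lemma urel_rep s : urel (urep (ucls s)) s.
Proof. by apply/ucls_eq; rewrite urepK. Qed.

Lemma uclsP (P : uea -> Prop) : (forall s, P (ucls s)) -> forall u, P u.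
Proof. by move=> Ps u; rewrite -(urepK u). Qed.

Definition uzero := ucls (UCst 0).
Definition uone := ucls (UCst 1).
Definition uadd (u v : uea) := ucls (UAdd (urep u) (urep v)).
Definition umul (u v : uea) := ucls (UMul (urep u) (urep v)).
Definition uscale a (u : uea) := ucls (UMul (UCst a) (urep u)).
Definition uopp (u : uea) := uscale (-1) u.

Lemma uaddE s t : uadd (ucls s) (ucls t) = ucls (UAdd s t).
Proof. by apply/ucls_eq/ur_congD; exact: urel_rep. Qed.
Lemma umulE s t : umul (ucls s) (ucls t) = ucls (UMul s t).
Proof. by apply/ucls_eq/ur_congM; exact: urel_rep. Qed.
Lemma uscaleE a s : uscale a (ucls s) = ucls (UMul (UCst a) s).
Proof. by apply/ucls_eq/ur_congM; [exact: ur_refl | exact: urel_rep]. Qed.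

Fact uaddA : associative uadd.
Proof.
elim/uclsP=> s; elim/uclsP=> t; elim/uclsP=> u; rewrite !uaddE.
by apply/ucls_eq/ur_addA.
Qed.
Fact uaddC : commutative uadd.
Proof.
by elim/uclsP=> s; elim/uclsP=> t; rewrite !uaddE; apply/ucls_eq/ur_addC.
Qed.
Fact uadd0 : left_id uzero uadd.
Proof. by elim/uclsP=> s; rewrite !uaddE; apply/ucls_eq/ur_add0. Qed.
Fact uscaleDl u : {morph uscale^~ u : a b / a + b >-> uadd a b}.
Proof.
move=> a b /=; elim/uclsP: u => s; rewrite !uscaleE uaddE; apply/ucls_eq.
apply: ur_trans (ur_mulDl _ _ _); apply: ur_congM (ur_refl _).
exact: ur_cstD.
Qed.
Fact uscale1 : left_id 1 uscale.
Proof. by elim/uclsP=> s; rewrite uscaleE; apply/ucls_eq/ur_mul1. Qed.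
Fact uscale0 u : uscale 0 u = uzero.
Proof. by elim/uclsP: u => s; rewrite uscaleE; apply/ucls_eq/ur_mul0. Qed.
Fact uaddN : left_inverse uzero uopp uadd.
Proof.
by move=> u; rewrite -{2}(uscale1 u) /uopp -uscaleDl addNr uscale0.
Qed.

HB.instance Definition _ := GRing.isZmodule.Build uea uaddA uaddC uadd0 uaddN.

Fact uscaleA a b u : uscale a (uscale b u) = uscale (a * b) u.
Proof.
elim/uclsP: u => s; rewrite !uscaleE; apply/ucls_eq.
apply: ur_trans (ur_mulA _ _ _) _; apply: ur_congM (ur_refl _).
by apply: ur_sym; exact: ur_cstM.
Qed.
Fact uscaleDr : right_distributive uscale +%R.
Proof.
move=> a; elim/uclsP=> s; elim/uclsP=> t.
by rewrite [X in uscale _ X]uaddE !uscaleE [RHS]uaddE; apply/ucls_eq/ur_mulDr.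
Qed.
HB.instance Definition _ := GRing.Zmodule_isLmodule.Build K uea
  uscaleA uscale1 uscaleDr uscaleDl.

Fact umulA : associative umul.
Proof.
elim/uclsP=> s; elim/uclsP=> t; elim/uclsP=> u; rewrite !umulE.
by apply/ucls_eq/ur_mulA.
Qed.
Fact umul1 : left_id uone umul.
Proof. by elim/uclsP=> s; rewrite !umulE; apply/ucls_eq/ur_mul1. Qed.
Fact umulr1 : right_id uone umul.
Proof.
elim/uclsP=> s; rewrite !umulE; apply/ucls_eq.
by apply: ur_trans (ur_mul1 s); apply: ur_sym; exact: ur_cstC.
Qed.
Fact umulDl : left_distributive umul +%R.
Proof.
elim/uclsP=> s; elim/uclsP=> t; elim/uclsP=> u.
by rewrite [ucls _ + _]uaddE !umulE [RHS]uaddE; apply/ucls_eq/ur_mulDl.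
Qed.
Fact umulDr : right_distributive umul +%R.
Proof.
elim/uclsP=> s; elim/uclsP=> t; elim/uclsP=> u.
by rewrite [ucls _ + _]uaddE !umulE [RHS]uaddE; apply/ucls_eq/ur_mulDr.
Qed.

Fixpoint ueval (A : algType K) (f : L -> A) (s : uterm K L) : A :=
  match s with
  | UGen x => f x
  | UCst a => a%:A
  | UAdd s t => ueval f s + ueval f t
  | UMul s t => ueval f s * ueval f t
  end.

(* The algebra morphism [uea -> A] extending [f]; meaningful when [f] is *)
(* linear and sends the bracket to the commutator (see [ulift_gen],      *)
(* [ulift_linear] and [ulift_monoid_morphism]).                          *)
Definition ulift (A : algType K) (f : L -> A) (u : uea) : A := ueval f (urep u).

Section Lift.
Variables (A : algType K) (f : L -> A).
Hypothesis f_lin : linear f.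
Hypothesis f_lie : forall x y, f (bracket x y) = f x * f y - f y * f x.

Lemma ueval_rel s t : urel s t -> ueval f s = ueval f t.
Proof.
elim=> {s t} //=.
- by move=> s t u _ -> _ ->.
- by move=> s s' t t' _ -> _ ->.
- by move=> s s' t t' _ -> _ ->.
- by move=> s t; rewrite addrC.
- by move=> s t u; rewrite addrA.
- by move=> s; rewrite scale0r add0r.
- by move=> s t u; rewrite mulrA.
- by move=> s; rewrite scale1r mul1r.
- by move=> s t u; rewrite mulrDl.
- by move=> s t u; rewrite mulrDr.
- by move=> s; rewrite scale0r mul0r.
- by move=> a b; rewrite scalerDl.
- by move=> a b; rewrite mulr_algl scalerA.
- by move=> a s; rewrite mulr_algl mulr_algr.
- by move=> a x y; rewrite f_lin mulr_algl.
- by move=> x y; rewrite f_lie mulr_algl scaleN1r.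
Qed.

Lemma ulift_cls s : ulift f (ucls s) = ueval f s.
Proof. exact/ueval_rel/urel_rep. Qed.

Lemma ulift_linear : linear (ulift f).
Proof.
move=> a; elim/uclsP=> s; elim/uclsP=> t.
by rewrite [a *: ucls s]uscaleE [ucls _ + _]uaddE !ulift_cls /= mulr_algl.
Qed.

End Lift.

Fact uone_neq0 : uone != 0.
Proof.
have l0 : linear (fun _ : L => 0 : K^o) by move=> a x y; rewrite scaler0 addr0.
have b0 (x y : L) : 0 = 0 * 0 - 0 * 0 :> K^o by rewrite mul0r subrr.
apply/eqP => /(congr1 (ulift (fun _ => 0 : K^o))).
rewrite !(ulift_cls l0 b0) /= scale1r scale0r => /eqP.
by rewrite oner_eq0.
Qed.

HB.instance Definition _ := GRing.Zmodule_isNzRing.Build uea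
  umulA umul1 umulr1 umulDl umulDr uone_neq0.

Fact uscaleAl a (u v : uea) : a *: (u * v) = a *: u * v.
Proof.
elim/uclsP: u => s; elim/uclsP: v => t.
rewrite [_ * _]umulE ![_ *: _]uscaleE [RHS]umulE.
by apply/ucls_eq/ur_mulA.
Qed.
HB.instance Definition _ := GRing.Lmodule_isLalgebra.Build K uea uscaleAl.
Fact uscaleAr a (u v : uea) : a *: (u * v) = u * (a *: v).
Proof.
elim/uclsP: u => s; elim/uclsP: v => t.
rewrite [_ * _]umulE ![_ *: _]uscaleE [RHS]umulE; apply/ucls_eq.
apply: ur_trans (ur_mulA _ _ _) _; apply: ur_trans (ur_sym (ur_mulA _ _ _)).
by apply: ur_congM (ur_refl _); exact: ur_cstC.
Qed.
HB.instance Definition _ := GRing.Lalgebra_isAlgebra.Build K uea uscaleAr.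

Definition ugen (x : L) : uea := ucls (UGen x).

Lemma ugen_linear : linear ugen.
Proof.
move=> a x y; rewrite [a *: ugen x]uscaleE [RHS]uaddE.
by apply/ucls_eq/ur_lin.
Qed.

Lemma ugen_bracket x y :
  ugen (bracket x y) = ugen x * ugen y - ugen y * ugen x.
Proof.
rewrite -scaleN1r ![_ * _]umulE [_ *: _]uscaleE [RHS]uaddE.
by apply/ucls_eq/ur_lie.
Qed.

Lemma ulift_gen (A : algType K) (f : L -> A) : linear f ->
  (forall x y, f (bracket x y) = f x * f y - f y * f x) ->
  forall x, ulift f (ugen x) = f x.
Proof. by move=> fl fb x; rewrite ulift_cls. Qed.

Lemma ulift_monoid_morphism (A : algType K) (f : L -> A) : linear f ->
  (forall x y, f (bracket x y) = f x * f y - f y * f x) ->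
  monoid_morphism (ulift f).
Proof.
move=> fl fb; split; first by rewrite [1]/(ucls _) ulift_cls //= scale1r.
elim/uclsP=> s; elim/uclsP=> t.
by rewrite [_ * _]umulE !ulift_cls.
Qed.

End UEA.
Arguments ugen {K L}.

(* [tensor V W] is the quotient of the vector space generated by the symbols *)
(* [TPure v w] by bilinearity.                                               *)
Inductive tterm (K V W : Type) :=
| TPure of V & W
| TZero
| TAdd of tterm K V W & tterm K V W
| TScale of K & tterm K V W.
Arguments TZero {K V W}.
Arguments TPure {K V W}.

Section Tensor.
Variables (K : fieldType) (V W : lmodType K).
Implicit Types (s t r : tterm K V W) (v : V) (w : W) (a b : K).

HB.instance Definition _ := gen_eqMixin (tterm K V W).
HB.instance Definition _ := gen_choiceMixin (tterm K V W).

Inductive trel : tterm K V W -> tterm K V W -> Prop :=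
| tr_refl s : trel s s
| tr_sym s t : trel s t -> trel t s
| tr_trans s t r : trel s t -> trel t r -> trel s r
| tr_congD s s' t t' : trel s s' -> trel t t' -> trel (TAdd s t) (TAdd s' t')
| tr_congZ a s s' : trel s s' -> trel (TScale a s) (TScale a s')
| tr_addC s t : trel (TAdd s t) (TAdd t s)
| tr_addA s t r : trel (TAdd s (TAdd t r)) (TAdd (TAdd s t) r)
| tr_add0 s : trel (TAdd TZero s) s
| tr_scaleA a b s : trel (TScale a (TScale b s)) (TScale (a * b) s)
| tr_scale1 s : trel (TScale 1 s) s
| tr_scale0 s : trel (TScale 0 s) TZero
| tr_scaleDr a s t :
    trel (TScale a (TAdd s t)) (TAdd (TScale a s) (TScale a t))
| tr_scaleDl a b s : trel (TScale (a + b) s) (TAdd (TScale a s) (TScale b s))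
| tr_linl a v v' w :
    trel (TPure (a *: v + v') w) (TAdd (TScale a (TPure v w)) (TPure v' w))
| tr_linr a v w w' :
    trel (TPure v (a *: w + w')) (TAdd (TScale a (TPure v w)) (TPure v w')).

Definition trelb : rel (tterm K V W) := fun s t => `[< trel s t >].

Fact trelb_refl : reflexive trelb.
Proof. by move=> s; apply/asboolP; exact: tr_refl. Qed.
Fact trelb_sym : symmetric trelb.
Proof. by move=> s t; apply/asboolP/asboolP => /tr_sym. Qed.
Fact trelb_trans : transitive trelb.
Proof.
by move=> t s r /asboolP st /asboolP tr; apply/asboolP; exact: tr_trans tr.
Qed.

Canonical trel_equiv := EquivRel trelb trelb_refl trelb_sym trelb_trans.

Definition tensor : Type := {eq_quot trel_equiv}.
HB.instance Definition _ := Choice.on tensor.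

Definition tcls (s : tterm K V W) : tensor := \pi_({eq_quot trel_equiv}) s.
Definition trep (x : tensor) : tterm K V W := repr (x : {eq_quot trel_equiv}).

Lemma trepK : cancel trep tcls.
Proof. by move=> x; rewrite /tcls reprK. Qed.

Lemma tcls_eq s t : tcls s = tcls t <-> trel s t.
Proof.
split=> [/eqmodP /asboolP //|st].
by apply/eqmodP; apply/asboolP.
Qed.

Lemma trel_rep s : trel (trep (tcls s)) s.
Proof. by apply/tcls_eq; rewrite trepK. Qed.

Lemma tclsP (P : tensor -> Prop) : (forall s, P (tcls s)) -> forall x, P x.
Proof. by move=> Ps x; rewrite -(trepK x). Qed.

Definition tzero := tcls TZero.
Definition tadd (x y : tensor) := tcls (TAdd (trep x) (trep y)).
Definition tscale a (x : tensor) := tcls (TScale a (trep x)).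
Definition topp (x : tensor) := tscale (-1) x.

Lemma taddE s t : tadd (tcls s) (tcls t) = tcls (TAdd s t).
Proof. by apply/tcls_eq/tr_congD; exact: trel_rep. Qed.
Lemma tscaleE a s : tscale a (tcls s) = tcls (TScale a s).
Proof. by apply/tcls_eq/tr_congZ; exact: trel_rep. Qed.

Fact taddA : associative tadd.
Proof.
elim/tclsP=> s; elim/tclsP=> t; elim/tclsP=> r; rewrite !taddE.
by apply/tcls_eq/tr_addA.
Qed.
Fact taddC : commutative tadd.
Proof.
by elim/tclsP=> s; elim/tclsP=> t; rewrite !taddE; apply/tcls_eq/tr_addC.
Qed.
Fact tadd0 : left_id tzero tadd.
Proof. by elim/tclsP=> s; rewrite !taddE; apply/tcls_eq/tr_add0. Qed.
Fact tscaleDl x : {morph tscale^~ x : a b / a + b >-> tadd a b}.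
Proof.
move=> a b /=; elim/tclsP: x => s; rewrite !tscaleE taddE.
by apply/tcls_eq/tr_scaleDl.
Qed.
Fact tscale1 : left_id 1 tscale.
Proof. by elim/tclsP=> s; rewrite tscaleE; apply/tcls_eq/tr_scale1. Qed.
Fact tscale0 x : tscale 0 x = tzero.
Proof. by elim/tclsP: x => s; rewrite tscaleE; apply/tcls_eq/tr_scale0. Qed.
Fact taddN : left_inverse tzero topp tadd.
Proof. by move=> x; rewrite -{2}(tscale1 x) /topp -tscaleDl addNr tscale0. Qed.

HB.instance Definition _ :=
  GRing.isZmodule.Build tensor taddA taddC tadd0 taddN.

Fact tscaleA a b x : tscale a (tscale b x) = tscale (a * b) x.
Proof. by elim/tclsP: x => s; rewrite !tscaleE; apply/tcls_eq/tr_scaleA. Qed.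
Fact tscaleDr : right_distributive tscale +%R.
Proof.
move=> a; elim/tclsP=> s; elim/tclsP=> t.
rewrite [X in tscale _ X]taddE !tscaleE [RHS]taddE.
by apply/tcls_eq/tr_scaleDr.
Qed.
HB.instance Definition _ := GRing.Zmodule_isLmodule.Build K tensor
  tscaleA tscale1 tscaleDr tscaleDl.

Definition tpure v w : tensor := tcls (TPure v w).

Lemma tpure_linearl w : linear (tpure^~ w).
Proof.
move=> a v v'; rewrite [a *: tpure v w]tscaleE [RHS]taddE.
by apply/tcls_eq/tr_linl.
Qed.
Lemma tpure_linearr v : linear (tpure v).
Proof.
move=> a w w'; rewrite [a *: tpure v w]tscaleE [RHS]taddE.
by apply/tcls_eq/tr_linr.
Qed.

Lemma tensor_ind (P : tensor -> Prop) :
  (forall v w, P (tpure v w)) ->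
  (forall a x y, P x -> P y -> P (a *: x + y)) -> forall x, P x.
Proof.
move=> Pp Pl; have P0 : P 0.
  have := Pl (-1) _ _ (Pp 0 0) (Pp 0 0).
  by rewrite scaleN1r addNr.
elim/tclsP; elim=> [v w||s Ps t Pt|a s Ps]; [exact: Pp|exact: P0| |].
- by rewrite -taddE; have := Pl 1 _ _ Ps Pt; rewrite scale1r.
- by rewrite -tscaleE; have := Pl a _ _ Ps P0; rewrite addr0.
Qed.

Fixpoint teval (Z : lmodType K) (f : V -> W -> Z) s : Z :=
  match s with
  | TPure v w => f v w
  | TZero => 0
  | TAdd s t => teval f s + teval f t
  | TScale a s => a *: teval f s
  end.

(* The linear map [tensor -> Z] sending [tpure v w] to [f v w]; meaningful *)
(* when [f] is bilinear (see [tlift_pure] and [tlift_linear]).             *)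
Definition tlift (Z : lmodType K) (f : V -> W -> Z) (x : tensor) : Z :=
  teval f (trep x).

Section Lift.
Variables (Z : lmodType K) (f : V -> W -> Z).
Hypothesis fl : forall w, linear (f^~ w).
Hypothesis fr : forall v, linear (f v).

Lemma teval_rel s t : trel s t -> teval f s = teval f t.
Proof.
elim=> {s t} //=.
- by move=> s t r _ -> _ ->.
- by move=> s s' t t' _ -> _ ->.
- by move=> a s s' _ ->.
- by move=> s t; rewrite addrC.
- by move=> s t r; rewrite addrA.
- by move=> s; rewrite add0r.
- by move=> a b s; rewrite scalerA.
- by move=> s; rewrite scale1r.
- by move=> s; rewrite scale0r.
- by move=> a s t; rewrite scalerDr.
- by move=> a b s; rewrite scalerDl.
- by move=> a v v' w; rewrite fl.
- by move=> a v w w'; rewrite fr.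
Qed.

Lemma tlift_cls s : tlift f (tcls s) = teval f s.
Proof. exact/teval_rel/trel_rep. Qed.

Lemma tlift_pure v w : tlift f (tpure v w) = f v w.
Proof. exact: tlift_cls. Qed.

Lemma tlift_linear : linear (tlift f).
Proof.
move=> a; elim/tclsP=> s; elim/tclsP=> t.
by rewrite [a *: tcls s]tscaleE [tcls _ + _]taddE !tlift_cls.
Qed.

End Lift.

Lemma tlift_linearf (Z : lmodType K) (f g h : V -> W -> Z) a :
  (forall v w, f v w = a *: g v w + h v w) ->
  forall x, tlift f x = a *: tlift g x + tlift h x.
Proof.
move=> E x; rewrite /tlift; elim: (trep x) => //= [|s -> t ->|b s ->].
- by rewrite scaler0 addr0.
- by rewrite scalerDr addrACA.
- by rewrite scalerDr !scalerA mulrC.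
Qed.

End Tensor.

Lemma ex_functional (K : fieldType) (V : lmodType K) (e : V) : e != 0 ->
  exists2 f : V -> K, linear (f : V -> K^o) & f e = 1.
Proof.
move=> e0.
pose P (S : set V) := ~ S e /\ forall a x y, S x -> S y -> S (a *: x + y).
have [|M [[Me Ml] Mmax]] := @Zorn_bigcup V P.
  move=> F FP Ftot; split=> [[S FS Se]|a x y [S FS Sx] [T FT Ty]].
    by have [] := FP _ FS.
  have [ST|TS] := Ftot _ _ FS FT.
    by exists T => //; have [_] := FP _ FT; apply; [exact: ST|].
  by exists S => //; have [_] := FP _ FS; apply=> //; exact: TS.
have M0 : M 0.
  apply: contrapT => M0; refine (Mmax [set x | M x \/ x = 0]%classic _ _).
    split=> [x|/(_ 0)]; first by left.
    by move=> /(_ (or_intror erefl)).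
  split=> [[//|e0']|a x y]; first by rewrite e0' eqxx in e0.
  case=> [Mx|->] [My|->]; [by left; exact: Ml| |by rewrite scaler0 add0r; left|].
    have [->|a0] := eqVneq (a *: x) 0; first by right; rewrite addr0.
    left; rewrite addr0; have := Ml (a - 1) x x Mx Mx.
    by rewrite scalerBl scale1r subrK.
  by right; rewrite scaler0 addr0.
have MZ a x : M x -> M (a *: x) by move=> Mx; rewrite -[_ *: _]addr0; exact: Ml.
have dec x : exists a : K, M (x - a *: e).
  apply: contrapT => nx.
  have Mx : ~ M x by move=> Mx; apply: nx; exists 0; rewrite scale0r subr0.
  refine (Mmax [set y | exists b : K, M (y - b *: x)]%classic _ _).
    split=> [y My|/(_ x)]; first by exists 0; rewrite scale0r subr0.
    by move=> /(_ _)/Mx; apply; exists 1; rewrite scale1r subrr.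
  split=> [[b Mb]|a y z [b Mb] [c Mc]].
    have [b0|b0] := eqVneq b 0; first by rewrite b0 scale0r subr0 in Mb.
    apply: nx; exists b^-1; have := MZ (- b^-1) _ Mb.
    by rewrite scalerBr scalerA mulNr mulVf // scaleN1r opprK scaleNr addrC.
  exists (a * b + c); have := Ml a _ _ Mb Mc.
  by rewrite scalerBr scalerA addrACA -opprD -scalerDl.
have uni a : M (a *: e) -> a = 0.
  move=> Ma; apply/eqP/negP => /negP a0; apply: Me.
  by have := MZ a^-1 _ Ma; rewrite scalerA mulVf // scale1r.
have [f fP] := choice dec.
exists f => [a x y|].
  apply/eqP; rewrite -subr_eq0; apply/eqP/uni.
  have := Ml (-1) _ _ (fP (a *: x + y)) (Ml a _ _ (fP x) (fP y)).
  rewrite scaleN1r opprB scalerBr scalerA (addrACA (a *: x)) -opprD -scalerDl.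
  by rewrite addrA subrK -scalerBl.
apply/eqP; rewrite eq_sym -subr_eq0; apply/eqP/uni.
by rewrite scalerBl scale1r; exact: fP.
Qed.

Section TensorAlgebra.
Variables (K : fieldType) (A B : algType K).
Local Notation AB := (tensor A B).

Definition tone : AB := tpure 1 1.
Definition tmul (x y : AB) : AB :=
  tlift (fun a b => tlift (fun c d => tpure (a * c) (b * d)) y) x.

Fact tmul_innerl (a : A) (b d : B) :
  linear (fun c : A => tpure (a * c) (b * d) : AB).
Proof. by move=> k c c'; rewrite mulrDr -scalerAr tpure_linearl. Qed.
Fact tmul_innerr (a c : A) (b : B) :
  linear (fun d : B => tpure (a * c) (b * d) : AB).
Proof. by move=> k d d'; rewrite mulrDr -scalerAr tpure_linearr. Qed.

Fact tmul_linearr x : linear (tmul x).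
Proof.
move=> k y z; rewrite /tmul; apply: tlift_linearf => a b.
by rewrite tlift_linear // => [d|c]; [exact: tmul_innerl|exact: tmul_innerr].
Qed.

Fact tmul_outerl y b :
  linear (fun a : A => tlift (fun c d => tpure (a * c) (b * d)) y : AB).
Proof.
move=> k a a'; apply: tlift_linearf => c d.
by rewrite mulrDl -scalerAl tpure_linearl.
Qed.
Fact tmul_outerr y a :
  linear (fun b : B => tlift (fun c d => tpure (a * c) (b * d)) y : AB).
Proof.
move=> k b b'; apply: tlift_linearf => c d.
by rewrite mulrDl -scalerAl tpure_linearr.
Qed.

Fact tmul_linearl y : linear (tmul^~ y).
Proof.
by apply: tlift_linear => [b|a]; [exact: tmul_outerl|exact: tmul_outerr].
Qed.

Fact tmul_pure a b c d : tmul (tpure a b) (tpure c d) = tpure (a * c) (b * d).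
Proof.
rewrite /tmul tlift_pure => [|{}b|{}a];
  [|exact: tmul_outerl|exact: tmul_outerr].
by rewrite tlift_pure => [//|{}d|{}c]; [exact: tmul_innerl|exact: tmul_innerr].
Qed.

Fact tmulA : associative tmul.
Proof.
move=> x y z; elim/tensor_ind: x => [a b|k x x' Hx Hx']; last first.
  by rewrite !tmul_linearl Hx Hx'.
elim/tensor_ind: y => [c d|k y y' Hy Hy']; last first.
  by rewrite [tmul (_ + _) z]tmul_linearl !tmul_linearr tmul_linearl Hy Hy'.
elim/tensor_ind: z => [e f|k z z' Hz Hz']; last first.
  by rewrite !tmul_linearr Hz Hz'.
by rewrite !tmul_pure !mulrA.
Qed.
Fact tmul1 : left_id tone tmul.
Proof.
elim/tensor_ind=> [a b|k x y Hx Hy]; first by rewrite tmul_pure !mul1r.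
by rewrite tmul_linearr Hx Hy.
Qed.
Fact tmulr1 : right_id tone tmul.
Proof.
elim/tensor_ind=> [a b|k x y Hx Hy]; first by rewrite tmul_pure !mulr1.
by rewrite tmul_linearl Hx Hy.
Qed.
Fact tmulDl : left_distributive tmul +%R.
Proof. by move=> x y z; have := tmul_linearl z 1 x y; rewrite /= !scale1r. Qed.
Fact tmulDr : right_distributive tmul +%R.
Proof. by move=> x y z; have := tmul_linearr x 1 y z; rewrite /= !scale1r. Qed.
Fact tone_neq0 : tone != 0.
Proof.
have [f fl f1] := ex_functional (oner_neq0 A).
have [g gl g1] := ex_functional (oner_neq0 B).
pose h a b : K^o := f a * g b.
have hl b : linear (h^~ b).
  move=> k a a'; rewrite /h fl mulrDl; congr (_ + _).
  exact: esym (mulrA _ _ _).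
have hr a : linear (h a).
  by move=> k b b'; rewrite /h gl mulrDr; congr (_ + _); exact: mulrCA.
apply/eqP => /(congr1 (tlift h)).
have -> : tlift h 0 = 0 by exact: (tlift_cls hl hr TZero).
by rewrite (tlift_pure hl hr) /h f1 g1 mulr1 => /eqP; rewrite oner_eq0.
Qed.

HB.instance Definition _ := GRing.Zmodule_isNzRing.Build (tensor A B)
  tmulA tmul1 tmulr1 tmulDl tmulDr tone_neq0.

Fact tscaleAl k (x y : AB) : k *: (x * y) = k *: x * y.
Proof.
have := tmul_linearl y k x 0; rewrite /= addr0 => E.
by rewrite [RHS]E [tmul 0 y](mul0r y) addr0.
Qed.
HB.instance Definition _ :=
  GRing.Lmodule_isLalgebra.Build K (tensor A B) tscaleAl.
Fact tscaleAr k (x y : AB) : k *: (x * y) = x * (k *: y).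
Proof.
have := tmul_linearr x k y 0; rewrite /= addr0 => E.
by rewrite [RHS]E [tmul x 0](mulr0 x) addr0.
Qed.
HB.instance Definition _ :=
  GRing.Lalgebra_isAlgebra.Build K (tensor A B) tscaleAr.

Lemma tpureM (a c : A) (b d : B) :
  tpure a b * tpure c d = tpure (a * c) (b * d) :> AB.
Proof. exact: tmul_pure. Qed.

End TensorAlgebra.

(* [fps V] stands for V[[xi, eta]]: [coef f i j] is the coefficient of        *)
(* xi^i eta^j.  The (xi, eta)-adically completed tensor product over          *)
(* K[[xi, eta]] of [fps V] and [fps W] is [fps (tensor V W)].                 *)
Record fps (V : Type) := Fps { coef : nat -> nat -> V }.

Section FpsBasic.
Variable V : Type.

HB.instance Definition _ := gen_eqMixin (fps V).
HB.instance Definition _ := gen_choiceMixin (fps V).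

Lemma fpsP (f g : fps V) : (forall i j, coef f i j = coef g i j) <-> f = g.
Proof.
split=> [|-> //]; case: f g => [f] [g] /= fg; congr Fps.
by apply/funext => i; apply/funext => j.
Qed.

End FpsBasic.

Definition fmap (V W : Type) (phi : V -> W) (f : fps V) : fps W :=
  Fps (fun i j => phi (coef f i j)).

Section FpsZmod.
Variable V : zmodType.
Implicit Types f g : fps V.

Definition fzero : fps V := Fps (fun _ _ => 0).
Definition fopp f : fps V := Fps (fun i j => - coef f i j).
Definition fadd f g : fps V := Fps (fun i j => coef f i j + coef g i j).

Fact faddA : associative fadd.
Proof. by move=> f g h; apply/fpsP => i j /=; rewrite addrA. Qed.
Fact faddC : commutative fadd.
Proof. by move=> f g; apply/fpsP => i j /=; rewrite addrC. Qed.
Fact fadd0 : left_id fzero fadd.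
Proof. by move=> f; apply/fpsP => i j /=; rewrite add0r. Qed.
Fact faddN : left_inverse fzero fopp fadd.
Proof. by move=> f; apply/fpsP => i j /=; rewrite addNr. Qed.

HB.instance Definition _ :=
  GRing.isZmodule.Build (fps V) faddA faddC fadd0 faddN.

Definition fmonom (a b : nat) (v : V) : fps V :=
  Fps (fun i j => if (i == a) && (j == b) then v else 0).
Definition fconst (v : V) : fps V := fmonom 0 0 v.

Lemma coefD f g i j : coef (f + g) i j = coef f i j + coef g i j.
Proof. by []. Qed.
Lemma coefN f i j : coef (- f) i j = - coef f i j.
Proof. by []. Qed.
Lemma coef0 i j : coef (0 : fps V) i j = 0.
Proof. by []. Qed.

Lemma triangle_sum (F : nat -> nat -> nat -> V) n :
  \sum_(p < n.+1) \sum_(k < p.+1) F k (p - k)%N (n - p)%N =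
  \sum_(k < n.+1) \sum_(m < (n - k).+1) F k m (n - k - m)%N.
Proof.
transitivity (\sum_(p < n.+1) \sum_(k < n.+1 | (k <= p)%N)
    F k (p - k)%N (n - p)%N).
  apply: eq_bigr => p _.
  by rewrite (big_ord_narrow_leq (leq_ord p)); apply: eq_bigr.
rewrite (exchange_big_dep predT) //=; apply: eq_bigr => k _.
rewrite -(big_mkord (fun p => (k <= p)%N) (fun p => F k (p - k)%N (n - p)%N)).
rewrite -(big_mkord predT (fun m => F k m (n - k - m)%N)).
have kn : (k <= n)%N by rewrite -ltnS ltn_ord.
rewrite (big_cat_nat _ (n := k)) //=; last exact: leqW.
rewrite big_nat_cond big_pred0 ?add0r; last first.
  by move=> p; rewrite leq0n /=; case: ltngtP.
rewrite -{1}(add0n k) big_addn subSn //.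
rewrite big_mkcond /=; apply: eq_bigr => m _.
by rewrite leq_addl addnK subnDA subnAC.
Qed.

End FpsZmod.

Section FpsLmod.
Variables (K : fieldType) (V : lmodType K).

Definition fscale (a : K) (f : fps V) : fps V :=
  Fps (fun i j => a *: coef f i j).

Fact fscaleA a b f : fscale a (fscale b f) = fscale (a * b) f.
Proof. by apply/fpsP => i j /=; rewrite scalerA. Qed.
Fact fscale1 : left_id 1 fscale.
Proof. by move=> f; apply/fpsP => i j /=; rewrite scale1r. Qed.
Fact fscaleDr : right_distributive fscale +%R.
Proof. by move=> a f g; apply/fpsP => i j /=; rewrite scalerDr. Qed.
Fact fscaleDl f : {morph fscale^~ f : a b / a + b}.
Proof. by move=> a b; apply/fpsP => i j /=; rewrite scalerDl. Qed.

HB.instance Definition _ := GRing.Zmodule_isLmodule.Build K (fps V)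
  fscaleA fscale1 fscaleDr fscaleDl.

Lemma coefZ a (f : fps V) i j : coef (a *: f) i j = a *: coef f i j.
Proof. by []. Qed.

End FpsLmod.

Section FpsRing.
Variable A : nzRingType.
Implicit Types f g h : fps A.

Definition fone : fps A := fconst 1.
Definition fmul f g : fps A := Fps (fun i j =>
  \sum_(k < i.+1) \sum_(l < j.+1) coef f k l * coef g (i - k) (j - l)).

Fact fmulA : associative fmul.
Proof.
move=> f g h; apply/fpsP => i j /=; symmetry.
pose G k m r := \sum_(l < j.+1) \sum_(n < (j - l).+1)
  coef f k l * (coef g m n * coef h r (j - l - n)).
transitivity (\sum_(p < i.+1) \sum_(k < p.+1) G k (p - k)%N (i - p)%N).
  apply: eq_bigr => p _; rewrite /G.
  transitivity (\sum_(q < j.+1) \sum_(k < p.+1) \sum_(l < q.+1)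
      coef f k l * (coef g (p - k) (q - l) * coef h (i - p) (j - q))).
    apply: eq_bigr => q _; rewrite mulr_suml; apply: eq_bigr => k _.
    by rewrite mulr_suml; apply: eq_bigr => l _; rewrite mulrA.
  rewrite exchange_big; apply: eq_bigr => k _ /=.
  exact: (triangle_sum (fun l n r =>
    coef f k l * (coef g (p - k) n * coef h (i - p) r))).
rewrite triangle_sum; apply: eq_bigr => k _; rewrite /G exchange_big /=.
apply: eq_bigr => l _; rewrite mulr_sumr; apply: eq_bigr => m _.
by rewrite mulr_sumr.
Qed.
Fact fmul1 : left_id fone fmul.
Proof.
move=> f; apply/fpsP => i j /=.
rewrite big_ord_recl big_ord_recl /= mul1r !subn0 big1 ?addr0 => [|l _].
  by rewrite big1 ?addr0 // => k _; rewrite big1 // => l _; rewrite /= mul0r.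
by rewrite /= mul0r.
Qed.
Fact fmulr1 : right_id fone fmul.
Proof.
move=> f; apply/fpsP => i j /=.
rewrite big_ord_recr big_ord_recr /= !subnn mulr1 big1 ?add0r => [|k _].
  rewrite big1 ?add0r // => l _.
  by rewrite subn_eq0 leqNgt ltn_ord /= mulr0.
rewrite big1 // => l _.
by rewrite subn_eq0 leqNgt ltn_ord /= mulr0.
Qed.
Fact fmulDl : left_distributive fmul +%R.
Proof.
move=> f g h; apply/fpsP => i j /=; rewrite -big_split; apply: eq_bigr => k _.
by rewrite -big_split; apply: eq_bigr => l _; rewrite mulrDl.
Qed.
Fact fmulDr : right_distributive fmul +%R.
Proof.
move=> f g h; apply/fpsP => i j /=; rewrite -big_split; apply: eq_bigr => k _.
by rewrite -big_split; apply: eq_bigr => l _; rewrite mulrDr.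
Qed.
Fact fone_neq0 : fone != 0.
Proof.
apply/eqP => /fpsP /(_ 0%N 0%N) /= /eqP; exact/negP/oner_neq0.
Qed.

HB.instance Definition _ := GRing.Zmodule_isNzRing.Build (fps A)
  fmulA fmul1 fmulr1 fmulDl fmulDr fone_neq0.

Lemma coefM f g i j : coef (f * g) i j =
  \sum_(k < i.+1) \sum_(l < j.+1) coef f k l * coef g (i - k) (j - l).
Proof. by []. Qed.

Lemma coefX_eq0 f n i j :
  coef f 0 0 = 0 -> (i + j < n)%N -> coef (f ^+ n) i j = 0.
Proof.
move=> f0; elim: n i j => // n IHn i j ijn; rewrite exprS coefM.
apply: big1 => k _; apply: big1 => l _.
have [/eqP|kl0] := posnP (k + l)%N.
  by rewrite addn_eq0 => /andP[/eqP-> /eqP->]; rewrite f0 mul0r.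
by rewrite IHn ?mulr0 //; move: (ltn_ord k) (ltn_ord l); lia.
Qed.

Definition funit : pred (fps A) :=
  fun f => `[< exists g : fps A, g * f = 1 /\ f * g = 1 >].
Definition finv f : fps A :=
  if pselect (exists g : fps A, g * f = 1 /\ f * g = 1) is left fg
  then projT1 (cid fg) else f.

Fact fmulVr : {in funit, left_inverse 1 finv *%R}.
Proof.
move=> f /asboolP fu; rewrite /finv; case: pselect => // fg.
by case: (cid fg) => g [].
Qed.
Fact fdivrr : {in funit, right_inverse 1 finv *%R}.
Proof.
move=> f /asboolP fu; rewrite /finv; case: pselect => // fg.
by case: (cid fg) => g [].
Qed.
Fact funitP f g : g * f = 1 /\ f * g = 1 -> funit f.
Proof. by move=> fg; apply/asboolP; exists g. Qed.
Fact finv_out : {in [predC funit], finv =1 id}.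
Proof. by move=> f /asboolP nf; rewrite /finv; case: pselect. Qed.

HB.instance Definition _ := GRing.NzRing_hasMulInverse.Build (fps A)
  fmulVr fdivrr funitP finv_out.

Definition xi : fps A := fmonom 1 0 1.
Definition eta : fps A := fmonom 0 1 1.

End FpsRing.
Arguments xi {A}.
Arguments eta {A}.

Section FpsAlg.
Variables (K : fieldType) (A : algType K).
Implicit Types f g : fps A.

Fact fscaleAl (a : K) f g : a *: (f * g) = a *: f * g.
Proof.
apply/fpsP => i j; rewrite coefZ !coefM scaler_sumr; apply: eq_bigr => k _.
by rewrite scaler_sumr; apply: eq_bigr => l _; rewrite coefZ scalerAl.
Qed.
HB.instance Definition _ := GRing.Lmodule_isLalgebra.Build K (fps A) fscaleAl.
Fact fscaleAr (a : K) f g : a *: (f * g) = f * (a *: g).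
Proof.
apply/fpsP => i j; rewrite coefZ !coefM scaler_sumr; apply: eq_bigr => k _.
by rewrite scaler_sumr; apply: eq_bigr => l _; rewrite coefZ scalerAr.
Qed.
HB.instance Definition _ := GRing.Lalgebra_isAlgebra.Build K (fps A) fscaleAr.

(* exp(f) and ln(f), meaningful when f, resp. f - 1, has no constant term:    *)
(* its n-th power then has no term of degree < n (see [coefX_eq0]), so that   *)
(* each coefficient of the exponential, resp. logarithmic, series is the      *)
(* finite sum below.                                                          *)
Definition fexp f : fps A := Fps (fun i j =>
  \sum_(0 <= n < (i + j).+1) (n`!%:R)^-1 *: coef (f ^+ n) i j).
Definition fln f : fps A := Fps (fun i j =>
  \sum_(1 <= n < (i + j).+1) ((-1) ^+ n.+1 / n%:R) *: coef ((f - 1) ^+ n) i j).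

End FpsAlg.

Section CompletedTensor.
Variable K : fieldType.

(* The image of (f, g) in the completed tensor product. *)
Definition ctens (V W : lmodType K) (f : fps V) (g : fps W) :
    fps (tensor V W) :=
  Fps (fun i j => \sum_(k < i.+1) \sum_(l < j.+1)
    tpure (coef f k l) (coef g (i - k) (j - l))).

(* The continuous K[[xi, eta]]-linear extension of [phi] to power series. *)
Definition fext (V W : zmodType) (phi : V -> fps W) (f : fps V) : fps W :=
  Fps (fun i j => \sum_(k < i.+1) \sum_(l < j.+1)
    coef (phi (coef f k l)) (i - k) (j - l)).

(* The completed tensor product of continuous K[[xi, eta]]-linear maps, which *)
(* are determined by their values on constant series.                         *)
Definition ctmap (V V' W W' : lmodType K)
    (phi : fps V -> fps V') (psi : fps W -> fps W') :
    fps (tensor V W) -> fps (tensor V' W') :=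
  fext (tlift (fun v w => ctens (phi (fconst v)) (psi (fconst w)))).

(* The canonical isomorphism V (x) (W (x) Z) -> (V (x) W) (x) Z. *)
Definition tassoc (V W Z : lmodType K) (x : tensor V (tensor W Z)) :
    tensor (tensor V W) Z :=
  tlift (fun v => tlift (fun w z => tpure (tpure v w) z)) x.

End CompletedTensor.

Notation "f '⊗' g" := (ctens f g) (at level 41, right associativity) :
  ring_scope.

Section Twist.
Variables (K : fieldType) (A : algType K).

(* The coproduct and counit of a Hopf algebra over K[[xi, eta]] with          *)
(* underlying algebra [fps A]; twisting and the twist equations involve no    *)
(* other structure map.                                                       *)
Record coalgOps := CoalgOps {
  comul : fps A -> fps (tensor A A);
  counit : fps A -> fps K^o
}.

(* F_12 (Delta (x) id)(F) = F_23 (id (x) Delta)(F), with the right-hand side  *)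
(* transported to (A (x) A) (x) A; in the last two equations, 1 is the unit   *)
(* of K (x) A = A, resp. of A (x) K = A.                                      *)
Definition is_twist (H : coalgOps) (F : fps (tensor A A)) : Prop :=
  [/\ F \is a GRing.unit,
      (F ⊗ 1) * ctmap (comul H) id F
        = fmap (@tassoc K A A A) ((1 ⊗ F) * ctmap id (comul H) F),
      ctmap (counit H) id F = 1
    & ctmap id (counit H) F = 1].

Definition twisted (H : coalgOps) (F : fps (tensor A A)) : coalgOps :=
  CoalgOps (fun x => F * comul H x * F^-1) (counit H).

End Twist.

Section UeaHopf.
Variables (K : fieldType) (L : lieAlgType K).
Local Notation U := (uea L).

Definition uprim (x : L) : tensor U U := tpure (ugen x) 1 + tpure 1 (ugen x).

Lemma uprim_linear : linear uprim.
Proof.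
move=> a x y; rewrite /uprim ugen_linear tpure_linearl tpure_linearr.
by rewrite scalerDr addrACA.
Qed.

Lemma uprim_bracket x y :
  uprim (bracket x y) = uprim x * uprim y - uprim y * uprim x.
Proof.
rewrite /uprim ugen_bracket !mulrDl !mulrDr !tpureM !mul1r !mulr1.
set a := ugen x; set b := ugen y.
have E1 c d : tpure (c - d) 1 = tpure c 1 - tpure d 1 :> tensor U U.
  by rewrite -scaleN1r addrC tpure_linearl scaleN1r addrC.
have E2 c d : tpure 1 (c - d) = tpure 1 c - tpure 1 d :> tensor U U.
  by rewrite -scaleN1r addrC tpure_linearr scaleN1r addrC.
rewrite E1 E2; set p := tpure (a * b) 1; set q := tpure (b * a) 1.
set r := tpure 1 (a * b); set s := tpure 1 (b * a).
set u := tpure a b; set v := tpure b a.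
rewrite (addrC v r) (addrACA p u r v) (addrC u s) (addrACA q v s u) (addrC v u).
by rewrite opprD [RHS]addrACA subrr addr0 opprD [RHS]addrACA.
Qed.

Definition uea_comul : U -> tensor U U := ulift uprim.
Definition uea_counit : U -> K^o := ulift (fun _ => 0 : K^o).

Lemma uea_comul_gen x :
  uea_comul (ugen x) = tpure (ugen x) 1 + tpure 1 (ugen x).
Proof. exact: (ulift_gen uprim_linear uprim_bracket). Qed.

Definition ueaOps : coalgOps U := CoalgOps (fmap uea_comul) (fmap uea_counit).

End UeaHopf.

Section SL3.
Variable R : realType.
Local Notation C := R[i].
Local Notation U := (uea (sl C 3)).

Let i1 : 'I_3 := @Ordinal 3 0 isT.
Let i2 : 'I_3 := @Ordinal 3 1 isT.
Let i3 : 'I_3 := @Ordinal 3 2 isT.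

Fact delta_traceless (a b : 'I_3) : a != b -> delta_mx a b \in @traceless C 3.
Proof.
move=> ab; rewrite inE /mxtrace big1 // => i _; rewrite mxE.
by case: eqP => // ->; rewrite (negPf ab).
Qed.

Fact mxtrace_delta (a : 'I_3) : \tr (delta_mx a a : 'M[C]_3) = 1.
Proof.
rewrite /mxtrace (bigD1 a) //= mxE eqxx big1 ?addr0 // => i /negPf ia.
by rewrite mxE ia.
Qed.

Definition h13_mx : 'M[C]_3 := 2^-1 *: (delta_mx i1 i1 - delta_mx i3 i3).
Definition hperp_mx : 'M[C]_3 :=
  2^-1 *: (delta_mx i1 i1 - 2 *: delta_mx i2 i2 + delta_mx i3 i3).

Fact h13_traceless : h13_mx \in traceless.
Proof. by rewrite inE mxtraceZ linearB /= !mxtrace_delta subrr mulr0. Qed.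
Fact hperp_traceless : hperp_mx \in traceless.
Proof.
rewrite inE mxtraceZ mxtraceD linearB /= mxtraceZ !mxtrace_delta mulr1.
by rewrite addrAC subrr mulr0.
Qed.

Definition inU (x : sl C 3) : fps U := fconst (ugen x).

Definition e12 := inU (Sl (@delta_traceless i1 i2 isT)).
Definition e13 := inU (Sl (@delta_traceless i1 i3 isT)).
Definition e23 := inU (Sl (@delta_traceless i2 i3 isT)).
Definition e21 := inU (Sl (@delta_traceless i2 i1 isT)).
Definition e32 := inU (Sl (@delta_traceless i3 i2 isT)).
Definition h13 := inU (Sl h13_traceless).
Definition hperp := inU (Sl hperp_traceless).

Definition hgam (gamma : C) : fps U := h13 + gamma *: hperp.

Definition sigma : fps U := fln (1 + xi * e13).

Definition Ftw (gamma : C) : fps (tensor U U) :=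
  fexp (xi * (e12 ⊗ (e23 * fexp ((2^-1 * (3 * gamma - 1)) *: sigma))))
    * fexp (hgam gamma ⊗ sigma).

Definition FJPplus : fps (tensor U U) :=
  fexp (- (2 / 3) *: (hperp ⊗ fln ((1 + eta * e21) * fexp (2 *: sigma)))).

Definition FJPminus : fps (tensor U U) :=
  fexp ((2 / 3) *:
    (hperp ⊗
       fln ((1 + eta * (e32 - xi * hgam (-1) * e12)) * fexp (2 *: sigma)))).

Definition Usl3 : coalgOps U := ueaOps (sl C 3).

End SL3.

(* Main.v *)
(* A group-like argument governs every Jordanian factor. Let Delta be the          *)
(* coproduct of a Hopf algebra, k primitive, and let T = 1 mod (xi, eta) satisfy   *)
(* Delta T = s (x) T + (T - s) (x) 1 with [k, s] = 0 and [k, T - s] = T - s.       *)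
(* Conjugation by J = exp(k (x) ln T) multiplies (T - s) (x) 1 by 1 (x) T, hence   *)
(* turns Delta T into T (x) T and Delta (ln T) into a primitive element; this      *)
(* makes J a twist. It applies with T = 1 + xi e13, s = 1, k = h(gamma) to the     *)
(* untwisted coproduct, and with T = (1 + eta v) e^(2 sigma), s = e^(2 sigma),     *)
(* k = -+ 2/3 h_perp to the coproduct twisted by F(gamma), gamma = +-1, as soon    *)
(* as Delta_F v = v (x) e^(-2 sigma) + 1 (x) v. The latter is a computation of     *)
(* nilpotent adjoint actions, for v = e21, resp. v = e32 - xi h(-1) e12.           *)
(*                                                                                 *)
(* The extension factor exp(u (x) y) is a twist because u (x) y (x) 1 and          *)
(* 1 (x) u (x) y generate a Heisenberg algebra, whose central term accounts for    *)
(* the difference between the two sides of the cocycle equation. Finally, twists   *)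
(* compose: a twist of the algebra twisted by F, times F, is a twist.              *)

Require Import Defs.
From mathcomp Require Import all_boot all_order all_algebra.
From mathcomp Require Import complex reals.
From mathcomp Require Import ring zify ssrAC.
Import GRing.Theory.
Local Open Scope ring_scope.

Set Implicit Arguments.
Unset Strict Implicit.
Unset Printing Implicit Defensive.

(** Write F(gamma) = X J with J = exp(h(gamma) ⊗ sigma) and X the extension factor. By
    [is_twist_comp] each half of the theorem splits into three cocycle statements: J is a twist, X
    is a twist after J, and the parabolic factor is a twist after X J. The first and the last are
    instances of [jordanian_twist], the middle one of [extension_twist].

    The last one needs the coproduct twisted by F(gamma) on three elements. The element sigma
    becomes primitive ([ejtw_jsig]), so each e^(c sigma) is group-like. The element h_perp stays
    primitive ([ejtw_cartan]), because it commutes with h(gamma) and e13 and has opposite weights on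
    e12 and e23. For v, conjugation by J produces an extra term, and the adjoint action of the
    exponent of X, whose third power kills the terms involved, removes exactly that term
    ([ejtw_lower], [ejtw_upper], through [fexp_conj_cancel]). This uses [e12, e21] = h(1), resp.
    [e23, e32] = h(-1), which is where gamma = 1 and gamma = -1 come from; the factors -2/3 and 2/3
    normalise h_perp so that v has weight one. Then [parabolic_twist] concludes.

    Identities between series are checked modulo every power (xi, eta)^N, where exp and ln are
    polynomials; continuous algebra morphisms over K[[xi, eta]] are compared on constant series.
    [fexp_ln1p] and [fexp_inj] make exp and ln inverse to each other. *)

(** * Congruence of power series modulo powers of (xi, eta) *)

Section Congruence.
Variable V : zmodType.
Implicit Types f g h : fps V.

(* Congruence modulo (xi, eta)^N. *)
Definition feq N f g :=
  forall i j, (i + j < N)%N -> coef f i j = coef g i j.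

Lemma feq_refl N f : feq N f f.
Proof. by []. Qed.

Lemma feq_of_eq N f g : f = g -> feq N f g.
Proof. by move=> ->. Qed.

Lemma feq_sym N f g : feq N f g -> feq N g f.
Proof. by move=> fg i j ij; rewrite fg. Qed.

Lemma feq_trans N f g h : feq N f g -> feq N g h -> feq N f h.
Proof. by move=> fg gh i j ij; rewrite fg ?gh. Qed.

Lemma feq_leq N M f g : (N <= M)%N -> feq M f g -> feq N f g.
Proof. by move=> NM fg i j ij; apply: fg; apply: leq_trans NM. Qed.

Lemma feq_eq f g : (forall N, feq N f g) -> f = g.
Proof. by move=> fg; apply/fpsP => i j; apply: (fg (i + j).+1). Qed.

Lemma feqD N f f' g g' : feq N f f' -> feq N g g' -> feq N (f + g) (f' + g').
Proof. by move=> ff gg i j ij; rewrite !Defs.coefD ff ?gg. Qed.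

Lemma feqN N f f' : feq N f f' -> feq N (- f) (- f').
Proof. by move=> ff i j ij; rewrite !Defs.coefN ff. Qed.

Lemma feq_addIl N f f' g g' :
  feq N f f' -> feq N (f + g) (f' + g') -> feq N g g'.
Proof.
by move=> ff fg i j ij; have := fg i j ij; rewrite !Defs.coefD ff // => /addrI.
Qed.

Lemma feq_addIr N f f' g g' :
  feq N g g' -> feq N (f + g) (f' + g') -> feq N f f'.
Proof.
by move=> gg fg i j ij; have := fg i j ij; rewrite !Defs.coefD gg // => /addIr.
Qed.

Lemma feq_sum N (I : Type) (r : seq I) (P : pred I) (F G : I -> fps V) :
  (forall i, P i -> feq N (F i) (G i)) ->
  feq N (\sum_(i <- r | P i) F i) (\sum_(i <- r | P i) G i).
Proof.
move=> FG; elim/big_rec2: _ => // i f g Pi fg.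
exact: feqD (FG i Pi) fg.
Qed.

Lemma feq_sum0 N (I : Type) (r : seq I) (P : pred I) (F : I -> fps V) :
  (forall i, P i -> feq N (F i) 0) -> feq N (\sum_(i <- r | P i) F i) 0.
Proof.
move=> F0; elim/big_ind: _ => // f g f0 g0.
by rewrite -[X in feq N _ X]addr0; apply: feqD.
Qed.

Lemma coef_sum (I : Type) (r : seq I) (P : pred I) (F : I -> fps V) i j :
  coef (\sum_(k <- r | P k) F k) i j = \sum_(k <- r | P k) coef (F k) i j.
Proof. by elim/big_rec2: _ => // k f g _ <-. Qed.

(** Truncation to finitely many monomials is what reduces statements about continuous additive maps
    to monomials. *)
Lemma feq_trunc N f :
  feq N f (\sum_(a < N) \sum_(b < N) fmonom a b (coef f a b)).
Proof.
move=> i j ij; have iN : (i < N)%N by lia. have jN : (j < N)%N by lia.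
rewrite coef_sum (bigD1 (Ordinal iN)) //= coef_sum (bigD1 (Ordinal jN)) //=.
rewrite !eqxx /= big1 ?addr0 => [|b bj]; last first.
  by rewrite -(inj_eq val_inj) /= in bj; rewrite [j == b]eq_sym (negPf bj).
rewrite big1 ?addr0 // => a ai; rewrite coef_sum big1 // => b _ /=.
by rewrite -(inj_eq val_inj) /= in ai; rewrite [i == a]eq_sym (negPf ai).
Qed.

End Congruence.

(** * Continuous additive maps *)

Record cadd (V W : zmodType) (phi : fps V -> fps W) : Prop := Cadd {
  caddD : forall f g, phi (f + g) = phi f + phi g;
  cadd_feq : forall N f g, feq N f g -> feq N (phi f) (phi g)
}.

Section Cadd.
Variables (V W : zmodType).
Implicit Types phi psi : fps V -> fps W.

Lemma cadd0 phi : cadd phi -> phi 0 = 0.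
Proof.
by case=> phiD _; apply: (@addrI _ (phi 0)); rewrite -phiD !addr0.
Qed.

Lemma caddN phi : cadd phi -> forall f, phi (- f) = - phi f.
Proof.
move=> cphi f; apply: (@addrI _ (phi f)).
by rewrite -(caddD cphi) !subrr cadd0.
Qed.

Lemma cadd_sum phi : cadd phi ->
  forall (I : Type) (r : seq I) (P : pred I) (F : I -> fps V),
  phi (\sum_(i <- r | P i) F i) = \sum_(i <- r | P i) phi (F i).
Proof.
move=> cphi I r P F; elim/big_rec2: _ => [|i f g _ <-]; first exact: cadd0.
exact: (caddD cphi).
Qed.

(** Modulo (xi, eta)^N every series is a finite sum of monomials, and both maps respect the
    congruence and the sum. *)
Lemma cadd_ext phi psi : cadd phi -> cadd psi ->
  (forall i j v, phi (fmonom i j v) = psi (fmonom i j v)) ->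
  forall f, phi f = psi f.
Proof.
move=> cphi cpsi E f; apply: feq_eq => N.
apply: feq_trans (cadd_feq cphi (@feq_trunc _ N f)) _.
apply: feq_trans (feq_sym (cadd_feq cpsi (@feq_trunc _ N f))).
rewrite !cadd_sum //; apply: feq_sum => i _; rewrite !cadd_sum //.
by apply: feq_sum => j _; rewrite E.
Qed.

End Cadd.

Lemma cadd_id (V : zmodType) : cadd (fun f : fps V => f).
Proof. by []. Qed.

Lemma cadd_comp (V W Z : zmodType) (phi : fps W -> fps Z) (psi : fps V -> fps W) :
  cadd phi -> cadd psi -> cadd (fun f => phi (psi f)).
Proof.
move=> cphi cpsi; split=> [f g|N f g fg].
  by rewrite (caddD cpsi) (caddD cphi).
exact: (cadd_feq cphi (cadd_feq cpsi fg)).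
Qed.

Lemma cadd_mull (A : nzRingType) (V : zmodType) (g : fps A) (phi : fps V -> fps A) :
  cadd phi -> cadd (fun f => g * phi f).
Proof.
move=> cphi; split=> [f f'|N f f' ff]; first by rewrite (caddD cphi) mulrDr.
move=> i j ij; rewrite !Defs.coefM; apply: eq_bigr => k _; apply: eq_bigr => l _.
by rewrite (cadd_feq cphi ff) //; lia.
Qed.

Lemma cadd_mulr (A : nzRingType) (V : zmodType) (g : fps A) (phi : fps V -> fps A) :
  cadd phi -> cadd (fun f => phi f * g).
Proof.
move=> cphi; split=> [f f'|N f f' ff]; first by rewrite (caddD cphi) mulrDl.
move=> i j ij; rewrite !Defs.coefM; apply: eq_bigr => k _; apply: eq_bigr => l _.
by rewrite (cadd_feq cphi ff) //; have := ltn_ord k; have := ltn_ord l; lia.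
Qed.

Section FeqRing.
Variable A : nzRingType.
Implicit Types f g : fps A.

Lemma feqM N f f' g g' : feq N f f' -> feq N g g' -> feq N (f * g) (f' * g').
Proof.
move=> ff gg; apply: feq_trans (cadd_feq (cadd_mull f (@cadd_id A)) gg) _.
exact: (cadd_feq (cadd_mulr g' (@cadd_id A)) ff).
Qed.

(* Membership in the ideal (xi, eta), where exp and ln(1 + .) converge. *)
Definition small f := coef f 0 0 = 0.

Lemma smallP f : small f <-> feq 1 f 0.
Proof.
split=> [f0 i j|/(_ 0%N 0%N isT)//]; rewrite ltnS leqn0 addn_eq0.
by case/andP => /eqP-> /eqP->.
Qed.

Lemma smallM f g : small f -> small (f * g).
Proof. by move=> f0; rewrite /small Defs.coefM !big_ord1 f0 mul0r. Qed.

Lemma smallD f g : small f -> small g -> small (f + g).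
Proof. by rewrite /small Defs.coefD => -> ->; rewrite addr0. Qed.

Lemma smallN f : small f -> small (- f).
Proof. by rewrite /small Defs.coefN => ->; rewrite oppr0. Qed.

Lemma small0 : small (0 : fps A).
Proof. by []. Qed.

Lemma feqX0 f N n : small f -> (N <= n)%N -> feq N (f ^+ n) 0.
Proof. by move=> f0 Nn i j ij; rewrite coefX_eq0 //; apply: leq_trans Nn. Qed.

(** Each factor of a nonzero term has positive degree, so the other one has degree at least one
    lower than the product: the congruence gains one order. *)
Lemma feqM_small N f f' g g' : small f -> small f' -> small g -> small g' ->
  feq N f f' -> feq N g g' -> feq N.+1 (f * g) (f' * g').
Proof.
move=> f0 f'0 g0 g'0 ff gg i j ij; rewrite !Defs.coefM.
apply: eq_bigr => k _; apply: eq_bigr => l _.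
have ki := ltn_ord k; have lj := ltn_ord l.
have [/eqP|kl0] := posnP (k + l)%N.
  by rewrite addn_eq0 => /andP[/eqP-> /eqP->]; rewrite f0 f'0 !mul0r.
have [/eqP|r0] := posnP ((i - k) + (j - l))%N.
  by rewrite addn_eq0 => /andP[/eqP-> /eqP->]; rewrite g0 g'0 !mulr0.
by rewrite ff ?gg //; lia.
Qed.

Lemma fmonomM a b c d (v w : A) :
  fmonom a b v * fmonom c d w = fmonom (a + c) (b + d) (v * w).
Proof.
apply/fpsP => i j; rewrite Defs.coefM /=.
have [/andP[/eqP-> /eqP->]|nij] := boolP ((i == a + c) && (j == b + d))%N.
  have ai : (a < (a + c).+1)%N by lia. have bj : (b < (b + d).+1)%N by lia.
  rewrite (bigD1 (Ordinal ai)) //= (bigD1 (Ordinal bj)) //=.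
  rewrite !addKn !eqxx /= big1 ?addr0 => [|l]; last first.
    by rewrite -(inj_eq val_inj) /= => /negPf->; rewrite mul0r.
  rewrite big1 ?addr0 // => k.
  rewrite -(inj_eq val_inj) /= => /negPf ka; rewrite big1 // => l _.
  by rewrite ka mul0r.
apply: big1 => k _; apply: big1 => l _; have ki := ltn_ord k.
have lj := ltn_ord l.
case: ifP => [/andP[/eqP ka /eqP lb]|_]; last by rewrite mul0r.
case: ifP => [/andP[/eqP kc /eqP ld]|_]; last by rewrite mulr0.
by case/negP: nij; lia.
Qed.

Lemma fconstM (v w : A) : fconst v * fconst w = fconst (v * w).
Proof. exact: fmonomM. Qed.

Lemma xi_exp n : xi ^+ n = fmonom n 0 (1 : A).
Proof. by elim: n => // n IH; rewrite exprS IH fmonomM mulr1. Qed.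

Lemma eta_exp n : eta ^+ n = fmonom 0 n (1 : A).
Proof. by elim: n => // n IH; rewrite exprS IH fmonomM mulr1. Qed.

Lemma fmonomE a b (v : A) : fmonom a b v = xi ^+ a * eta ^+ b * fconst v.
Proof. by rewrite xi_exp eta_exp !fmonomM !mul1r !addn0 add0n. Qed.

Lemma fmonom1_comm a b f : fmonom a b 1 * f = f * fmonom a b 1.
Proof.
move: f; apply: cadd_ext => [||i j v].
- exact: cadd_mull (@cadd_id A).
- exact: cadd_mulr (@cadd_id A).
- by rewrite !fmonomM mulr1 mul1r addnC (addnC b).
Qed.

Lemma xi_comm f : xi * f = f * xi.
Proof. exact: fmonom1_comm. Qed.

Lemma eta_comm f : eta * f = f * eta.
Proof. exact: fmonom1_comm. Qed.

End FeqRing.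

Lemma feqZ (K : fieldType) (V : lmodType K) N (a : K) (f g : fps V) :
  feq N f g -> feq N (a *: f) (a *: g).
Proof. by move=> fg i j ij; rewrite !Defs.coefZ fg. Qed.

Lemma smallZ (K : fieldType) (A : algType K) (a : K) (f : fps A) :
  small f -> small (a *: f).
Proof. by rewrite /small Defs.coefZ => ->; rewrite scaler0. Qed.

(** * Exponential and logarithm *)

Section PowerSeries.
Variables (K : fieldType) (A : algType K).
Implicit Types (f g u w : fps A) (c d : nat -> K).

(** The series with terms c n f^n for [small] f, common to exp, ln and the geometric series. Cutting
    at n = i + j is exact, since f^n has no term of degree below n. *)
Definition fser c f : fps A := Fps (fun i j =>
  \sum_(0 <= n < (i + j).+1) c n *: coef (f ^+ n) i j).

Lemma fser_feq c f N M : small f -> (N <= M)%N ->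
  feq N (fser c f) (\sum_(n < M) c n *: f ^+ n).
Proof.
move=> f0 NM i j ij; rewrite coef_sum /= -(big_mkord predT
  (fun n => coef (c n *: f ^+ n) i j)) /=.
rewrite [RHS](big_cat_nat _ (n := (i + j).+1)) //=; last exact: (leq_trans ij NM).
rewrite [X in _ = _ + X]big_nat_cond [X in _ = _ + X]big1 ?addr0 //.
move=> n /andP[/andP[ijn _] _].
by rewrite coefX_eq0 ?scaler0.
Qed.

Lemma small_fser c f : c 0%N = 0 -> small (fser c f).
Proof. by move=> c0; rewrite /small /= big_nat1 c0 scale0r. Qed.

Lemma eq_fser c d f : c =1 d -> fser c f = fser d f.
Proof. by move=> cd; apply/fpsP => i j /=; apply: eq_bigr => n _; rewrite cd. Qed.

(** An intertwiner of P and Q intertwines their powers, hence any series in them. All conjugations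
    of exponentials below rest on this form, which needs no inverse of X. *)
Lemma fser_comm c P Q X : small P -> small Q -> P * X = X * Q ->
  fser c P * X = X * fser c Q.
Proof.
move=> P0 Q0 PX; have PXn n : P ^+ n * X = X * Q ^+ n.
  elim: n => [|n IH]; first by rewrite mul1r mulr1.
  by rewrite exprSr -mulrA PX mulrA IH -mulrA -exprSr.
apply: feq_eq => N.
apply: feq_trans (feqM (fser_feq c P0 (leqnn N)) (@feq_refl _ N X)) _.
apply: feq_trans (feqM (@feq_refl _ N X) (feq_sym (fser_feq c Q0 (leqnn N)))).
rewrite mulr_suml mulr_sumr; apply: feq_sum => n _.
by rewrite -scalerAl -scalerAr PXn.
Qed.

Lemma fser_const c f : (forall n, c n.+1 = 0) -> fser c f = (c 0%N)%:A.
Proof.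
move=> c0; apply/fpsP => i j /=.
rewrite big_nat_recl // big_nat big1 ?addr0 // => n _.
by rewrite c0 scale0r.
Qed.

Lemma fser_lin c f : small f -> (forall n, c n.+2 = 0) ->
  fser c f = (c 0%N)%:A + c 1%N *: f.
Proof.
move=> f0 c0; apply: feq_eq => N.
apply: feq_trans (fser_feq c f0 (leq_addr 2 N)) _.
rewrite addn2 !big_ord_recl big1 ?addr0 // => n _.
by rewrite /= c0 scale0r.
Qed.

(* D is a derivation, for instance the commutator with a fixed element. *)
Lemma fser_deriv (D : fps A -> fps A) c u : cadd D ->
  (forall a f, D (a *: f) = a *: D f) ->
  (forall f g, D (f * g) = D f * g + f * D g) ->
  small u -> D u * u = u * D u ->
  D (fser c u) = fser (fun n => n.+1%:R * c n.+1) u * D u.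
Proof.
move=> cD DZ DM u0 Du.
have D1 : D 1 = 0.
  by apply: (@addrI _ (D 1)); rewrite addr0 -{3}[1]mulr1 DM mulr1 mul1r.
have DX n : D (u ^+ n.+1) = n.+1%:R *: (u ^+ n * D u).
  elim: n => [|n IH]; first by rewrite expr0 mul1r scale1r.
  rewrite exprSr DM IH -scalerAl -mulrA Du mulrA -exprSr.
  by rewrite -{2}[u ^+ n.+1 * D u]scale1r -scalerDl -mulrSr.
apply: feq_eq => N.
apply: feq_trans (cadd_feq cD (fser_feq c u0 (leqnSn N))) _.
apply: feq_trans (feqM (feq_sym (fser_feq _ u0 (leqnn N)))
  (@feq_refl _ N (D u))).
rewrite (cadd_sum cD) big_ord_recl DZ expr0 D1 scaler0 add0r mulr_suml.
apply: feq_sum => n _.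
by rewrite DZ DX scalerA -scalerAl /= mulrC.
Qed.

Lemma sum_triangle (V : zmodType) (F : nat -> nat -> V) N :
  \sum_(n < N) \sum_(k < n.+1) F k (n - k)%N
  = \sum_(k < N) \sum_(m < N - k) F k m.
Proof.
case: N => [|N]; first by rewrite !big_ord0.
rewrite (triangle_sum (fun k m _ => F k m)); apply: eq_bigr => k _.
by rewrite subSn // -ltnS.
Qed.

(** Products of truncated series sum over a square, Cauchy products over a triangle; the corner
    between them has order at least N. *)
Lemma feq_square (F : nat -> nat -> fps A) N :
  (forall k m, (N <= k + m)%N -> feq N (F k m) 0) ->
  feq N (\sum_(n < N) \sum_(k < n.+1) F k (n - k)%N)
        (\sum_(k < N) \sum_(m < N) F k m).
Proof.
move=> F0; rewrite sum_triangle; apply: feq_sum => k _.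
rewrite -(big_mkord predT (fun m => F k m)) -(big_mkord predT (fun m => F k m)).
rewrite [X in feq N _ X](big_cat_nat _ (n := (N - k)%N)) ?leq_subr //=.
apply: feq_sym; rewrite -[X in feq N _ X]addr0.
apply: feqD => //; rewrite big_nat_cond; apply: feq_sum0.
by move=> m /andP[/andP[mk _] _]; apply: F0; lia.
Qed.

Lemma fserM c d u : small u ->
  fser c u * fser d u = fser (fun n => \sum_(k < n.+1) c k * d (n - k)%N) u.
Proof.
move=> u0; apply: feq_eq => N.
apply: feq_trans (feqM (fser_feq c u0 (leqnn N)) (fser_feq d u0 (leqnn N))) _.
apply: feq_trans (feq_sym (fser_feq _ u0 (leqnn N))).
pose F k m := c k *: u ^+ k * (d m *: u ^+ m).
have F0 k m : (N <= k + m)%N -> feq N (F k m) 0.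
  move=> km; rewrite /F -scalerAl -scalerAr -exprD.
  rewrite -[X in feq N _ X](scaler0 _ (c k)); apply: feqZ.
  rewrite -[X in feq N _ X](scaler0 _ (d m)).
  by apply: feqZ; apply: feqX0.
rewrite big_distrlr /=; apply: feq_sym; apply: feq_trans (feq_square F0).
apply: feq_sum => n _; rewrite scaler_suml; apply: feq_sum => k _.
by rewrite /F -scalerAl -scalerAr -exprD scalerA subnKC // -ltnS.
Qed.

End PowerSeries.

Lemma fser_morph (K : fieldType) (A B : algType K) (phi : fps A -> fps B) c u :
  cadd phi -> (forall a f, phi (a *: f) = a *: phi f) ->
  phi 1 = 1 -> (forall f g, phi (f * g) = phi f * phi g) ->
  small u -> phi (fser c u) = fser c (phi u).
Proof.
move=> cphi phiZ phi1 phiM u0.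
have phiX n : phi (u ^+ n) = phi u ^+ n.
  by elim: n => // n IH; rewrite !exprS phiM IH.
have pu0 : small (phi u).
  by apply/smallP; rewrite -(cadd0 cphi); apply: (cadd_feq cphi); apply/smallP.
apply: feq_eq => N.
apply: feq_trans (cadd_feq cphi (fser_feq c u0 (leqnn N))) _.
apply: feq_trans (feq_sym (fser_feq _ pu0 (leqnn N))).
rewrite (cadd_sum cphi); apply: feq_sum => n _; by rewrite phiZ phiX.
Qed.

Section ExpLog.
Variables (K : numFieldType) (A : algType K).
Implicit Types (f g u w a b : fps A).

Let natS_neq0 n : n.+1%:R != 0 :> K.
Proof. by rewrite Num.Theory.pnatr_eq0. Qed.

Let fact_neq0 n : n`!%:R != 0 :> K.
Proof. by rewrite Num.Theory.pnatr_eq0 -lt0n fact_gt0. Qed.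

Definition expc n : K := (n`!%:R)^-1.
Definition lnc n : K := (-1) ^+ n.+1 / n%:R.

Lemma expcS n : n.+1%:R * expc n.+1 = expc n.
Proof. by rewrite /expc factS natrM invfM mulrA divff // mul1r. Qed.

Lemma lncS n : n.+1%:R * lnc n.+1 = (-1) ^+ n.
Proof. by rewrite /lnc mulrCA divff // mulr1 !exprS !mulN1r opprK. Qed.

Lemma fexpE f : fexp f = fser expc f.
Proof. by []. Qed.

Lemma flnE f : fln f = fser lnc (f - 1).
Proof.
apply/fpsP => i j /=; rewrite [RHS]big_ltn //.
by rewrite /lnc invr0 mulr0 scale0r add0r.
Qed.

Lemma small_fln f : small (fln f).
Proof. by rewrite flnE; apply: small_fser; rewrite /lnc invr0 mulr0. Qed.

Lemma fexp0 : fexp (0 : fps A) = 1.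
Proof.
apply: feq_eq => N; rewrite fexpE.
apply: feq_trans (fser_feq expc (small0 A) (leqnSn N)) _.
rewrite big_ord_recl big1 ?addr0 => [|n _]; last by rewrite expr0n scaler0.
by rewrite /expc invr1 scale1r.
Qed.

Lemma fln1 : fln (1 : fps A) = 0.
Proof.
apply: feq_eq => N; rewrite flnE subrr.
apply: feq_trans (fser_feq lnc (small0 A) (leqnSn N)) _.
rewrite big_ord_recl big1 ?addr0 => [|n _]; last by rewrite expr0n scaler0.
by rewrite /lnc invr0 mulr0 scale0r.
Qed.

Lemma small_fexpB1 f : small f -> small (fexp f - 1).
Proof.
move=> f0; rewrite /small Defs.coefD /= big_nat1 /expc invr1 scale1r.
by rewrite expr0 /= subrr.
Qed.

Lemma fexp_comm a b f : small a -> small b -> a * f = f * b ->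
  fexp a * f = f * fexp b.
Proof. exact: fser_comm. Qed.

Lemma fln_comm a f : small (a - 1) -> a * f = f * a ->
  fln a * f = f * fln a.
Proof.
move=> a0 af; rewrite flnE; apply: fser_comm => //.
by rewrite mulrBl mulrBr mul1r mulr1 af.
Qed.

Lemma fexpD a b : small a -> small b -> a * b = b * a ->
  fexp (a + b) = fexp a * fexp b.
Proof.
move=> a0 b0 ab; apply: feq_eq => N; rewrite !fexpE.
apply: feq_trans (fser_feq expc (smallD a0 b0) (leqnn N)) _.
apply: feq_trans (feq_sym (feqM (fser_feq expc a0 (leqnn N))
  (fser_feq expc b0 (leqnn N)))).
pose F k m := expc k *: a ^+ k * (expc m *: b ^+ m).
have FE k m : F k m = (expc k * expc m) *: (a ^+ k * b ^+ m).
  by rewrite /F -scalerAl -scalerAr scalerA.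
(* A term of degree below k + m in the product needs degree below k from a^k or below m from b^m. *)
have F0 k m : (N <= k + m)%N -> feq N (F k m) 0.
  move=> km; rewrite FE -[X in feq N _ X](scaler0 _ (expc k * expc m)).
  apply: feqZ => i j ij; rewrite Defs.coefM big1 // => p _; apply: big1 => q _.
  have [pk|kp] := ltnP (p + q)%N k; first by rewrite coefX_eq0 ?mul0r.
  rewrite [coef (b ^+ _) _ _]coefX_eq0 ?mulr0 //.
  by have := ltn_ord p; have := ltn_ord q; lia.
rewrite big_distrlr /=; apply: feq_trans (feq_square F0).
apply: feq_sum => n _; rewrite addrC exprDn_comm; last by rewrite /GRing.comm ab.
rewrite scaler_sumr; apply: feq_sum => k _; rewrite FE -scaler_nat scalerA.
have kn : (k <= n)%N by rewrite -ltnS.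
have -> : expc n * 'C(n, k)%:R = expc k * expc (n - k)%N.
  rewrite /expc -(bin_fact kn) !natrM; have := fact_neq0 k.
  have := fact_neq0 (n - k)%N; have : 'C(n, k)%:R != 0 :> K.
    by rewrite Num.Theory.pnatr_eq0 -lt0n bin_gt0.
  by move=> h1 h2 h3; field; rewrite h1 h2 h3.
rewrite (_ : b ^+ (n - k) * a ^+ k = a ^+ k * b ^+ (n - k)) //.
by apply: commrX; apply: commr_sym; apply: commrX.
Qed.

Lemma fexpVl a : small a -> fexp (- a) * fexp a = 1.
Proof.
move=> a0; rewrite -fexpD ?addNr ?fexp0 //; first exact: smallN.
by rewrite mulNr mulrN.
Qed.

Lemma fexpVr a : small a -> fexp a * fexp (- a) = 1.
Proof.
move=> a0; rewrite -fexpD ?subrr ?fexp0 //; first exact: smallN.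
by rewrite mulNr mulrN.
Qed.

Lemma fexp_unit a : small a -> fexp a \is a GRing.unit.
Proof.
by move=> a0; apply/unitrP; exists (fexp (- a)); rewrite fexpVl ?fexpVr.
Qed.

(** Order by order: if a and b agree modulo (xi, eta)^N, their powers of exponent at least two agree
    one order further ([feqM_small]), so equality of the exponentials forces the linear terms to
    agree one order further too. *)
Lemma fexp_inj a b : small a -> small b -> fexp a = fexp b -> a = b.
Proof.
move=> a0 b0 ab; apply: feq_eq; elim=> // -[_|N IH].
  exact: (feq_trans ((smallP a).1 a0) (feq_sym ((smallP b).1 b0))).
have sX (c : fps A) n : small c -> small (c ^+ n.+1).
  by move=> c0; rewrite exprS; apply: smallM.
have X n : feq N.+2 (a ^+ n.+2) (b ^+ n.+2).
  elim: n => [|n IHn]; first exact: feqM_small.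
  rewrite (exprS a n.+2) (exprS b n.+2).
  exact: (feqM_small a0 b0 (sX _ _ a0) (sX _ _ b0) IH (feq_leq (leqnSn _) IHn)).
have E f : small f ->
    feq N.+2 (fexp f) (1 + f + \sum_(n < N.+2) expc n.+2 *: f ^+ n.+2).
  move=> f0; apply: feq_trans (fser_feq expc f0 (leq_addr 2 N.+2)) _.
  by rewrite addn2 !big_ord_recl /= /expc invr1 !scale1r addrA.
have Ea := E a a0; rewrite ab in Ea.
have Eab := feq_addIr _ (feq_trans (feq_sym Ea) (E b b0)).
apply: feq_addIl (@feq_refl _ _ 1) (Eab _).
by apply: feq_sum => n _; apply: feqZ.
Qed.

Lemma fser_geom u : small u -> (1 + u) * fser (fun n => (-1) ^+ n : K) u = 1.
Proof.
move=> u0.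
have -> : 1 + u = fser (fun n => if n is n'.+2 then 0 else 1 : K) u.
  by rewrite fser_lin // !scale1r.
rewrite fserM // fser_const => [|n]; first by rewrite big_ord1 expr0 mulr1 scale1r.
rewrite 2!big_ord_recl big1 ?addr0 => [|k _]; last by rewrite /= mul0r.
by rewrite /= /bump /= subn0 subn1 exprS !mul1r mulN1r addNr.
Qed.

(** Termwise, D ln(1 + u) is the geometric series in -u times D u, and [fser_geom] sums it. The
    commutation of u with D u is what makes the scalar chain rule valid. *)
Lemma ln1p_deriv (D : fps A -> fps A) u : cadd D ->
  (forall c f, D (c *: f) = c *: D f) ->
  (forall f g, D (f * g) = D f * g + f * D g) ->
  small u -> D u * u = u * D u ->
  (1 + u) * D (fln (1 + u)) = D u.
Proof.
move=> cD DZ DM u0 Du; rewrite flnE [1 + u]addrC addrK addrC (fser_deriv _ cD) //.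
by rewrite (eq_fser _ lncS) mulrA fser_geom // mul1r.
Qed.

Lemma cadd_commutator b : cadd (fun f => b * f - f * b).
Proof.
have cl := cadd_mull b (@cadd_id A); have cr := cadd_mulr b (@cadd_id A).
split=> [f g|N f g fg]; first by rewrite mulrDr mulrDl opprD addrACA.
by apply: feqD; [exact: (cadd_feq cl)|apply: feqN; exact: (cadd_feq cr)].
Qed.

Lemma commutator_ln1p b u w : small u -> b * u = u * b + w -> w * u = u * w ->
  (1 + u) * (b * fln (1 + u) - fln (1 + u) * b) = w.
Proof.
move=> u0 bu wu; pose D f := b * f - f * b.
have Du : D u = w by rewrite /D bu addrC addKr.
rewrite -Du; apply: (ln1p_deriv (D := D)) => //.
- exact: cadd_commutator.
- by move=> c f; rewrite /D -scalerAl -scalerAr scalerBr.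
- by move=> f g; rewrite /D mulrBl mulrBr !mulrA addrA subrK.
- by rewrite Du.
Qed.

Lemma commutator_exp b u w : small u -> b * u = u * b + w -> w * u = u * w ->
  b * fexp u = fexp u * (b + w).
Proof.
move=> u0 bu wu; pose D f := b * f - f * b.
have Du : D u = w by rewrite /D bu addrC addKr.
have : D (fexp u) = fexp u * D u.
  rewrite fexpE (fser_deriv (D := D)) ?(eq_fser _ expcS) //.
  - exact: cadd_commutator.
  - by move=> c f; rewrite /D -scalerAl -scalerAr scalerBr.
  - by move=> f g; rewrite /D mulrBl mulrBr !mulrA addrA subrK.
  - by rewrite Du.
by rewrite Du mulrDr => <-; rewrite /D addrC subrK.
Qed.

End ExpLog.

(** * Conjugation by an exponential with nilpotent adjoint action *)

Section AdLemma.
Variables (K : numFieldType) (A : algType K).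
Implicit Types (f g u w a b : fps A).

(** This is exp(ad a) b = b + [a, b] + [a, [a, b]] / 2 when the third bracket vanishes; the factor 2
    in front of d absorbs the 1/2!. *)
Lemma fexp_conj2 a b c d : small a -> a * b = b * a + c ->
  a * c = c * a + 2 *: d -> a * d = d * a ->
  fexp a * b = (b + c + d) * fexp a.
Proof.
move=> a0 ab ac ad.
have ac' n : a ^+ n.+1 * c = c * a ^+ n.+1 + (n.+1%:R * 2) *: (d * a ^+ n).
  elim: n => [|n IH]; first by rewrite !expr1 mul1r expr0 mulr1.
  rewrite exprS -mulrA IH mulrDr mulrA ac mulrDl -[c * a * _]mulrA -exprS.
  rewrite -addrA; congr (_ + _); rewrite -scalerAl -scalerAr mulrA ad -mulrA.
  by rewrite -exprS -scalerDl; congr (_ *: _); ring.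
have ab' n : a ^+ n.+2 * b = b * a ^+ n.+2 + n.+2%:R *: (c * a ^+ n.+1)
    + (n.+2%:R * n.+1%:R) *: (d * a ^+ n).
  elim: n => [|n IH].
    rewrite expr2 -mulrA ab mulrDr mulrA ab mulrDl ac expr0 expr1 mulr1.
    rewrite -mulrA -!addrA; congr (_ + _); rewrite addrA; congr (_ + _).
      by rewrite scaler_nat mulr2n.
    by rewrite !mulr1.
  (* The numeral is hidden behind p, so that the coefficients become polynomials in one variable for
     [ring]. *)
  have [p pE] : exists p : K, n.+1%:R = p by eexists.
  have n2E : n.+2%:R = p + 1 by rewrite -pE -natr1.
  have n3E : n.+3%:R = p + 2 by rewrite -natr1 n2E -addrA.
  rewrite exprSr -mulrA ab mulrDr mulrA IH ac' pE n2E n3E !mulrDl -mulrA -exprSr.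
  rewrite -!scalerAl -![_ * _ * a]mulrA -!exprSr -!addrA; congr (_ + _).
  rewrite [X in _ + X]addrCA addrA -{2}[c * _]scale1r -!scalerDl.
  by congr (_ *: _ + _ *: _); ring.
apply: feq_eq => N; rewrite fexpE.
apply: feq_trans (feqM (fser_feq (expc K) a0 (leq_addr 2 N)) (@feq_refl _ N b)) _.
rewrite !mulrDl.
have Eb := feqM (@feq_refl _ N b) (fser_feq (expc K) a0 (leq_addr 2 N)).
have Ec := feqM (@feq_refl _ N c) (fser_feq (expc K) a0 (leq_addr 1 N)).
have Ed := feqM (@feq_refl _ N d) (fser_feq (expc K) a0 (leqnn N)).
apply: feq_trans (feq_sym (feqD (feqD Eb Ec) Ed)).
(* The truncations at N + 2, N + 1 and N terms match the index shifts of the parts b, c and d in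
   [ab']; peeling off the low terms leaves three sums over the same range. *)
rewrite addn2 addn1 !big_ord_recl /= !expr0 expr1 /expc !invr1 !scale1r.
set x := \sum_(i < N) _; set y := \sum_(i < N) _; set z := \sum_(i < N) _.
suff xb : x * b = b * x + c * y + d * z.
  apply: feq_of_eq.
  rewrite !mulrDl !mulrDr mul1r !mulr1 ab xb !addrA.
  by rewrite [LHS](ACl (1 * 2 * 4 * 3 * 5 * 6))%AC.
rewrite /x /y /z mulr_suml !mulr_sumr -!big_split /=; apply: eq_bigr => n _.
rewrite -scalerAl ab' !scalerDr !scalerA -!scalerAr -!/(expc K _).
congr (_ + _ *: _ + _ *: _); first by rewrite mulrC expcS.
by rewrite mulrA [expc _ _ * _]mulrC expcS mulrC expcS.
Qed.

End AdLemma.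

(** * The exponential inverts the logarithm *)

Section ExpLnXi.
Variables (K : numFieldType) (A : algType K).
Implicit Types f g : fps A.

(* The Euler derivation xi d/dxi. *)
Let theta f : fps A := Fps (fun i j => i%:R *: coef f i j).

Let theta_cadd : cadd theta.
Proof.
split=> [f g|N f g fg i j ij]; last by rewrite /= fg.
by apply/fpsP => i j; rewrite /= scalerDr.
Qed.

Let thetaM f g : theta (f * g) = theta f * g + f * theta g.
Proof.
apply/fpsP => i j; rewrite Defs.coefD !Defs.coefM /= scaler_sumr -big_split.
apply: eq_bigr => k _ /=; rewrite scaler_sumr -big_split; apply: eq_bigr => l _.
rewrite /= -scalerAl -scalerAr -scalerDl -natrD subnKC //.
by rewrite -ltnS.
Qed.

Let thetaZ (a : K) f : theta (a *: f) = a *: theta f.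
Proof. by apply/fpsP => i j; rewrite /= !scalerA mulrC. Qed.

Let theta_xi : theta xi = xi.
Proof.
apply/fpsP => i j /=; case: ifP => [/andP[/eqP-> _]|_]; rewrite ?scaler0 //.
by rewrite scale1r.
Qed.

Lemma coef_xiM f i j : coef (xi * f) i.+1 j = coef f i j.
Proof.
rewrite Defs.coefM big_ord_recl big1 => [|l _]; last by rewrite /= mul0r.
rewrite big_ord_recl big_ord_recl /= mul1r subSS !subn0 add0r.
rewrite big1 ?addr0 => [|l _]; last by rewrite /= mul0r.
rewrite big1 ?addr0 // => k _; rewrite big1 // => l _.
by rewrite /= mul0r.
Qed.

(** With theta = xi d/dxi, the series G = exp(ln(1 + xi)) satisfies (1 + xi) theta G = xi G. Its
    coefficients therefore obey (m + 1) g_(m+1) + m g_m = g_m with g_0 = 1, which forces g_1 = 1 and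
    all later ones to vanish. *)
Lemma exp_ln_xi n : coef (fexp (fln (1 + xi)) : fps A) n.+1 0 = (n == 0%N)%:R.
Proof.
set L := fln _; set G := fexp L.
have xi0 : small (xi : fps A) by [].
have LE : L = fser (lnc K) xi by rewrite /L flnE [1 + xi]addrC addrK.
have xiC c X : fser c (xi : fps A) * X = X * fser c xi.
  by apply: fser_comm => //; rewrite xi_comm.
have thL : (1 + xi) * theta L = xi.
  by rewrite ln1p_deriv // theta_xi.
have thG : (1 + xi) * theta G = xi * G.
  have -> : theta G = G * theta L.
    rewrite /G !fexpE (fser_deriv (D := theta)) ?(eq_fser _ (@expcS K)) //.
      exact: small_fln.
    by rewrite LE xiC.
  have C : (1 + xi) * G = G * (1 + xi).
    by rewrite mulrDl mulrDr mul1r mulr1 xi_comm.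
  by rewrite mulrA C -mulrA thL xi_comm.
have G0 : coef G 0 0 = 1.
  by rewrite /G /= big_nat1 expr0 /= invr1 scale1r.
have rec m : m.+1%:R *: coef G m.+1 0 + m%:R *: coef G m 0 = coef G m 0.
  have /(congr1 (fun f => coef f m.+1 0)) := thG.
  by rewrite mulrDl mul1r Defs.coefD !coef_xiM.
have nz m : m.+1%:R != 0 :> K by rewrite Num.Theory.pnatr_eq0.
elim: n => [|n IH].
  by have := rec 0%N; rewrite scale0r addr0 scale1r G0.
have := rec n.+1; rewrite IH; case: n {IH} => [|n] /=.
  rewrite scale1r -[RHS]add0r => /addIr /eqP.
  by rewrite scaler_eq0 (negPf (nz _)) => /eqP.
by rewrite scaler0 addr0 => /eqP; rewrite scaler_eq0 (negPf (nz _)) => /eqP.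
Qed.

End ExpLnXi.

Section ExpOfLog.
Variables (K : numFieldType) (A : algType K).
Implicit Types (f g : fps K^o) (u : fps A).

(* Substitution of u for xi and of 0 for eta. *)
Let subst u f : fps A := fser (fun n => coef f n 0) u.

Let subst_cadd u : cadd (subst u).
Proof.
split=> [f g|N f g fg].
  apply/fpsP => i j; rewrite Defs.coefD /= -big_split /=; apply: eq_bigr => n _.
  by rewrite scalerDl.
move=> i j ij; apply: eq_big_nat => n /andP[_ nij].
by rewrite fg // addn0; apply: leq_trans ij.
Qed.

Let substZ u a f : subst u (a *: f) = a *: subst u f.
Proof.
apply/fpsP => i j; rewrite Defs.coefZ /= scaler_sumr; apply: eq_bigr => n _.
by rewrite scalerA.
Qed.

Let subst1 u : small u -> subst u 1 = 1.
Proof. by move=> u0; rewrite /subst fser_const // scale1r. Qed.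

Let substM u f g : small u -> subst u (f * g) = subst u f * subst u g.
Proof.
move=> u0; rewrite /subst fserM //; apply: eq_fser => n.
by rewrite Defs.coefM; apply: eq_bigr => k _; rewrite big_ord1.
Qed.

Let subst_xi u : small u -> subst u xi = u.
Proof.
by move=> u0; rewrite /subst fser_lin //= scale0r add0r scale1r.
Qed.

(** The universal identity in one variable, with scalar coefficients, is transported by the
    continuous morphism that substitutes u for xi. *)
Lemma fexp_ln1p u : small u -> fexp (fln (1 + u)) = 1 + u.
Proof.
move=> u0; have xi0 : small (xi : fps K^o) by [].
have M c f : small f -> subst u (fser c f) = fser c (subst u f).
  move=> f0; apply: fser_morph f0; first exact: subst_cadd.
  - exact: substZ.
  - exact: subst1.
  - by move=> g h; apply: substM.
have <- : subst u (fexp (fln (1 + xi))) = fexp (fln (1 + u)).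
  rewrite !fexpE M; last exact: small_fln.
  rewrite (flnE (1 + xi)) (flnE (1 + u)) (addrC 1 xi) (addrC 1 u) !addrK.
  by rewrite (M _ _ xi0) (subst_xi u0).
rewrite /subst fser_lin // => [|n]; last by rewrite exp_ln_xi.
by rewrite exp_ln_xi scale1r /= big_nat1 expr0 invr1 !scale1r.
Qed.

Lemma fexp_fln (f : fps A) : small (f - 1) -> fexp (fln f) = f.
Proof. by move=> f0; rewrite -{1}(subrK 1 f) addrC fexp_ln1p // addrC subrK. Qed.

Lemma fln_fexp (s : fps A) : small s -> fln (fexp s) = s.
Proof.
move=> s0; apply: fexp_inj => //; first exact: small_fln.
exact: fexp_fln (small_fexpB1 s0).
Qed.

End ExpOfLog.

(** * Completed tensor products *)

Section LinearMaps.
Variables (K : fieldType) (V W : lmodType K) (phi : V -> W).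
Hypothesis phiL : linear phi.

Lemma linear_fun0 : phi 0 = 0.
Proof. by have := phiL (-1) 0 0; rewrite scaler0 addr0 scaleN1r addNr. Qed.

Lemma linear_funD x y : phi (x + y) = phi x + phi y.
Proof. by have := phiL 1 x y; rewrite !scale1r. Qed.

Lemma linear_funZ a x : phi (a *: x) = a *: phi x.
Proof. by have := phiL a x 0; rewrite linear_fun0 !addr0. Qed.

End LinearMaps.

Section CompletedTensorModule.
Variables (K : fieldType) (V W : lmodType K).
Implicit Types (f : fps V) (g : fps W).

Lemma tpure0l (w : W) : tpure (0 : V) w = 0.
Proof. exact: (linear_fun0 (tpure_linearl w)). Qed.

Lemma tpure0r (v : V) : tpure v (0 : W) = 0.
Proof. exact: (linear_fun0 (tpure_linearr v)). Qed.

Lemma ctens_linl a f f' g : (a *: f + f') ⊗ g = a *: (f ⊗ g) + f' ⊗ g.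
Proof.
apply/fpsP => i j; rewrite Defs.coefD Defs.coefZ /= scaler_sumr -big_split /=.
apply: eq_bigr => k _; rewrite scaler_sumr -big_split /=.
by apply: eq_bigr => l _; rewrite tpure_linearl.
Qed.

Lemma ctens_linr a f g g' : f ⊗ (a *: g + g') = a *: (f ⊗ g) + f ⊗ g'.
Proof.
apply/fpsP => i j; rewrite Defs.coefD Defs.coefZ /= scaler_sumr -big_split /=.
apply: eq_bigr => k _; rewrite scaler_sumr -big_split /=.
by apply: eq_bigr => l _; rewrite tpure_linearr.
Qed.

Let linl g : linear (fun f => f ⊗ g). Proof. by move=> a f f'; apply: ctens_linl. Qed.
Let linr f : linear (fun g => f ⊗ g). Proof. by move=> a g g'; apply: ctens_linr. Qed.

Lemma ctens0l g : (0 : fps V) ⊗ g = 0.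
Proof. exact: (linear_fun0 (linl g)). Qed.
Lemma ctens0r f : f ⊗ (0 : fps W) = 0.
Proof. exact: (linear_fun0 (linr f)). Qed.
Lemma ctensDl f f' g : (f + f') ⊗ g = f ⊗ g + f' ⊗ g.
Proof. exact: (linear_funD (linl g)). Qed.
Lemma ctensDr f g g' : f ⊗ (g + g') = f ⊗ g + f ⊗ g'.
Proof. exact: (linear_funD (linr f)). Qed.
Lemma ctensZl a f g : (a *: f) ⊗ g = a *: (f ⊗ g).
Proof. exact: (linear_funZ (linl g)). Qed.
Lemma ctensZr a f g : f ⊗ (a *: g) = a *: (f ⊗ g).
Proof. exact: (linear_funZ (linr f)). Qed.
Lemma ctensNl f g : (- f) ⊗ g = - (f ⊗ g).
Proof. by rewrite -scaleN1r ctensZl scaleN1r. Qed.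
Lemma ctensNr f g : f ⊗ (- g) = - (f ⊗ g).
Proof. by rewrite -scaleN1r ctensZr scaleN1r. Qed.

Lemma cadd_ctensl g : cadd (fun f => f ⊗ g).
Proof.
split=> [f f'|N f f' ff i j ij]; first exact: ctensDl.
apply: eq_bigr => k _; apply: eq_bigr => l _; rewrite ff //.
by have := ltn_ord k; have := ltn_ord l; lia.
Qed.

Lemma cadd_ctensr f : cadd (fun g => f ⊗ g).
Proof.
split=> [g g'|N g g' gg i j ij]; first exact: ctensDr.
apply: eq_bigr => k _; apply: eq_bigr => l _; rewrite gg //.
by lia.
Qed.

Lemma ctens_monom a b c d (v : V) (w : W) :
  fmonom a b v ⊗ fmonom c d w = fmonom (a + c) (b + d) (tpure v w).
Proof.
apply/fpsP => i j /=.
have [/andP[/eqP-> /eqP->]|nij] := boolP ((i == a + c) && (j == b + d))%N.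
  have ai : (a < (a + c).+1)%N by lia. have bj : (b < (b + d).+1)%N by lia.
  rewrite (bigD1 (Ordinal ai)) //= (bigD1 (Ordinal bj)) //=.
  rewrite !addKn !eqxx /= big1 ?addr0 => [|l]; last first.
    by rewrite -(inj_eq val_inj) /= => /negPf->; rewrite tpure0l.
  rewrite big1 ?addr0 // => k.
  rewrite -(inj_eq val_inj) /= => /negPf ka; rewrite big1 // => l _.
  by rewrite ka tpure0l.
apply: big1 => k _; apply: big1 => l _; have ki := ltn_ord k.
have lj := ltn_ord l.
case: ifP => [/andP[/eqP ka /eqP lb]|_]; last by rewrite tpure0l.
case: ifP => [/andP[/eqP kc /eqP ld]|_]; last by rewrite tpure0r.
by case/negP: nij; lia.
Qed.

Lemma fconst_tens (v : V) (w : W) : fconst v ⊗ fconst w = fconst (tpure v w).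
Proof. exact: ctens_monom. Qed.

End CompletedTensorModule.

Section CompletedTensorAlgebra.
Variables (K : fieldType) (A B : algType K).
Implicit Types (f : fps A) (g : fps B).

(** Both sides are additive and continuous in each of the four arguments, so monomials suffice. *)
Lemma ctensM f f' g g' : (f ⊗ g) * (f' ⊗ g') = (f * f') ⊗ (g * g').
Proof.
move: f; apply: cadd_ext => [||a b v]; first 1 last.
- apply: (cadd_comp (phi := fun h => h ⊗ (g * g'))); first exact: cadd_ctensl.
  exact: cadd_mulr.
- move: f'; apply: cadd_ext => [||a' b' v']; first 1 last.
  + apply: (cadd_comp (phi := fun h => h ⊗ (g * g'))); first exact: cadd_ctensl.
    exact: cadd_mull.
  + move: g; apply: cadd_ext => [||c d w]; first 1 last.
    * apply: (cadd_comp (phi := fun h => _ ⊗ h)); first exact: cadd_ctensr.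
      exact: cadd_mulr.
    * move: g'; apply: cadd_ext => [||c' d' w']; first 1 last.
      - apply: (cadd_comp (phi := fun h => _ ⊗ h)); first exact: cadd_ctensr.
        exact: cadd_mull.
      - rewrite !ctens_monom !fmonomM tpureM !ctens_monom.
        by rewrite addnACA (addnACA b).
      - by apply: cadd_mull; exact: cadd_ctensr.
    * by apply: cadd_mulr; exact: cadd_ctensr.
  + by apply: cadd_mull; exact: cadd_ctensl.
- by apply: cadd_mulr; exact: cadd_ctensl.
Qed.

Lemma ctens11 : (1 : fps A) ⊗ (1 : fps B) = 1.
Proof. exact: fconst_tens. Qed.

Lemma ctens_xi_l : (xi : fps A) ⊗ (1 : fps B) = xi.
Proof. exact: ctens_monom. Qed.
Lemma ctens_xi_r : (1 : fps A) ⊗ (xi : fps B) = xi.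
Proof. exact: ctens_monom. Qed.
Lemma ctens_eta_l : (eta : fps A) ⊗ (1 : fps B) = eta.
Proof. exact: ctens_monom. Qed.
Lemma ctens_eta_r : (1 : fps A) ⊗ (eta : fps B) = eta.
Proof. exact: ctens_monom. Qed.

Lemma ctens_xil f g : (xi * f) ⊗ g = xi * (f ⊗ g).
Proof. by rewrite -ctens_xi_l ctensM mul1r. Qed.
Lemma ctens_xir f g : f ⊗ (xi * g) = xi * (f ⊗ g).
Proof. by rewrite -ctens_xi_r ctensM mul1r. Qed.
Lemma ctens_etal f g : (eta * f) ⊗ g = eta * (f ⊗ g).
Proof. by rewrite -ctens_eta_l ctensM mul1r. Qed.
Lemma ctens_etar f g : f ⊗ (eta * g) = eta * (f ⊗ g).
Proof. by rewrite -ctens_eta_r ctensM mul1r. Qed.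

Lemma small_ctensl f g : small f -> small (f ⊗ g).
Proof. by move=> f0; rewrite /small /= !big_ord1 f0 tpure0l. Qed.
Lemma small_ctensr f g : small g -> small (f ⊗ g).
Proof. by move=> g0; rewrite /small /= !big_ord1 g0 tpure0r. Qed.

End CompletedTensorAlgebra.

(** * Continuous algebra morphisms over K[[xi, eta]] *)

(** Linearity over K[[xi, eta]] is expressed by fixing [xi] and [eta]; with continuity it makes the
    map determined by its values on constants ([fmorph_ext]). *)
Record fmorph (K : fieldType) (A B : algType K) (phi : fps A -> fps B) : Prop :=
  Fmorph {
    fmorphP : forall a f g, phi (a *: f + g) = a *: phi f + phi g;
    fmorph1 : phi 1 = 1;
    fmorphM : forall f g, phi (f * g) = phi f * phi g;
    fmorph_feq : forall N f g, feq N f g -> feq N (phi f) (phi g);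
    fmorph_xi : phi xi = xi;
    fmorph_eta : phi eta = eta
  }.

Section Fmorph.
Variables (K : fieldType) (A B C : algType K).
Implicit Types (phi psi : fps A -> fps B).

Lemma fmorphD phi : fmorph phi -> forall f g, phi (f + g) = phi f + phi g.
Proof. by move=> H; apply: (linear_funD (fmorphP H)). Qed.

Lemma fmorphZ phi : fmorph phi -> forall a f, phi (a *: f) = a *: phi f.
Proof. by move=> H; apply: (linear_funZ (fmorphP H)). Qed.

Lemma fmorph_cadd phi : fmorph phi -> cadd phi.
Proof. by move=> H; split; [exact: fmorphD|exact: (fmorph_feq H)]. Qed.

Lemma fmorph0 phi : fmorph phi -> phi 0 = 0.
Proof. by move=> H; apply: cadd0 (fmorph_cadd H). Qed.

Lemma fmorphN phi : fmorph phi -> forall f, phi (- f) = - phi f.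
Proof. by move=> H; apply: caddN (fmorph_cadd H). Qed.

Lemma fmorph_small phi f : fmorph phi -> small f -> small (phi f).
Proof.
move=> H /smallP f0; apply/smallP; rewrite -(fmorph0 H).
exact: (fmorph_feq H f0).
Qed.

Lemma fmorphX phi : fmorph phi -> forall f n, phi (f ^+ n) = phi f ^+ n.
Proof.
move=> H f; elim=> [|n IH]; first by rewrite !expr0 (fmorph1 H).
by rewrite !exprS (fmorphM H) IH.
Qed.

Lemma fmorph_fser phi c u : fmorph phi -> small u ->
  phi (fser c u) = fser c (phi u).
Proof.
move=> H; apply: fser_morph; [exact: fmorph_cadd|exact: fmorphZ| |].
  exact: fmorph1.
exact: fmorphM.
Qed.

Lemma fmorph_ext phi psi : fmorph phi -> fmorph psi ->
  (forall v, phi (fconst v) = psi (fconst v)) -> forall f, phi f = psi f.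
Proof.
move=> Hphi Hpsi E; apply: cadd_ext; [exact: fmorph_cadd..|move=> a b v].
rewrite fmonomE !(fmorphM Hphi) !(fmorphM Hpsi) !fmorphX // E.
by rewrite (fmorph_xi Hphi) (fmorph_xi Hpsi) (fmorph_eta Hphi) (fmorph_eta Hpsi).
Qed.

Lemma fmorph_id : fmorph (@id (fps A)).
Proof. by []. Qed.

Lemma fmorph_comp (chi : fps B -> fps C) phi :
  fmorph chi -> fmorph phi -> fmorph (fun f => chi (phi f)).
Proof.
move=> H H'; split=> [a f g||f g|N f g fg||].
- by rewrite (fmorphP H') (fmorphP H).
- by rewrite (fmorph1 H') (fmorph1 H).
- by rewrite (fmorphM H') (fmorphM H).
- exact: (fmorph_feq H (fmorph_feq H' fg)).
- by rewrite (fmorph_xi H') (fmorph_xi H).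
- by rewrite (fmorph_eta H') (fmorph_eta H).
Qed.

Lemma fmorph_conj phi F : fmorph phi -> F \is a GRing.unit ->
  fmorph (fun f => F * phi f * F^-1).
Proof.
move=> H Fu; split=> [a f g||f g|N f g fg||].
- by rewrite (fmorphP H) mulrDr mulrDl -scalerAr -scalerAl.
- by rewrite (fmorph1 H) mulr1 divrr.
- by rewrite (fmorphM H) !mulrA mulrVK.
- by apply: feqM => //; apply: feqM => //; exact: (fmorph_feq H fg).
- by rewrite (fmorph_xi H) -xi_comm mulrK.
- by rewrite (fmorph_eta H) -eta_comm mulrK.
Qed.

Lemma fext_monom (phi : A -> fps B) a b v : phi 0 = 0 ->
  fext phi (fmonom a b v) = fmonom a b 1 * phi v.
Proof.
move=> phi0; apply/fpsP => i j; rewrite Defs.coefM /=.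
apply: eq_bigr => k _; apply: eq_bigr => l _.
by case: ifP => _; rewrite ?mul1r // mul0r phi0.
Qed.

Lemma fext_const (phi : A -> fps B) v : phi 0 = 0 ->
  fext phi (fconst v) = phi v.
Proof. by move=> phi0; rewrite fext_monom // mul1r. Qed.

Lemma fmorph_fext (phi : A -> fps B) : linear phi -> phi 1 = 1 ->
  (forall v w, phi (v * w) = phi v * phi w) -> fmorph (fext phi).
Proof.
move=> phiL phi1 phiM; have phi0 := linear_fun0 phiL.
have L a f g : fext phi (a *: f + g) = a *: fext phi f + fext phi g.
  apply/fpsP => i j; rewrite Defs.coefD Defs.coefZ /= scaler_sumr -big_split.
  apply: eq_bigr => k _; rewrite scaler_sumr -big_split; apply: eq_bigr => l _.
  by rewrite phiL.
have H : cadd (fext phi).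
  split=> [f g|N f g fg i j ij].
    by have := L 1 f g; rewrite !scale1r.
  apply: eq_bigr => k _; apply: eq_bigr => l _; rewrite fg //.
  by have := ltn_ord k; have := ltn_ord l; lia.
split=> //.
- by rewrite fext_const.
- move=> f g; move: f; apply: cadd_ext => [||a b v].
  + by apply: (cadd_comp (phi := fext phi)) => //; apply: cadd_mulr.
  + exact: cadd_mulr.
  move: g; apply: cadd_ext => [||c d w].
  + by apply: (cadd_comp (phi := fext phi)) => //; apply: cadd_mull.
  + exact: cadd_mull.
  rewrite fmonomM !fext_monom // phiM.
  have -> : fmonom (a + c) (b + d) 1 = fmonom a b 1 * fmonom c d (1 : B).
    by rewrite fmonomM mulr1.
  by rewrite -!mulrA; congr (_ * _); rewrite !mulrA fmonom1_comm.
- exact: (cadd_feq H).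
- by rewrite /xi fext_monom // phi1 mulr1.
- by rewrite /eta fext_monom // phi1 mulr1.
Qed.

Lemma fmorph_fmap (phi : A -> B) : linear phi -> phi 1 = 1 ->
  (forall v w, phi (v * w) = phi v * phi w) -> fmorph (fmap phi).
Proof.
move=> phiL phi1 phiM; have phi0 := linear_fun0 phiL.
have phi_sum n (F : 'I_n -> A) : phi (\sum_(k < n) F k) = \sum_(k < n) phi (F k).
  elim/big_rec2: _ => // k x y _ <-; exact: linear_funD.
split.
- by move=> a f g; apply/fpsP => i j; apply: phiL.
- by apply/fpsP => i j /=; case: ifP.
- move=> f g; apply/fpsP => i j; rewrite Defs.coefM /= phi_sum.
  by apply: eq_bigr => k _; rewrite phi_sum; apply: eq_bigr => l _.
- by move=> N f g fg i j ij; rewrite /= fg.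
- by apply/fpsP => i j /=; case: ifP.
- by apply/fpsP => i j /=; case: ifP.
Qed.

Lemma fmap_const (phi : A -> B) v : phi 0 = 0 -> fmap phi (fconst v) = fconst (phi v).
Proof. by move=> phi0; apply/fpsP => i j /=; case: ifP. Qed.

End Fmorph.

Section FmorphTensor.
Variable K : fieldType.

Lemma fconst_linear (V : lmodType K) : linear (@fconst V).
Proof.
move=> a v w; apply/fpsP => i j; rewrite Defs.coefD Defs.coefZ /=.
by case: ifP => _ //; rewrite scaler0 addr0.
Qed.

Lemma fmorph_tensl (A B : algType K) : fmorph (fun f : fps A => f ⊗ (1 : fps B)).
Proof.
split.
- by move=> a f g; rewrite ctens_linl.
- exact: ctens11.
- by move=> f g; rewrite ctensM mulr1.
- by move=> N f g fg; have H := @cadd_ctensl K A B 1; exact (cadd_feq H fg).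
- exact: ctens_xi_l.
- exact: ctens_eta_l.
Qed.

Lemma fmorph_tensr (A B : algType K) : fmorph (fun g : fps B => (1 : fps A) ⊗ g).
Proof.
split.
- by move=> a f g; rewrite ctens_linr.
- exact: ctens11.
- by move=> f g; rewrite ctensM mulr1.
- by move=> N f g fg; have H := @cadd_ctensr K A B 1; exact (cadd_feq H fg).
- exact: ctens_xi_r.
- exact: ctens_eta_r.
Qed.

(** The two legs generate: a constant pure tensor is (v ⊗ 1)(1 ⊗ w), and these span the
    constants. *)
Lemma fmorph_ext_tens (A B C : algType K)
    (phi psi : fps (tensor A B) -> fps C) : fmorph phi -> fmorph psi ->
  (forall f, phi (f ⊗ 1) = psi (f ⊗ 1)) ->
  (forall g, phi (1 ⊗ g) = psi (1 ⊗ g)) -> forall f, phi f = psi f.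
Proof.
move=> Hphi Hpsi El Er; apply: fmorph_ext => //.
elim/tensor_ind => [v w|a x y Ex Ey].
  have -> : fconst (tpure v w) = (fconst v ⊗ 1) * (1 ⊗ fconst w).
    by rewrite ctensM mulr1 mul1r fconst_tens.
  by rewrite (fmorphM Hphi) (fmorphM Hpsi) El Er.
by rewrite fconst_linear (fmorphP Hphi) (fmorphP Hpsi) Ex Ey.
Qed.

Section Ctmap.
Variables (A A' B B' : algType K).
Variables (phi : fps A -> fps A') (psi : fps B -> fps B').
Hypotheses (Hphi : fmorph phi) (Hpsi : fmorph psi).

Let beta (v : A) (w : B) := phi (fconst v) ⊗ psi (fconst w).

Let beta_l w : linear (beta^~ w).
Proof.
by move=> a v v'; rewrite /beta fconst_linear (fmorphP Hphi) ctens_linl.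
Qed.

Let beta_r v : linear (beta v).
Proof.
by move=> a w w'; rewrite /beta fconst_linear (fmorphP Hpsi) ctens_linr.
Qed.

Lemma fmorph_ctmap : fmorph (ctmap phi psi).
Proof.
have L := tlift_linear beta_l beta_r; apply: fmorph_fext => //.
  rewrite [1](_ : _ = tpure 1 1) // (tlift_pure beta_l beta_r) /beta.
  by rewrite (fmorph1 Hphi) (fmorph1 Hpsi) ctens11.
have Lr x a y z : tlift beta (x * (a *: y + z))
    = a *: tlift beta (x * y) + tlift beta (x * z).
  by rewrite mulrDr -scalerAr L.
have Ll x a y z : tlift beta ((a *: y + z) * x)
    = a *: tlift beta (y * x) + tlift beta (z * x).
  by rewrite mulrDl -scalerAl L.
elim/tensor_ind => [v w|a x x' Ex Ex'] y; last first.
  by rewrite Ll L mulrDl -scalerAl Ex Ex'.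
elim/tensor_ind: y => [v' w'|a y y' Ey Ey']; last first.
  by rewrite Lr L mulrDr -scalerAr Ey Ey'.
rewrite tpureM !(tlift_pure beta_l beta_r) /beta ctensM.
by rewrite -!fconstM (fmorphM Hphi) (fmorphM Hpsi).
Qed.

Lemma ctmap_ctens f g : ctmap phi psi (f ⊗ g) = phi f ⊗ psi g.
Proof.
have H := fmorph_ctmap; have b0 := linear_fun0 (tlift_linear beta_l beta_r).
have C (v : A) (w : B) : ctmap phi psi (fconst v ⊗ fconst w)
    = phi (fconst v) ⊗ psi (fconst w).
  by rewrite fconst_tens /ctmap fext_const // (tlift_pure beta_l beta_r).
have -> : f ⊗ g = (f ⊗ 1) * (1 ⊗ g) by rewrite ctensM mulr1 mul1r.
rewrite (fmorphM H).
have -> : ctmap phi psi (f ⊗ 1) = phi f ⊗ 1.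
  move: f; apply: (fmorph_ext (phi := fun f => ctmap phi psi (f ⊗ 1))
    (psi := fun f => phi f ⊗ 1)) => [||v].
  - exact (fmorph_comp (phi := (fun f => f ⊗ 1)) H (@fmorph_tensl _ _)).
  - exact (fmorph_comp (chi := (fun f => f ⊗ 1)) (@fmorph_tensl _ _) Hphi).
  - by rewrite C (fmorph1 Hpsi).
have -> : ctmap phi psi (1 ⊗ g) = 1 ⊗ psi g.
  move: g; apply: (fmorph_ext (phi := fun f => ctmap phi psi (1 ⊗ f))
    (psi := fun f => 1 ⊗ psi f)) => [||v].
  - exact (fmorph_comp (phi := (fun f => 1 ⊗ f)) H (@fmorph_tensr _ _)).
  - exact (fmorph_comp (chi := (fun f => 1 ⊗ f)) (@fmorph_tensr _ _) Hpsi).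
  - by rewrite C (fmorph1 Hphi).
by rewrite ctensM mulr1 mul1r.
Qed.

End Ctmap.

Section Assoc.
Variables (A B C : algType K).

Let gam v (w : B) (z : C) := tpure (tpure (v : A) w) z.

Let gam_l v z : linear (fun w => gam v w z).
Proof. by move=> a w w'; rewrite /gam tpure_linearr tpure_linearl. Qed.
Let gam_r v w : linear (gam v w).
Proof. by move=> a z z'; rewrite /gam tpure_linearr. Qed.

Let ass_l y : linear (fun v => tlift (gam v) y).
Proof.
move=> a v v'; apply: tlift_linearf => w z.
by rewrite /gam tpure_linearl tpure_linearl.
Qed.
Let ass_r v : linear (tlift (gam v)).
Proof. exact: tlift_linear. Qed.

Lemma tassoc_linear : linear (@tassoc K A B C).
Proof. exact: tlift_linear. Qed.

Lemma tassoc_pure v w z : @tassoc K A B C (tpure v (tpure w z)) = tpure (tpure v w) z.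
Proof. by rewrite /tassoc (tlift_pure ass_l ass_r) (tlift_pure (gam_l v) (gam_r v)). Qed.

Lemma tassocM x y : @tassoc K A B C (x * y) = tassoc x * tassoc y.
Proof.
have L := tassoc_linear.
have Lr u a x' y' : tassoc (u * (a *: x' + y'))
    = a *: @tassoc K A B C (u * x') + tassoc (u * y').
  by rewrite mulrDr -scalerAr L.
have Ll u a x' y' : tassoc ((a *: x' + y') * u)
    = a *: @tassoc K A B C (x' * u) + tassoc (y' * u).
  by rewrite mulrDl -scalerAl L.
have P v a (x' y' : tensor B C) : tpure (v : A) (a *: x' + y')
    = a *: tpure v x' + tpure v y'.
  exact: tpure_linearr.
elim/tensor_ind: x => [v x|a x x' Ex Ex']; last first.
  by rewrite Ll L mulrDl -scalerAl Ex Ex'.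
elim/tensor_ind: x => [w z|a x x' Ex Ex']; last first.
  by rewrite P Ll L mulrDl -scalerAl Ex Ex'.
elim/tensor_ind: y => [v' y|a y y' Ey Ey']; last first.
  by rewrite Lr L mulrDr -scalerAr Ey Ey'.
elim/tensor_ind: y => [w' z'|a y y' Ey Ey']; last first.
  by rewrite P Lr L mulrDr -scalerAr Ey Ey'.
by rewrite !tpureM !tassoc_pure !tpureM.
Qed.

Lemma fmorph_assoc : fmorph (fmap (@tassoc K A B C)).
Proof.
apply: fmorph_fmap; [exact: tassoc_linear|exact: tassoc_pure|exact: tassocM].
Qed.

Lemma assoc_ctens f g h : fmap (@tassoc K A B C) (f ⊗ (g ⊗ h)) = (f ⊗ g) ⊗ h.
Proof.
pose al := fmap (@tassoc K A B C); have H : fmorph al := fmorph_assoc.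
rewrite -/al; have t0 := linear_fun0 tassoc_linear.
have Cs v w z : al (fconst v ⊗ (fconst w ⊗ fconst z)) = (fconst v ⊗ fconst w) ⊗ fconst z.
  by rewrite !fconst_tens /al fmap_const // tassoc_pure.
have -> : f ⊗ (g ⊗ h) = (f ⊗ 1) * ((1 ⊗ (g ⊗ 1)) * (1 ⊗ (1 ⊗ h))).
  by rewrite !ctensM !mulr1 !mul1r.
rewrite !(fmorphM H).
have -> : al (f ⊗ 1) = (f ⊗ 1) ⊗ 1.
  move: f; apply: (fmorph_ext (phi := fun f => al (f ⊗ 1))
    (psi := fun f => (f ⊗ 1) ⊗ 1)) => [||v].
  - exact (fmorph_comp (phi := (fun f => f ⊗ 1)) H (@fmorph_tensl _ _)).
  - exact (fmorph_comp (chi := (fun f => f ⊗ 1)) (phi := (fun f => f ⊗ 1))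
      (@fmorph_tensl _ _) (@fmorph_tensl _ _)).
  - by rewrite -Cs ctens11.
have -> : al (1 ⊗ (g ⊗ 1)) = (1 ⊗ g) ⊗ 1.
  move: g; apply: (fmorph_ext (phi := fun g => al (1 ⊗ (g ⊗ 1)))
    (psi := fun f => (1 ⊗ f) ⊗ 1)) => [||v].
  - apply: (fmorph_comp (chi := al) (phi := fun g => 1 ⊗ (g ⊗ 1))) => //.
    exact (fmorph_comp (chi := (fun f => 1 ⊗ f)) (phi := (fun f => f ⊗ 1))
      (@fmorph_tensr _ _) (@fmorph_tensl _ _)).
  - exact (fmorph_comp (chi := (fun f => f ⊗ 1)) (phi := (fun f => 1 ⊗ f))
      (@fmorph_tensl _ _) (@fmorph_tensr _ _)).
  - exact: Cs.
have -> : al (1 ⊗ (1 ⊗ h)) = 1 ⊗ h.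
  move: h; apply: (fmorph_ext (phi := fun g => al (1 ⊗ (1 ⊗ g)))
    (psi := fun f => 1 ⊗ f)) => [||v].
  - apply: (fmorph_comp (chi := al) (phi := fun g => 1 ⊗ (1 ⊗ g))) => //.
    exact (fmorph_comp (chi := (fun f => 1 ⊗ f)) (phi := (fun f => 1 ⊗ f))
      (@fmorph_tensr _ _) (@fmorph_tensr _ _)).
  - exact: fmorph_tensr.
  - by rewrite Cs ctens11.
by rewrite !ctensM !mulr1 !mul1r ctensM mulr1 mul1r.
Qed.

End Assoc.

(** * Composition of twists *)

Section TwistComposition.
Variable A : algType K.
Implicit Types (H : coalgOps A) (F G : fps (tensor A A)).

Definition comul_morph H := fmorph (comul H) /\ fmorph (counit H).

Lemma twisted_morph H F : comul_morph H -> F \is a GRing.unit ->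
  comul_morph (twisted H F).
Proof. by case=> H1 H2 Fu; split=> //; apply: fmorph_conj. Qed.

(** Conjugation by F ⊗ 1 after Delta ⊗ id is an algebra morphism, and so is Delta_F ⊗ id; they agree
    on both legs. *)
Lemma ctmap_twisted_l H F : comul_morph H -> F \is a GRing.unit -> forall G,
  (F ⊗ 1) * ctmap (comul H) id G
    = ctmap (comul (twisted H F)) id G * (F ⊗ (1 : fps A)).
Proof.
move=> Hm Fu G; have [Hc _] := Hm; have [Hc' _] := twisted_morph Hm Fu.
pose F1 := F ⊗ (1 : fps A); have F1u : F1 \is a GRing.unit.
  apply/unitrP; exists (F^-1 ⊗ 1).
  by rewrite /F1 !ctensM mulVr // divrr // mulr1 ctens11.
have C := fmorph_conj (fmorph_ctmap Hc (@fmorph_id _ A)) F1u.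
rewrite -(fmorph_ext_tens C (fmorph_ctmap Hc' (@fmorph_id _ A))).
- by rewrite mulrVK.
- move=> f; rewrite !ctmap_ctens //.
  apply: (mulIr F1u); rewrite mulrVK // /F1 !ctensM /=.
  by rewrite mulrVK.
- move=> g; rewrite !ctmap_ctens //.
  apply: (mulIr F1u); rewrite mulrVK // /F1 !ctensM /= (fmorph1 Hc) mulr1.
  by rewrite divrr // mul1r mulr1 mul1r.
Qed.

Lemma ctmap_twisted_r H F : comul_morph H -> F \is a GRing.unit -> forall G,
  ((1 : fps A) ⊗ F) * ctmap id (comul H) G
    = ctmap id (comul (twisted H F)) G * ((1 : fps A) ⊗ F).
Proof.
move=> Hm Fu G; have [Hc _] := Hm; have [Hc' _] := twisted_morph Hm Fu.
pose F1 := (1 : fps A) ⊗ F; have F1u : F1 \is a GRing.unit.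
  apply/unitrP; exists (1 ⊗ F^-1).
  by rewrite /F1 !ctensM mulVr // divrr // mulr1 ctens11.
have C := fmorph_conj (fmorph_ctmap (@fmorph_id _ A) Hc) F1u.
rewrite -(fmorph_ext_tens C (fmorph_ctmap (@fmorph_id _ A) Hc')).
- by rewrite mulrVK.
- move=> f; rewrite !ctmap_ctens //.
  apply: (mulIr F1u); rewrite mulrVK // /F1 !ctensM /= (fmorph1 Hc) mulr1.
  by rewrite divrr // mul1r mulr1 mul1r.
- move=> g; rewrite !ctmap_ctens //.
  apply: (mulIr F1u); rewrite mulrVK // /F1 !ctensM /=.
  by rewrite mulrVK.
Qed.

(** Moving F ⊗ 1 past (Delta ⊗ id)(G), and 1 ⊗ F past (id ⊗ Delta)(G), replaces Delta by Delta_F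
    there; the equation then factors into the cocycle equations of G and F. *)
Lemma is_twist_comp H F G : comul_morph H ->
  is_twist H F -> is_twist (twisted H F) G -> is_twist H (G * F).
Proof.
move=> Hm [Fu FE Fl Fr] [Gu GE Gl Gr]; have [Hc He] := Hm.
have Ml := fmorph_ctmap Hc (@fmorph_id _ A).
have Mr := fmorph_ctmap (@fmorph_id _ A) Hc.
have Al := fmorph_assoc A A A.
split; first by rewrite unitrMl.
- rewrite (fmorphM Ml) (fmorphM Mr).
  have -> : (G * F) ⊗ (1 : fps A) = (G ⊗ 1) * (F ⊗ 1) by rewrite ctensM mulr1.
  have -> : (1 : fps A) ⊗ (G * F) = (1 ⊗ G) * (1 ⊗ F) by rewrite ctensM mulr1.
  rewrite -[LHS]mulrA (mulrA (F ⊗ 1)) (ctmap_twisted_l Hm Fu) -!mulrA FE.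
  rewrite [LHS]mulrA GE -(fmorphM Al); congr fmap.
  by rewrite [in RHS](mulrA (1 ⊗ F)) (ctmap_twisted_r Hm Fu G) -!mulrA.
- by rewrite (fmorphM (fmorph_ctmap He (@fmorph_id _ A))) Gl Fl mulr1.
- by rewrite (fmorphM (fmorph_ctmap (@fmorph_id _ A) He)) Gr Fr mulr1.
Qed.

End TwistComposition.
End FmorphTensor.

(** * Exponentials in tensor products *)

Section FmorphExp.
Variables (K : numFieldType) (A B : algType K).

Lemma fmorph_fexp (phi : fps A -> fps B) u : fmorph phi -> small u ->
  phi (fexp u) = fexp (phi u).
Proof. by move=> H u0; rewrite !fexpE (fmorph_fser _ H u0). Qed.

Lemma fmorph_fln (phi : fps A -> fps B) f : fmorph phi -> small (f - 1) ->
  phi (fln f) = fln (phi f).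
Proof.
move=> H f0; rewrite !flnE (fmorph_fser _ H f0).
by rewrite (fmorphD H) (fmorphN H) (fmorph1 H).
Qed.

End FmorphExp.

Section TensorExp.
Variables (K : numFieldType) (A B : algType K).

Lemma tensl_fexp (u : fps A) : small u ->
  fexp u ⊗ (1 : fps B) = fexp (u ⊗ 1).
Proof. move=> u0; exact (fmorph_fexp (@fmorph_tensl K A B) u0). Qed.

Lemma tensr_fexp (u : fps B) : small u ->
  (1 : fps A) ⊗ fexp u = fexp (1 ⊗ u).
Proof. move=> u0; exact (fmorph_fexp (@fmorph_tensr K A B) u0). Qed.

Lemma tens_exp_eigen (k x : fps A) (w g : fps B) (c : K) : small w ->
  k * x = x * k + c *: x -> w * g = g * w ->
  fexp (k ⊗ w) * (x ⊗ g) = (x ⊗ (g * fexp (c *: w))) * fexp (k ⊗ w).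
Proof.
move=> w0 kx wg; have cw0 : small (c *: w) by apply: smallZ.
have E : (k ⊗ w) * (x ⊗ g) = (x ⊗ g) * (1 ⊗ (c *: w) + k ⊗ w).
  rewrite mulrDr !ctensM kx ctensDl wg mulr1 -scalerAr ctensZr ctensZl.
  by rewrite addrC.
rewrite (fexp_comm _ _ E); last first.
- by apply: smallD; apply: small_ctensr.
- exact: small_ctensr.
rewrite fexpD; first by rewrite mulrA -tensr_fexp // ctensM mulr1.
- exact: small_ctensr.
- exact: small_ctensr.
- by rewrite !ctensM mul1r mulr1 -scalerAl -scalerAr.
Qed.

(** The adjoint action stops after one step because d commutes with w: this is [fexp_conj2] with
    vanishing quadratic term. *)
Lemma tens_exp_right (k : fps A) (w g d : fps B) : small w ->
  w * g = g * w + d -> w * d = d * w ->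
  fexp (k ⊗ w) * (1 ⊗ g) = (1 ⊗ g + k ⊗ d) * fexp (k ⊗ w).
Proof.
move=> w0 wg wd.
have := @fexp_conj2 K _ (k ⊗ w) (1 ⊗ g) (k ⊗ d) 0; rewrite addr0; apply.
- exact: small_ctensr.
- by rewrite !ctensM mul1r mulr1 wg ctensDr.
- by rewrite !ctensM wd scaler0 addr0.
- by rewrite mulr0 mul0r.
Qed.

End TensorExp.

Section ExpIdentities.
Variables (K : numFieldType) (A : algType K).

(* Here ad(a)(p + r) = c + d and ad(a)^2(p + r) = 2 d, so that p + r - c is   *)
(* exp(-a) (p + r) exp(a).                                                    *)
Lemma fexp_conj_cancel (a p r c d : fps A) : small a ->
  a * p = p * a + c -> a * c = c * a + 2 *: d -> a * d = d * a ->
  a * r = r * a + d ->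
  fexp a * (p + r - c) = (p + r) * fexp a.
Proof.
move=> a0 ap ac ad ar.
have Ep := fexp_conj2 a0 ap ac ad.
have Er : fexp a * r = (r + d + 0) * fexp a.
  by apply: fexp_conj2 => //; rewrite ?scaler0 ?addr0 ?mulr0 ?mul0r.
have Ec : fexp a * c = (c + 2 *: d + 0) * fexp a.
  apply: fexp_conj2 => //; rewrite ?scaler0 ?addr0 ?mulr0 ?mul0r //.
  by rewrite -scalerAl -scalerAr ad.
rewrite mulrBr mulrDr Ep Er Ec -mulrDl -mulrBl; congr (_ * _).
rewrite !addr0 scaler_nat mulr2n opprD opprD !addrA.
rewrite [LHS](ACl (1 * 4 * (2 * 6) * (3 * 7) * (5 * 8)))%AC.
by rewrite /= !subrr !addr0.
Qed.

(** Moving e^X past e^Y costs the central factor e^(Q - P), which turns the e^P of the left side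
    into the e^Q of the right side. *)
Lemma fexp_heisenberg (X Y P Q : fps A) :
  small X -> small Y -> small P -> small Q -> X * Y = Y * X + (Q - P) ->
  X * P = P * X -> X * Q = Q * X -> Y * P = P * Y -> Y * Q = Q * Y ->
  P * Q = Q * P ->
  fexp X * fexp (P + Y) = fexp Y * fexp (X + Q).
Proof.
move=> X0 Y0 P0 Q0 XY XP XQ YP YQ PQ.
have XQP : X * (Q - P) = (Q - P) * X by rewrite mulrBr mulrBl XQ XP.
have YQP : Y * (Q - P) = (Q - P) * Y by rewrite mulrBr mulrBl YQ YP.
have QP0 : small (Q - P) by apply: smallD => //; apply: smallN.
have XeY : fexp X * fexp Y = fexp Y * (fexp (Q - P) * fexp X).
  have XY' : (Y + (Q - P)) * fexp X = fexp X * Y.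
    have := @fexp_conj2 K _ X Y (Q - P) 0 X0 XY; rewrite addr0 => -> //.
    - by rewrite scaler0 addr0.
    - by rewrite mulr0 mul0r.
  rewrite -(fexp_comm (smallD Y0 QP0) Y0 XY') (fexpD Y0 QP0 YQP).
  exact: esym (mulrA _ _ _).
have eXP : fexp X * fexp P = fexp P * fexp X.
  by rewrite -(fexpD X0 P0 XP) -(fexpD P0 X0 (esym XP)) addrC.
have eQ : fexp (Q - P) * fexp P = fexp Q.
  rewrite -(fexpD QP0 P0) ?subrK //; rewrite mulrBl mulrBr PQ; reflexivity.
rewrite (addrC P Y) (addrC X Q) (fexpD Y0 P0 YP) (fexpD Q0 X0 (esym XQ)).
by rewrite mulrA XeY -!mulrA eXP -eQ -!mulrA.
Qed.

End ExpIdentities.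

(** * Jordanian twists and their extensions *)

Section Twists.
Variables (K : numFieldType) (A : algType K) (H : coalgOps A).
Hypothesis Hm : comul_morph H.
Local Notation Delta := (comul H).
Local Notation eps := (counit H).
Local Notation al := (fmap (@tassoc K A A A)).

Let Dm : fmorph Delta. Proof. by case: Hm. Qed.
Let Em : fmorph eps. Proof. by case: Hm. Qed.
Let idm : fmorph (@id (fps A)). Proof. exact: fmorph_id. Qed.
Let D1 := fmorph_ctmap Dm idm.
Let D2 := fmorph_ctmap idm Dm.
Let E1 := fmorph_ctmap Em idm.
Let E2 := fmorph_ctmap idm Em.
Let alm := fmorph_assoc A A A.

(** The last hypothesis lets 1 ⊗ J turn k ⊗ Delta w into k ⊗ (w ⊗ 1 + 1 ⊗ w). Both sides of the
    cocycle equation are then the same ordered product of the exponentials of k ⊗ w ⊗ 1, k ⊗ 1 ⊗ w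
    and 1 ⊗ k ⊗ w. *)
Lemma jordanian_cocycle (k w : fps A) : small w ->
  Delta k = k ⊗ 1 + 1 ⊗ k -> eps k = 0 -> eps w = 0 ->
  fexp (k ⊗ w) * Delta w = (w ⊗ 1 + 1 ⊗ w) * fexp (k ⊗ w) ->
  is_twist H (fexp (k ⊗ w)).
Proof.
move=> w0 Dk ek ew Dw; set J := fexp (k ⊗ w).
have kw0 : small (k ⊗ w) by apply: small_ctensr.
have w1 : small (w ⊗ (1 : fps A)) by apply: small_ctensl.
have w2 : small ((1 : fps A) ⊗ w) by apply: small_ctensr.
split; first exact: fexp_unit.
- rewrite /J (fmorph_fexp D1 kw0) (fmorph_fexp D2 kw0).
  rewrite (ctmap_ctens Dm idm) (ctmap_ctens idm Dm) Dk ctensDl.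
  rewrite (tensl_fexp A kw0).
  have P0 : small (k ⊗ (w ⊗ (1 : fps A) + (1 : fps A) ⊗ w)).
    by apply: small_ctensr; apply: smallD.
  have Q0 : small (k ⊗ Delta w) by apply: small_ctensr; apply: fmorph_small.
  have PQ : (k ⊗ (w ⊗ 1 + 1 ⊗ w)) * (1 ⊗ J) = (1 ⊗ J) * (k ⊗ Delta w).
    by rewrite !ctensM mulr1 mul1r -Dw.
  rewrite -(fexp_comm P0 Q0 PQ) (fmorphM alm) (fmorph_fexp alm P0).
  rewrite (tensr_fexp A kw0) (fmorph_fexp alm); last exact: small_ctensr.
  rewrite ctensDr (fmorphD alm) !assoc_ctens.
  have C1 : ((k ⊗ (1 : fps A)) ⊗ w) * ((1 ⊗ k) ⊗ w) = ((1 ⊗ k) ⊗ w) * ((k ⊗ 1) ⊗ w).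
    by rewrite !ctensM !mulr1 !mul1r.
  have C2 : ((k ⊗ w) ⊗ (1 : fps A)) * ((k ⊗ 1) ⊗ w) = ((k ⊗ 1) ⊗ w) * ((k ⊗ w) ⊗ 1).
    by rewrite !ctensM !mulr1 !mul1r.
  have S1 f : small (f ⊗ w : fps (tensor (tensor A A) A)) by apply: small_ctensr.
  rewrite (fexpD (S1 _) (S1 _) C1) (fexpD (small_ctensl _ kw0) (S1 _) C2).
  exact: mulrA.
- by rewrite (fmorph_fexp E1 kw0) (ctmap_ctens Em idm) ek ctens0l fexp0.
- by rewrite (fmorph_fexp E2 kw0) (ctmap_ctens idm Em) ew ctens0r fexp0.
Qed.

Lemma jordanian_primitive (k s T : fps A) : small (T - 1) ->
  k * s = s * k -> k * (T - s) = (T - s) * k + (T - s) ->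
  Delta T = s ⊗ T + (T - s) ⊗ 1 ->
  fexp (k ⊗ fln T) * Delta (fln T)
    = (fln T ⊗ 1 + 1 ⊗ fln T) * fexp (k ⊗ fln T).
Proof.
move=> T1 ks kt DT; set w := fln T; set J := fexp _.
have w0 : small w by apply: small_fln.
have eT : fexp w = T by apply: fexp_fln.
have kw0 : small (k ⊗ w) by apply: small_ctensr.
have w1 : small (w ⊗ (1 : fps A)) by apply: small_ctensl.
have w2 : small ((1 : fps A) ⊗ w) by apply: small_ctensr.
have wT : w * T = T * w by apply: fln_comm.
have Ju : J \is a GRing.unit by apply: fexp_unit.
have E : J * Delta T = (T ⊗ T) * J.
  have Es : J * (s ⊗ T) = (s ⊗ (T * fexp (0 *: w))) * J.
    by apply: tens_exp_eigen; rewrite ?scale0r ?addr0.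
  have Et : J * ((T - s) ⊗ 1) = ((T - s) ⊗ (1 * fexp (1 *: w))) * J.
    by apply: tens_exp_eigen; rewrite ?scale1r ?mul1r ?mulr1.
  rewrite DT mulrDr Es Et scale0r fexp0 mulr1 scale1r mul1r eT -mulrDl -ctensDl.
  by rewrite addrC subrK.
have C := fmorph_conj Dm Ju.
have : J * Delta w * J^-1 = w ⊗ 1 + 1 ⊗ w.
  rewrite (fmorph_fln C T1) E mulrK //.
  (* T is the exponential of w, so T ⊗ T is the exponential of a sum of commuting terms, and its
     logarithm is that sum. *)
  have -> : T ⊗ T = fexp (w ⊗ 1 + 1 ⊗ w).
    have C12 : (w ⊗ (1 : fps A)) * (1 ⊗ w) = (1 ⊗ w) * (w ⊗ 1).
      by rewrite !ctensM !mulr1 !mul1r.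
    rewrite (fexpD w1 w2 C12) -(tensl_fexp A w0) -(tensr_fexp A w0) eT.
    by rewrite ctensM mulr1 mul1r.
  exact: (fln_fexp (smallD w1 w2)).
by move=> <-; rewrite mulrVK.
Qed.

Lemma jordanian_twist (k s T : fps A) : small (T - 1) ->
  Delta k = k ⊗ 1 + 1 ⊗ k -> eps k = 0 -> eps T = 1 ->
  k * s = s * k -> k * (T - s) = (T - s) * k + (T - s) ->
  Delta T = s ⊗ T + (T - s) ⊗ 1 ->
  is_twist H (fexp (k ⊗ fln T)).
Proof.
move=> T1 Dk ek eT ks kt DT; apply: jordanian_cocycle => //.
- exact: small_fln.
- by rewrite (fmorph_fln Em T1) eT fln1.
- exact: (jordanian_primitive T1 ks kt DT).
Qed.

(** With X = u ⊗ y ⊗ 1, Y = 1 ⊗ u ⊗ y, P = u ⊗ a ⊗ y and Q = u ⊗ b ⊗ y, the cocycle equation reads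
    exp(X) exp(P + Y) = exp(Y) exp(X + Q), and [u, y] = a - b gives [X, Y] = Q - P. *)
Lemma extension_twist (u y a b : fps A) : small u ->
  Delta u = u ⊗ a + 1 ⊗ u -> Delta y = y ⊗ 1 + b ⊗ y ->
  eps u = 0 -> eps y = 0 -> u * y = y * u + (a - b) ->
  a * u = u * a -> a * y = y * a -> b * u = u * b -> b * y = y * b ->
  is_twist H (fexp (u ⊗ y)).
Proof.
move=> u0 Du Dy eu ey uy au ay bu by_.
have uy0 : small (u ⊗ y) by apply: small_ctensl.
split; first exact: fexp_unit.
- rewrite (fmorph_fexp D1 uy0) (fmorph_fexp D2 uy0).
  rewrite (ctmap_ctens Dm idm) (ctmap_ctens idm Dm) Du Dy.
  rewrite (tensl_fexp A uy0) (tensr_fexp A uy0) (fmorphM alm).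
  have S1 : small ((1 : fps A) ⊗ (u ⊗ y)) by apply: small_ctensr.
  have S2 : small (u ⊗ (y ⊗ 1 + b ⊗ y)) by apply: small_ctensl.
  refine (etrans _ (esym (congr2 *%R (fmorph_fexp alm S1) (fmorph_fexp alm S2)))).
  rewrite ctensDr (fmorphD alm) !assoc_ctens ctensDl.
  set X := (u ⊗ y) ⊗ 1; set Y := (1 ⊗ u) ⊗ y.
  set P := (u ⊗ a) ⊗ y; set Q := (u ⊗ b) ⊗ y.
  have X0 : small X by apply: small_ctensl.
  have Y0 : small Y by apply: small_ctensl; apply: small_ctensr.
  have P0 : small P by apply: small_ctensl; apply: small_ctensl.
  have Q0 : small Q by apply: small_ctensl; apply: small_ctensl.
  have YP : Y * P = P * Y by rewrite !ctensM !mulr1 !mul1r au.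
  have YQ : Y * Q = Q * Y by rewrite !ctensM !mulr1 !mul1r bu.
  have XP : X * P = P * X by rewrite !ctensM !mulr1 !mul1r ay.
  have XQ : X * Q = Q * X by rewrite !ctensM !mulr1 !mul1r by_.
  (* a commutes with u and y, hence with their commutator a - b. *)
  have ab : a * b = b * a.
    have : a * (a - b) = (a - b) * a.
      have -> : a - b = u * y - y * u by rewrite uy [RHS]addrC addKr.
      rewrite mulrBr mulrBl !mulrA au ay -mulrA ay -(mulrA y a u) au.
      by rewrite !mulrA.
    by rewrite mulrBr mulrBl => /addrI /oppr_inj.
  have PQ : P * Q = Q * P by rewrite !ctensM ab.
  have XY : X * Y = Y * X + (Q - P).
    rewrite !ctensM !mulr1 !mul1r uy ctensDr ctensDl -addrA.
    rewrite -[LHS]addr0; congr (_ + _).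
    by rewrite ctensDr ctensDl ctensNr ctensNl addrA subrK subrr.
  exact: (fexp_heisenberg X0 Y0 P0 Q0 XY XP XQ YP YQ PQ).
- by rewrite (fmorph_fexp E1 uy0) (ctmap_ctens Em idm) eu ctens0l fexp0.
- by rewrite (fmorph_fexp E2 uy0) (ctmap_ctens idm Em) ey ctens0r fexp0.
Qed.

End Twists.

Lemma addr_cancel3 (V : zmodType) (a p q w z : V) :
  a + q - w - (z - (p - q) - w) = a - z + p.
Proof.
rewrite !opprB addrA subrK !addrA [LHS](ACl (1 * 5 * 3 * (2 * 4)))%AC /=.
by rewrite subrr addr0.
Qed.

(** Used with t = xi and g1, g2, g3 the powers e^(-sigma), e^(-2 sigma), e^(-3 sigma). The
    correction t h x cancels the quadratic term y0 x g3 of [ybar, v] and, through t e g2 = g1 - g2,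
    replaces h g2 by h g1. *)
Lemma upper_relation (K : fieldType) (B : algType K)
    (t e h v x y0 ybar g1 g2 g3 : B) :
  (forall f g : B, f * (t * g) = t * (f * g)) ->
  ybar * v = v * ybar + h * g2 - 2 *: (t * (y0 * (x * g3))) ->
  ybar * h = h * ybar - 2 *: (y0 * g3) -> ybar * x = x * ybar - e * g2 ->
  x * g3 = g3 * x -> t * e * g2 = g1 - g2 ->
  ybar * (v - t * (h * x)) = (v - t * (h * x)) * ybar + h * g1.
Proof.
move=> tC ybv ybh ybx xg teg.
have ybhx : ybar * (h * x) = h * x * ybar - h * (e * g2) - 2 *: (y0 * (x * g3)).
  rewrite mulrA ybh mulrBl -[h * ybar * x]mulrA ybx mulrBr -scalerAl.
  by rewrite -[y0 * _ * x]mulrA -xg -[h * x * ybar]mulrA.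
have hteg : t * (h * (e * g2)) = h * g1 - h * g2.
  by rewrite -tC [t * (e * _)]mulrA teg mulrBr.
rewrite mulrBr mulrBl ybv tC ybhx !mulrBr hteg -[t * (2 *: _)]scalerAr.
by rewrite -[t * (h * x) * ybar]mulrA addr_cancel3.
Qed.

Lemma commutator_mulr (K : fieldType) (B : algType K) (f g u w w' : B) (c : K) :
  f * g = g * f - c *: w -> f * u = u * f -> w * u = w' ->
  f * (g * u) = g * u * f - c *: w'.
Proof. by move=> fg fu <-; rewrite mulrA fg mulrBl -scalerAl -!mulrA fu. Qed.

Definition primitive (K : fieldType) (A : algType K) (H : coalgOps A) f :=
  comul H f = f ⊗ 1 + 1 ⊗ f /\ counit H f = 0.

(** * The extended Jordanian twist and the coproduct it produces *)

Section ExtendedJordanian.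
Variables (K : numFieldType) (A : algType K) (H : coalgOps A).
Hypothesis Hm : comul_morph H.
Local Notation Delta := (comul H).
Local Notation eps := (counit H).

(** These model h(gamma), e13, e12 and e23. The weight b of e23 under h(gamma) carries all the
    dependence on gamma, so both parabolic cases share the computations. *)
Variables (h e x y0 : fps A) (b : K).
Hypotheses (hP : primitive H h) (eP : primitive H e).
Hypotheses (xP : primitive H x) (y0P : primitive H y0).
Hypotheses (he : h * e = e * h + e) (xe : x * e = e * x) (ye : y0 * e = e * y0).
Hypotheses (hx : h * x = x * h + (1 - b) *: x) (hy : h * y0 = y0 * h + b *: y0).
Hypothesis xy : x * y0 = y0 * x + e.

Let Dm : fmorph Delta. Proof. by case: Hm. Qed.
Let Em : fmorph eps. Proof. by case: Hm. Qed.

Definition jsig := fln (1 + xi * e).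
Definition esig c := fexp (c *: jsig).
Definition jtw := fexp (h ⊗ jsig).
(** After J, y0 has coproduct y0 ⊗ e^(b sigma) + 1 ⊗ y0; multiplying by the group-like e^(-b sigma)
    gives ybar ⊗ 1 + e^(-b sigma) ⊗ ybar, the shape required by [extension_twist]. *)
Definition ybar := y0 * esig (- b).
Definition xtw := fexp ((xi * x) ⊗ ybar).

Lemma xi_mulr (B : nzRingType) (f g : fps B) : f * (xi * g) = xi * (f * g).
Proof. by rewrite !mulrA xi_comm. Qed.

Lemma commuteM (B : nzRingType) (f g s : B) :
  f * s = s * f -> g * s = s * g -> f * g * s = s * (f * g).
Proof. by move=> fs gs; rewrite -mulrA gs !mulrA fs. Qed.

Lemma conj_mul (B : nzRingType) (X f f' g g' : B) :
  X * f = g * X -> X * f' = g' * X -> X * (f * f') = g * g' * X.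
Proof. by move=> E E'; rewrite mulrA E -mulrA E' mulrA. Qed.

Lemma conj_trans (B : nzRingType) (X J f g g' : B) :
  J * f = g * J -> X * g = g' * X -> X * J * f = g' * (X * J).
Proof. by move=> E1 E2; rewrite -mulrA E1 mulrA E2 -mulrA. Qed.

Lemma addr_cancel2 (V : zmodType) (p1 p2 p3 p4 p5 p6 : V) :
  p1 + p2 + p3 - (p4 + p3 + (p5 + p6)) = p2 - p6 + (p1 - p4) - p5.
Proof.
rewrite !opprD !addrA [LHS](ACl (2 * 7 * 1 * 4 * 6 * (3 * 5)))%AC /=.
by rewrite subrr addr0.
Qed.

Lemma eta_mulr (B : nzRingType) (f g : fps B) : f * (eta * g) = eta * (f * g).
Proof. by rewrite !mulrA eta_comm. Qed.

Let u0 : small (xi * e). Proof. exact: smallM. Qed.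
Let jsig0 : small jsig. Proof. exact: small_fln. Qed.
Let cjsig0 c : small (c *: jsig). Proof. exact: smallZ. Qed.

Lemma esigD c d : esig c * esig d = esig (c + d).
Proof.
rewrite /esig scalerDl fexpD // -scalerAl -scalerAr -scalerAl -scalerAr.
by rewrite scalerA mulrC -scalerA.
Qed.

Lemma esig0 : esig 0 = 1.
Proof. by rewrite /esig scale0r fexp0. Qed.

Lemma esig1 : esig 1 = 1 + xi * e.
Proof. by rewrite /esig scale1r fexp_ln1p. Qed.

Lemma jsig_comm f : f * e = e * f -> f * jsig = jsig * f.
Proof.
move=> fe; apply/esym/fln_comm; first by rewrite addrC addKr.
by rewrite mulrDl mulrDr mul1r mulr1 xi_mulr fe mulrA.
Qed.

Lemma esig_comm f c : f * jsig = jsig * f -> f * esig c = esig c * f.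
Proof.
move=> fs; apply/esym; apply: fexp_comm => //.
by rewrite -scalerAl -scalerAr fs.
Qed.

Lemma esig_jsig c : esig c * jsig = jsig * esig c.
Proof. exact/esym/esig_comm. Qed.

Lemma xi_e_esig c : xi * e * esig c = esig (c + 1) - esig c.
Proof. by rewrite [c + 1]addrC -esigD esig1 mulrDl mul1r addrC addKr. Qed.

(** The commutator with f acts on series in e as w d/de, and the derivative of ln(1 + xi e) is xi
    e^(-sigma). *)
Lemma jsig_commutator f w : f * e = e * f + w -> w * e = e * w ->
  jsig * f = f * jsig - xi * (w * esig (- 1)).
Proof.
move=> fe we.
have E : (1 + xi * e) * (f * jsig - jsig * f) = xi * w.
  apply: commutator_ln1p => //.
    by rewrite xi_mulr fe mulrDr mulrA.
  by rewrite xi_mulr -mulrA we -[RHS]mulrA xi_mulr.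
have <- : f * jsig - jsig * f = xi * (w * esig (- 1)).
  rewrite -[LHS]mul1r -esig0 -(addNr 1) -esigD esig1 -mulrA E xi_mulr.
  by rewrite (esig_comm _ (jsig_comm we)).
by rewrite opprB addrCA subrr addr0.
Qed.

(** The same rule applied to (1 + xi e)^c, whose derivative is c xi (1 + xi e)^(c - 1). *)
Lemma esig_commutator f w c : f * e = e * f + w -> w * e = e * w ->
  esig c * f = f * esig c - c *: (xi * (w * esig (c - 1))).
Proof.
move=> fe we; have sf := jsig_commutator fe we.
have ws := jsig_comm we.
have W : xi * (w * esig (- 1)) * jsig = jsig * (xi * (w * esig (- 1))).
  apply: commuteM (xi_comm _) (commuteM ws (esig_jsig _)).
have E : f * esig c = esig c * (f + c *: (xi * (w * esig (-1)))).
  apply: commutator_exp => //.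
    by rewrite -scalerAl -scalerAr sf -scalerDr subrK.
  by rewrite -!scalerAl -!scalerAr W.
have W2 : esig c * (w * esig (-1)) = w * esig (c - 1).
  by rewrite mulrA -(esig_comm c ws) -mulrA esigD.
by rewrite E mulrDr -scalerAr xi_mulr W2 addrK.
Qed.

Let xs : x * jsig = jsig * x. Proof. exact: jsig_comm. Qed.
Let y0s : y0 * jsig = jsig * y0. Proof. exact: jsig_comm. Qed.
Let ybs : ybar * jsig = jsig * ybar.
Proof. by rewrite /ybar -mulrA esig_jsig mulrA y0s mulrA. Qed.
Lemma jtw_unit : jtw \is a GRing.unit.
Proof. by apply/fexp_unit/small_ctensr. Qed.

Lemma xtw_small : small ((xi * x) ⊗ ybar).
Proof. by apply: small_ctensl; apply: smallM. Qed.

Lemma xtw_unit : xtw \is a GRing.unit.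
Proof. exact/fexp_unit/xtw_small. Qed.

Let eT : eps (1 + xi * e) = 1.
Proof.
by rewrite (fmorphD Em) (fmorphM Em) (fmorph1 Em) (proj2 eP) mulr0 addr0.
Qed.

Let DT : Delta (1 + xi * e) = 1 ⊗ (1 + xi * e) + (1 + xi * e - 1) ⊗ 1.
Proof.
rewrite [1 + xi * e - 1]addrC addKr (fmorphD Dm) (fmorphM Dm) (fmorph1 Dm).
rewrite (fmorph_xi Dm) (proj1 eP) ctensDr ctens11 ctens_xil ctens_xir.
by rewrite -addrA -mulrDr [X in xi * X]addrC.
Qed.

Let T1 : small (1 + xi * e - 1). Proof. by rewrite addrC addKr. Qed.
Let hs1 : h * 1 = 1 * h. Proof. by rewrite mulr1 mul1r. Qed.
Let ht : h * (1 + xi * e - 1) = (1 + xi * e - 1) * h + (1 + xi * e - 1).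
Proof.
by rewrite [1 + xi * e - 1]addrC addKr xi_mulr he mulrDr mulrA.
Qed.

Lemma jtw_twist : is_twist H jtw.
Proof.
apply: (jordanian_twist Hm (s := 1) T1 (proj1 hP) (proj2 hP) eT hs1 ht DT).
Qed.

Lemma jtw_jsig : jtw * Delta jsig = (jsig ⊗ 1 + 1 ⊗ jsig) * jtw.
Proof. exact: (jordanian_primitive Hm (s := 1) T1 hs1 ht DT). Qed.

Lemma jtw_l f c g : h * f = f * h + c *: f -> jsig * g = g * jsig ->
  jtw * (f ⊗ g) = (f ⊗ (g * esig c)) * jtw.
Proof. exact: tens_exp_eigen. Qed.

Lemma jtw_r f w : f * e = e * f + w -> w * e = e * w ->
  jtw * (1 ⊗ f) = (1 ⊗ f - xi * (h ⊗ (w * esig (- 1)))) * jtw.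
Proof.
move=> fe we.
have -> : xi * (h ⊗ (w * esig (- 1))) = - (h ⊗ (- (xi * (w * esig (- 1))))).
  by rewrite ctensNr ctens_xir opprK.
rewrite opprK; apply: tens_exp_right => //; first exact: jsig_commutator.
rewrite mulrN mulNr; congr (- _); apply: esym.
exact: commuteM (xi_comm _) (commuteM (jsig_comm we) (esig_jsig _)).
Qed.

Lemma jtw_r_comm f : f * e = e * f -> jtw * (1 ⊗ f) = (1 ⊗ f) * jtw.
Proof.
move=> fe; have := @jtw_r f 0; rewrite addr0 !mul0r !mulr0 ctens0r mulr0 subr0.
exact.
Qed.

Lemma jtw_x : jtw * Delta x = (x ⊗ esig (1 - b) + 1 ⊗ x) * jtw.
Proof.
rewrite (proj1 xP) mulrDr jtw_r_comm // (jtw_l (g := 1) hx) ?mul1r ?mulr1 //.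
by rewrite mulrDl.
Qed.

Lemma jtw_y0 : jtw * Delta y0 = (y0 ⊗ esig b + 1 ⊗ y0) * jtw.
Proof.
rewrite (proj1 y0P) mulrDr jtw_r_comm // (jtw_l (g := 1) hy) ?mul1r ?mulr1 //.
by rewrite mulrDl.
Qed.

(** Twisted coproducts are computed as relations F * Delta f = g * F, which chain over the factors
    of F ([conj_trans]) without inverses. *)
Lemma twisted_comulE F f g : F \is a GRing.unit -> F * Delta f = g * F ->
  comul (twisted H F) f = g.
Proof. by move=> Fu E; rewrite /= E mulrK. Qed.

Let Hm1 := twisted_morph Hm jtw_unit.

Lemma exp_grouplike (H' : coalgOps A) c : comul_morph H' ->
  comul H' jsig = jsig ⊗ 1 + 1 ⊗ jsig -> comul H' (esig c) = esig c ⊗ esig c.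
Proof.
case=> Dm' _ Ds; rewrite /esig (fmorph_fexp Dm') // (fmorphZ Dm') Ds scalerDr.
rewrite -ctensZl -ctensZr fexpD.
- by rewrite -tensl_fexp // -tensr_fexp // ctensM mulr1 mul1r.
- exact: small_ctensl.
- exact: small_ctensr.
- by rewrite !ctensM !mulr1 !mul1r.
Qed.

(** Since xi e = e^sigma - 1, the commutator of xi x and ybar is e^((1 - b) sigma) - e^(-b sigma),
    the difference of the group-likes in the coproducts of these two elements. *)
Lemma xtw_twist : is_twist (twisted H jtw) xtw.
Proof.
have [Dm1 _] := Hm1.
have D1x := twisted_comulE jtw_unit jtw_x.
have D1y := twisted_comulE jtw_unit jtw_y0.
have D1e c := exp_grouplike c Hm1 (twisted_comulE jtw_unit jtw_jsig).
have exx c : esig c * x = x * esig c by exact/esym/esig_comm.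
have exy c : esig c * ybar = ybar * esig c by exact/esym/esig_comm.
apply: (extension_twist Hm1 (a := esig (1 - b)) (b := esig (- b))).
- exact: smallM.
- rewrite (fmorphM Dm1) (fmorph_xi Dm1) D1x mulrDr ctens_xil ctens_xir.
  by [].
- rewrite (fmorphM Dm1) D1y D1e mulrDl !ctensM esigD mul1r addrN esig0.
  by [].
- by rewrite /= (fmorphM Em) (proj2 xP) mulr0.
- by rewrite /= (fmorphM Em) (proj2 y0P) mul0r.
- have E : x * ybar = ybar * x + e * esig (- b).
    rewrite /ybar mulrA xy mulrDl; congr (_ + _).
    by rewrite -[LHS]mulrA -[RHS]mulrA exx.
  rewrite -[LHS]mulrA E mulrDr [in RHS]xi_mulr; congr (_ + _).
  by rewrite mulrA xi_e_esig [- b + 1]addrC.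
- by rewrite xi_mulr exx mulrA.
- exact: exy.
- by rewrite xi_mulr exx mulrA.
- exact: exy.
Qed.

Definition ejtw := xtw * jtw.

Lemma ejtw_unit : ejtw \is a GRing.unit.
Proof. rewrite /ejtw (unitrMl _ jtw_unit); exact: xtw_unit. Qed.

Lemma ejtw_twist : is_twist H ejtw.
Proof. exact: (is_twist_comp Hm jtw_twist xtw_twist). Qed.

Lemma ejtw_conj f g g' : jtw * Delta f = g * jtw -> xtw * g = g' * xtw ->
  ejtw * Delta f = g' * ejtw.
Proof. exact: conj_trans. Qed.

Lemma xtw_comm g : ((xi * x) ⊗ ybar) * g = g * ((xi * x) ⊗ ybar) ->
  xtw * g = g * xtw.
Proof. exact: fexp_comm xtw_small xtw_small. Qed.

Lemma ejtw_jsig : ejtw * Delta jsig = (jsig ⊗ 1 + 1 ⊗ jsig) * ejtw.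
Proof.
apply: (ejtw_conj jtw_jsig); apply: xtw_comm.
have us : xi * x * jsig = jsig * (xi * x) by apply: commuteM (xi_comm _) xs.
by rewrite mulrDl mulrDr !ctensM !mulr1 !mul1r us ybs.
Qed.

(** * The parabolic factor *)

Section Parabolic.
Variables (k : fps A) (m : K).
Hypotheses (kP : primitive H k) (kh : k * h = h * k) (ke : k * e = e * k).
Hypotheses (kx : k * x = x * k + m *: x) (ky : k * y0 = y0 * k - m *: y0).

(** k commutes with h and e, hence is untouched by J; its weights m on x and -m on ybar cancel in x
    ⊗ ybar, so X does not affect it either. *)
Lemma ejtw_cartan : ejtw * Delta k = (k ⊗ 1 + 1 ⊗ k) * ejtw.
Proof.
apply: (@ejtw_conj _ (k ⊗ 1 + 1 ⊗ k)).
  have E : jtw * (k ⊗ 1) = (k ⊗ 1) * jtw.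
    apply: fexp_comm; [exact: small_ctensr..|].
    by rewrite !ctensM mulr1 mul1r kh.
  by rewrite (proj1 kP) mulrDr mulrDl E jtw_r_comm.
apply: xtw_comm.
have ku : k * (xi * x) = xi * x * k + m *: (xi * x).
  by rewrite xi_mulr kx mulrDr mulrA -scalerAr.
have kyb : k * ybar = ybar * k - m *: ybar.
  rewrite /ybar mulrA ky mulrBl -!mulrA -scalerAl; congr (y0 * _ - _).
  exact/esig_comm/jsig_comm.
rewrite mulrDl mulrDr !ctensM !mulr1 !mul1r ku kyb ctensDl ctensDr.
by rewrite ctensNr ctensZl ctensZr [RHS]addrACA subrr addr0.
Qed.

(** Multiplying the coproduct of v by that of the group-like s = e^(2 sigma) gives (v s) ⊗ 1 + s ⊗
    (v s); with T - s = eta v s this is the hypothesis of [jordanian_twist]. *)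
Lemma parabolic_twist v : ejtw * Delta v = (v ⊗ esig (- 2) + 1 ⊗ v) * ejtw ->
  k * v = v * k + v -> eps v = 0 ->
  is_twist (twisted H ejtw) (fexp (k ⊗ fln ((1 + eta * v) * esig 2))).
Proof.
move=> Dv kv ev; have Hm2 := twisted_morph Hm ejtw_unit; have [Dm2 Em2] := Hm2.
have D2k := twisted_comulE ejtw_unit ejtw_cartan.
have D2v := twisted_comulE ejtw_unit Dv.
have D2e c := exp_grouplike c Hm2 (twisted_comulE ejtw_unit ejtw_jsig).
have ks c : k * esig c = esig c * k by apply/esig_comm/jsig_comm.
have tE : (1 + eta * v) * esig 2 - esig 2 = eta * (v * esig 2).
  by rewrite mulrDl mul1r addrC addKr mulrA.
apply: (jordanian_twist Hm2 (s := esig 2)).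
- rewrite mulrDl mul1r addrAC; apply: smallD; first exact: small_fexpB1.
  by rewrite -mulrA; apply: smallM.
- exact: D2k.
- exact: (proj2 kP).
- rewrite (fmorphM Em2) (fmorphD Em2) (fmorphM Em2) (fmorph1 Em2).
  rewrite [counit _ v]ev mulr0 addr0 mul1r /esig (fmorph_fexp Em2) //.
  rewrite (fmorphZ Em2) (fmorph_fln Em2) // [counit _ _]eT fln1 scaler0 fexp0.
  by [].
- exact: ks.
- have kve : k * (v * esig 2) = v * esig 2 * k + v * esig 2.
    by rewrite mulrA kv mulrDl -[in LHS]mulrA ks mulrA.
  by rewrite tE eta_mulr kve mulrDr !mulrA.
- rewrite tE (fmorphM Dm2) (fmorphD Dm2) (fmorph1 Dm2) (fmorphM Dm2).
  rewrite (fmorph_eta Dm2) D2v D2e [LHS]mulrDl mul1r -[X in _ + X = _]mulrA.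
  rewrite [X in eta * X]mulrDl !ctensM esigD addNr esig0 !mul1r [in LHS]mulrDr.
  rewrite [in RHS]mulrDl mul1r ctensDr -[in RHS]mulrA ctens_etal ctens_etar.
  by rewrite -[RHS]addrA; congr (_ + _); apply: addrC.
Qed.

End Parabolic.

Lemma xtwL f g :
  ((xi * x) ⊗ ybar) * (f ⊗ g) = xi * ((x * f) ⊗ (ybar * g)).
Proof. by rewrite ctensM -[xi * x * f]mulrA ctens_xil. Qed.

Lemma xtwR f g :
  (f ⊗ g) * ((xi * x) ⊗ ybar) = xi * ((f * x) ⊗ (g * ybar)).
Proof. by rewrite ctensM xi_mulr ctens_xil. Qed.

Lemma xtwL2 f g : ((xi * x) ⊗ ybar) * (xi * (f ⊗ g))
  = xi * (xi * ((x * f) ⊗ (ybar * g))).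
Proof. by rewrite xi_mulr xtwL. Qed.

Lemma xtwR2 f g : xi * (f ⊗ g) * ((xi * x) ⊗ ybar)
  = xi * (xi * ((f * x) ⊗ (g * ybar))).
Proof. by rewrite -mulrA xtwR. Qed.

Let y0ex c : y0 * esig c = esig c * y0. Proof. exact: esig_comm. Qed.
Let xex c : x * esig c = esig c * x. Proof. exact: esig_comm. Qed.
Let ybex c : ybar * esig c = esig c * ybar. Proof. exact: esig_comm. Qed.
Let yby0 : ybar * y0 = y0 * ybar.
Proof. by rewrite /ybar -[LHS]mulrA y0ex. Qed.

(* The case gamma = 1, where v is e21. *)
Lemma ejtw_lower v : b = -1 -> primitive H v -> v * e = e * v + y0 ->
  x * v = v * x + h -> h * v = v * h - 2 *: v -> y0 * v = v * y0 ->
  ejtw * Delta v = (v ⊗ esig (- 2) + 1 ⊗ v) * ejtw.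
Proof.
move=> b1 vP ve xv hv yv.
have yE : ybar = y0 * esig 1 by rewrite /ybar b1 opprK.
have hx2 : x * h = h * x - 2 *: x by rewrite hx b1 opprK addrK.
have yb_ex2 : ybar * esig (- 2) = y0 * esig (- 1).
  by rewrite yE -[LHS]mulrA esigD; congr (_ * esig _); ring.
have yb_g : ybar * (y0 * esig (- 1)) = y0 * y0.
  by rewrite mulrA yby0 -mulrA yE -[y0 * esig 1 * _]mulrA esigD addrN esig0 mulr1.
have g_yb : y0 * esig (- 1) * ybar = y0 * y0.
  by rewrite -mulrA -ybex mulrA -yby0 -mulrA yb_g.
have yb_yy : ybar * (y0 * y0) = y0 * y0 * ybar.
  exact: esym (commuteM (esym yby0) (esym yby0)).
have ybv : ybar * v = v * ybar - xi * (y0 * y0).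
  have E1 : esig 1 * v = v * esig 1 - xi * y0.
    by rewrite (esig_commutator 1 ve ye) addrN esig0 mulr1 scale1r.
  rewrite yE -[LHS]mulrA E1 mulrBr [y0 * (v * _)]mulrA yv xi_mulr.
  by rewrite -[v * y0 * _]mulrA.
(* -c is the extra term produced by J. It is cancelled by X: the exponent of X has commutator c with
   v ⊗ e^(-2 sigma), because [x, v] = h, and commutator d with 1 ⊗ v. *)
pose c := xi * (h ⊗ (y0 * esig (- 1))).
pose d := - (xi * (xi * (x ⊗ (y0 * y0)))).
apply: (@ejtw_conj _ (v ⊗ esig (- 2) + 1 ⊗ v - c)).
  rewrite (proj1 vP) mulrDr (jtw_r ve ye).
  have hv' : h * v = v * h + (- 2) *: v by rewrite scaleNr.
  have := jtw_l (g := 1) hv'; rewrite !mul1r mulr1 => /(_ erefl) ->.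
  by rewrite -mulrDl addrA.
apply: (fexp_conj_cancel (d := d)); first exact: xtw_small.
- by rewrite xtwL xtwR /c -mulrDr xv ctensDl -ybex yb_ex2.
- rewrite /c xtwL2 xtwR2 yb_g g_yb hx2 /d.
  by rewrite ctensDl ctensNl ctensZl !mulrBr -!scalerAr scalerN.
- rewrite /d mulrN mulNr xi_mulr xtwL2 -[xi * _ * _]mulrA xtwR2.
  by rewrite yb_yy.
- rewrite xtwL xtwR mulr1 mul1r ybv ctensDr ctensNr ctens_xir mulrBr.
  by [].
Qed.

(* The case gamma = -1, where v is e32: the corrected element z, not v itself, *)
(* has the coproduct that [parabolic_twist] needs.                             *)
Lemma ejtw_upper v : b = 2 -> primitive H v -> v * e = e * v - x ->
  x * v = v * x -> h * v = v * h - 2 *: v -> y0 * v = v * y0 + h ->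
  let z := v - xi * h * x in
  ejtw * Delta z = (z ⊗ esig (- 2) + 1 ⊗ z) * ejtw.
Proof.
move=> b2 vP ve xv hv yv z; have [Dh _] := hP; have [Dv _] := vP.
have zE : z = v - xi * (h * x) by rewrite /z -mulrA.
clearbody z.
have nxe : - x * e = e * - x by rewrite mulNr mulrN xe.
have yE : ybar = y0 * esig (- 2) by rewrite /ybar b2.
have m12 : 1 - 2 = -1 :> K by ring.
have xh : x * h = h * x + x by rewrite hx b2 m12 scaleN1r subrK.
have yh : y0 * h = h * y0 - 2 *: y0 by rewrite hy b2 addrK.
have yx : y0 * x = x * y0 - e by rewrite xy addrK.
have m31 : -3 + 1 = -2 :> K by ring.
have m34 : -3 - 1 = -4 :> K by ring.
have m22 : -2 - 2 = -4 :> K by ring.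
have m21' : -2 + 1 = -1 :> K by ring.
have m11 : -1 - 1 = -2 :> K by ring.
have m21 : -2 - 1 = -3 :> K by ring.
have exv : esig (- 2) * v = v * esig (- 2) - 2 *: (xi * (x * esig (- 3))).
  rewrite (esig_commutator (- 2) ve nxe) m21 mulNr mulrN scaleNr scalerN opprK.
  by [].
have exh : esig (- 2) * h = h * esig (- 2) + 2 *: (esig (- 2) - esig (- 3)).
  rewrite (esig_commutator (- 2) he (erefl _)) m21 scaleNr opprK mulrA xi_e_esig m31.
  by [].
have ybh : ybar * h = h * ybar - 2 *: (y0 * esig (- 3)).
  rewrite yE -[LHS]mulrA exh mulrDr mulrA yh mulrBl -scalerAr mulrBr scalerBr.
  by rewrite -scalerAl addrA subrK -[h * y0 * _]mulrA.
have ybx : ybar * x = x * ybar - e * esig (- 2).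
  by rewrite yE -[LHS]mulrA -xex mulrA yx mulrBl -[x * y0 * _]mulrA.
have ybv : ybar * v = v * ybar + h * esig (- 2) - 2 *: (xi * (y0 * (x * esig (- 3)))).
  rewrite yE -[LHS]mulrA exv mulrBr [y0 * (v * _)]mulrA yv mulrDl -scalerAr xi_mulr.
  by rewrite -[v * y0 * _]mulrA.
have ybz : ybar * z = z * ybar + h * esig (- 1).
  rewrite zE.
  apply: (upper_relation (@xi_mulr A) ybv ybh ybx (xex _)).
  by rewrite xi_e_esig m21'.
have xz : x * z = z * x - xi * (x * x).
  have xhx : x * (h * x) = h * x * x + x * x by rewrite mulrA xh mulrDl.
  rewrite zE mulrBr mulrBl xv xi_mulr xhx mulrDr -[xi * _ * x]mulrA.
  by rewrite opprD addrA.
have ybhe : ybar * (h * esig (- 1)) = h * esig (- 1) * ybar - 2 *: (y0 * esig (- 4)).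
  have E : y0 * esig (- 3) * esig (- 1) = y0 * esig (- 4) by rewrite -mulrA esigD m34.
  exact: (commutator_mulr ybh (ybex _) E).
have yb_y4 : ybar * (y0 * esig (- 4)) = y0 * esig (- 4) * ybar.
  exact: esym (commuteM (esym yby0) (esym (ybex _))).
(* The legs exchange roles compared with [ejtw_lower]: now 1 ⊗ z has commutator c with the exponent
   of X, and z ⊗ e^(-2 sigma) has commutator d. *)
pose c := xi * (x ⊗ (h * esig (- 1))).
pose d := - (xi * (xi * ((x * x) ⊗ (y0 * esig (- 4))))).
rewrite [z ⊗ _ + _]addrC.
have jv : jtw * Delta v
    = (v ⊗ esig (- 2) + 1 ⊗ v + xi * (h ⊗ (x * esig (- 1)))) * jtw.
  have hv' : h * v = v * h + (- 2) *: v by rewrite scaleNr.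
  have := jtw_l (g := 1) hv'; rewrite !mul1r mulr1 => /(_ erefl) E.
  rewrite Dv mulrDr E (jtw_r ve nxe) mulNr ctensNr mulrN opprK -mulrDl.
  by rewrite addrA.
have jh : jtw * Delta h = (h ⊗ esig (- 1) + 1 ⊗ h) * jtw.
  have E : jtw * (h ⊗ 1) = (h ⊗ 1) * jtw.
    apply: fexp_comm; [exact: small_ctensr..|].
    by rewrite !ctensM mulr1 mul1r.
  have E2 : xi * (h ⊗ (e * esig (- 1))) = h ⊗ 1 - h ⊗ esig (- 1).
    by rewrite -ctens_xir mulrA xi_e_esig addNr esig0 ctensDr ctensNr.
  rewrite Dh mulrDr E (jtw_r he (erefl _)) E2 -mulrDl opprB !addrA.
  by rewrite [X in X * _](ACl (3 * 2 * (1 * 4)))%AC /= addrN addr0.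
have jhx : jtw * (Delta h * Delta x)
    = (h ⊗ esig (- 1) + 1 ⊗ h) * (x ⊗ esig (- 1) + 1 ⊗ x) * jtw.
  have := jtw_x; rewrite b2 m12 => jx.
  exact: conj_mul jh jx.
(* J turns Delta v into an expression with the extra term xi h ⊗ x e^(-sigma), which X would not
   absorb. The image of xi h x contains the same term, so in z it drops out and only -c remains. *)
apply: (@ejtw_conj _ (1 ⊗ z + z ⊗ esig (- 2) - c)).
  rewrite {1}zE (fmorphD Dm) (fmorphN Dm) !(fmorphM Dm) (fmorph_xi Dm).
  rewrite mulrBr jv xi_mulr jhx mulrA -mulrBl; congr (_ * _).
  rewrite zE ctensDl ctensDr ctensNl ctensNr ctens_xil ctens_xir /c.
  rewrite mulrDl !mulrDr !ctensM !mulr1 !mul1r esigD m11 xex.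
  exact: addr_cancel2.
apply: (fexp_conj_cancel (d := d)); first exact: xtw_small.
- by rewrite xtwL xtwR /c -mulrDr mulr1 mul1r ybz ctensDr.
- rewrite /c xtwL2 xtwR2 ybhe /d.
  by rewrite ctensDr ctensNr ctensZr !mulrBr -!scalerAr scalerN.
- rewrite /d mulrN mulNr xi_mulr xtwL2 -[xi * _ * _]mulrA xtwR2.
  have xxx : x * (x * x) = x * x * x := mulrA _ _ _.
  rewrite xxx yb_y4; reflexivity.
- rewrite xtwL xtwR xz -ybex ctensDl ctensNl ctens_xil mulrBr.
  by rewrite yE -[y0 * _ * _]mulrA esigD m22.
Qed.

End ExtendedJordanian.

(** * The Lie algebra sl(3) *)

Section EnvelopingAlgebra.
Variables (K : fieldType) (L : lieAlgType K).
Local Notation U := (uea L).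

Let eps0_linear : linear (fun _ : L => 0 : K^o).
Proof. by move=> a x y; rewrite scaler0 addr0. Qed.

Let eps0_bracket (x y : L) : 0 = 0 * 0 - 0 * 0 :> K^o.
Proof. by rewrite mul0r subrr. Qed.

Lemma ueaOps_morph : comul_morph (ueaOps L).
Proof.
have [c1 cM] := ulift_monoid_morphism (@uprim_linear K L) (@uprim_bracket K L).
have [e1 eM] := ulift_monoid_morphism eps0_linear eps0_bracket.
split.
  by apply: fmorph_fmap => //; apply: ulift_linear;
    [exact: uprim_linear|exact: uprim_bracket].
by apply: fmorph_fmap => //; exact: (ulift_linear eps0_linear eps0_bracket).
Qed.

Lemma primitive_gen (x : L) : primitive (ueaOps L) (fconst (ugen x)).
Proof.
have cL := ulift_linear (@uprim_linear K L) (@uprim_bracket K L).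
have eL := ulift_linear eps0_linear eps0_bracket.
have c0 : uea_comul (0 : U) = 0 := linear_fun0 cL.
have e0 : uea_counit (0 : U) = 0 := linear_fun0 eL.
split; rewrite /=; [rewrite (fmap_const _ c0)|rewrite (fmap_const _ e0)].
  rewrite uea_comul_gen.
  have fcD (v w : tensor U U) : fconst (v + w) = fconst v + fconst w.
    by have := fconst_linear 1 v w; rewrite !scale1r.
  by rewrite fcD; congr (_ + _); apply: esym; exact: fconst_tens.
have -> : uea_counit (ugen x) = 0 by exact: (ulift_gen eps0_linear eps0_bracket).
by apply/fpsP => i j /=; case: ifP.
Qed.

End EnvelopingAlgebra.

(** * From matrix commutators to relations in the enveloping algebra *)

Section SL3Relations.
Variable R : realType.
Local Notation C := R[i].
Local Notation L := (sl C 3).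

Lemma inU_linear a (x y : L) : inU (a *: x + y) = a *: inU x + inU y.
Proof. by rewrite /inU ugen_linear fconst_linear. Qed.

Lemma inU0 : inU (0 : L) = 0.
Proof. exact: (linear_fun0 inU_linear). Qed.

Lemma inUZ a (x : L) : inU (a *: x) = a *: inU x.
Proof. exact: (linear_funZ inU_linear). Qed.

Lemma inU_commutator (x y z : L) :
  sl_val x *m sl_val y - sl_val y *m sl_val x = sl_val z ->
  inU x * inU y = inU y * inU x + inU z.
Proof.
move=> E; have <- : bracket x y = z by apply: val_inj.
rewrite /inU ugen_bracket !fconstM.
by apply/fpsP => i j /=; case: ifP => _; rewrite ?addr0 // addrC subrK.
Qed.

Lemma inU_commutatorZ a (x y z : L) :
  sl_val x *m sl_val y - sl_val y *m sl_val x = a *: sl_val z ->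
  inU x * inU y = inU y * inU x + a *: inU z.
Proof. by move=> E; rewrite -inUZ; apply: inU_commutator. Qed.

Lemma inU_commute (x y : L) :
  sl_val x *m sl_val y - sl_val y *m sl_val x = 0 ->
  inU x * inU y = inU y * inU x.
Proof. by move=> E; rewrite (inU_commutator (z := 0)) // inU0 addr0. Qed.

Lemma hgamE g :
  hgam g = inU (g *: Sl (hperp_traceless R) + Sl (h13_traceless R)).
Proof. by rewrite inU_linear addrC. Qed.

End SL3Relations.

(** * Root vectors and weights in 3 by 3 matrices *)

Section MatrixCommutators.
Variable F : numFieldType.
Implicit Types g : F.

Local Notation i1 := (@Ordinal 3 0 isT).
Local Notation i2 := (@Ordinal 3 1 isT).
Local Notation i3 := (@Ordinal 3 2 isT).
Local Notation E12 := (delta_mx i1 i2 : 'M[F]_3).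
Local Notation E13 := (delta_mx i1 i3 : 'M[F]_3).
Local Notation E23 := (delta_mx i2 i3 : 'M[F]_3).
Local Notation E21 := (delta_mx i2 i1 : 'M[F]_3).
Local Notation E32 := (delta_mx i3 i2 : 'M[F]_3).
Local Notation HP :=
  (2^-1 *: (delta_mx i1 i1 - 2 *: delta_mx i2 i2 + delta_mx i3 i3) : 'M[F]_3).
Local Notation H g :=
  (g *: HP + 2^-1 *: (delta_mx i1 i1 - delta_mx i3 i3) : 'M[F]_3).

Lemma diag_delta_commutator (d : 'rV[F]_3) i j :
  diag_mx d *m delta_mx i j - delta_mx i j *m diag_mx d
    = (d 0 i - d 0 j) *: delta_mx i j.
Proof.
apply/matrixP => k l; rewrite mul_diag_mx mul_mx_diag !mxE.
by case: eqP => [->|_]; case: eqP => [->|_];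
  rewrite ?mulr0 ?mul0r ?subrr //= !mulr1 mul1r.
Qed.

Definition diag3 (a b c : F) : 'rV[F]_3 := \row_j nth 0 [:: a; b; c] j.

Lemma HP_diag : HP = diag_mx (diag3 2^-1 (-1) 2^-1).
Proof.
apply/matrixP; case=> [[|[|[|//]]] ?]; case=> [[|[|[|//]]] ?];
  rewrite !mxE /= ?mxE /= ?mulr0n ?mulr1n ?subr0 ?subrr ?mulr0 ?addr0 ?mulr1 //;
  by field.
Qed.

Lemma H_diag g : H g = diag_mx (diag3 (2^-1 * (g + 1)) (- g) (2^-1 * (g - 1))).
Proof.
rewrite HP_diag; apply/matrixP; case=> [[|[|[|//]]] ?]; case=> [[|[|[|//]]] ?];
  rewrite !mxE /= ?mxE /= ?mulr0n ?mulr1n ?subr0 ?subrr ?mulr0 ?addr0 ?mulr1 //;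
  by field.
Qed.

(** The reason for gamma = 1: h(1) is the coroot of the pair e12, e21. *)
Lemma delta_sub_H1 : delta_mx i1 i1 - delta_mx i2 i2 = H 1.
Proof.
rewrite H_diag; apply/matrixP; case=> [[|[|[|//]]] ?]; case=> [[|[|[|//]]] ?];
  rewrite !mxE /= ?mulr0n ?mulr1n ?subr0 ?subrr ?sub0r ?mulr0 //;
  by field.
Qed.

(** The reason for gamma = -1: h(-1) is the coroot of the pair e23, e32. *)
Lemma delta_sub_Hm1 : delta_mx i2 i2 - delta_mx i3 i3 = H (-1).
Proof.
rewrite H_diag; apply/matrixP; case=> [[|[|[|//]]] ?]; case=> [[|[|[|//]]] ?];
  rewrite !mxE /= ?mulr0n ?mulr1n ?subr0 ?subrr ?sub0r ?opprK ?addNr ?mulr0 //;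
  by field.
Qed.

Ltac mx_root :=
  rewrite ?H_diag ?HP_diag diag_delta_commutator !mxE /=;
  congr (_ *: _); by field.
Ltac mx_delta :=
  rewrite !mul_delta_mx_cond /= ?mulr0n ?mulr1n ?subr0 ?sub0r ?subrr
    ?delta_sub_H1 ?delta_sub_Hm1 ?scaleN1r; reflexivity.

Lemma mx_hgam_e13 g : (H g) *m E13 - E13 *m (H g) = E13.
Proof. rewrite -[RHS]scale1r; mx_root. Qed.

Lemma mx_hgam_e12 g : (H g) *m E12 - E12 *m (H g) = (1 - - (2^-1 * (3 * g - 1))) *: E12.
Proof. mx_root. Qed.

Lemma mx_hgam_e23 g : (H g) *m E23 - E23 *m (H g) = (- (2^-1 * (3 * g - 1))) *: E23.
Proof. mx_root. Qed.

Lemma mx_e12_e13 : E12 *m E13 - E13 *m E12 = 0.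
Proof. mx_delta. Qed.

Lemma mx_e23_e13 : E23 *m E13 - E13 *m E23 = 0.
Proof. mx_delta. Qed.

Lemma mx_e12_e23 : E12 *m E23 - E23 *m E12 = E13.
Proof. mx_delta. Qed.

Lemma mx_hperp_hgam g : HP *m (H g) - (H g) *m HP = 0.
Proof.
rewrite H_diag HP_diag !mulmx_diag -linearB /=; apply/matrixP => i j.
by rewrite !mxE [X in X - _]mulrC subrr mul0rn.
Qed.

Lemma mx_hperp_e13 : HP *m E13 - E13 *m HP = 0.
Proof. rewrite -[RHS](scale0r E13); mx_root. Qed.

Lemma mx_hperp_e12 : HP *m E12 - E12 *m HP = (3 / 2) *: E12.
Proof. mx_root. Qed.

Lemma mx_hperp_e23 : HP *m E23 - E23 *m HP = (- (3 / 2)) *: E23.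
Proof. mx_root. Qed.

Lemma mx_e21_e13 : E21 *m E13 - E13 *m E21 = E23.
Proof. mx_delta. Qed.

Lemma mx_e12_e21 : E12 *m E21 - E21 *m E12 = (H 1).
Proof. mx_delta. Qed.

Lemma mx_hgam_e21 : (H 1) *m E21 - E21 *m (H 1) = (-2) *: E21.
Proof. mx_root. Qed.

Lemma mx_e23_e21 : E23 *m E21 - E21 *m E23 = 0.
Proof. mx_delta. Qed.

Lemma mx_hperp_e21 : HP *m E21 - E21 *m HP = (- (3 / 2)) *: E21.
Proof. mx_root. Qed.

Lemma mx_e32_e13 : E32 *m E13 - E13 *m E32 = (-1) *: E12.
Proof. mx_delta. Qed.

Lemma mx_e12_e32 : E12 *m E32 - E32 *m E12 = 0.
Proof. mx_delta. Qed.

Lemma mx_hgam_e32 : (H (-1)) *m E32 - E32 *m (H (-1)) = (-2) *: E32.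
Proof. mx_root. Qed.

Lemma mx_e23_e32 : E23 *m E32 - E32 *m E23 = (H (-1)).
Proof. mx_delta. Qed.

Lemma mx_hperp_e32 : HP *m E32 - E32 *m HP = (3 / 2) *: E32.
Proof. mx_root. Qed.

End MatrixCommutators.

Section SL3Commutators.
Variable R : realType.
Local Notation C := R[i].
Implicit Types g : C.

(** The weight of e23 under h(g); it equals -1 at g = 1 and 2 at g = -1, the values required by
    [ejtw_lower] and [ejtw_upper]. *)
Definition bgam g : C := - (2^-1 * (3 * g - 1)).

Lemma hgam_e13 g : hgam g * e13 R = e13 R * hgam g + e13 R.
Proof. rewrite ?hgamE; apply: inU_commutator; exact: mx_hgam_e13. Qed.

Lemma hgam_e12 g : hgam g * e12 R = e12 R * hgam g + (1 - bgam g) *: e12 R.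
Proof. rewrite ?hgamE; apply: inU_commutatorZ; exact: mx_hgam_e12. Qed.

Lemma hgam_e23 g : hgam g * e23 R = e23 R * hgam g + bgam g *: e23 R.
Proof. rewrite ?hgamE; apply: inU_commutatorZ; exact: mx_hgam_e23. Qed.

Lemma e12_e13 : e12 R * e13 R = e13 R * e12 R.
Proof. apply: inU_commute; exact: mx_e12_e13. Qed.

Lemma e23_e13 : e23 R * e13 R = e13 R * e23 R.
Proof. apply: inU_commute; exact: mx_e23_e13. Qed.

Lemma e12_e23 : e12 R * e23 R = e23 R * e12 R + e13 R.
Proof. apply: inU_commutator; exact: mx_e12_e23. Qed.

Lemma hperp_hgam g : hperp R * hgam g = hgam g * hperp R.
Proof. rewrite ?hgamE; apply: inU_commute; exact: mx_hperp_hgam. Qed.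

Lemma hperp_e13 : hperp R * e13 R = e13 R * hperp R.
Proof. apply: inU_commute; exact: mx_hperp_e13. Qed.

Lemma hperp_e12 : hperp R * e12 R = e12 R * hperp R + (3 / 2) *: e12 R.
Proof. apply: inU_commutatorZ; exact: mx_hperp_e12. Qed.

Lemma hperp_e23 : hperp R * e23 R = e23 R * hperp R + (- (3 / 2)) *: e23 R.
Proof. apply: inU_commutatorZ; exact: mx_hperp_e23. Qed.

Lemma e21_e13 : e21 R * e13 R = e13 R * e21 R + e23 R.
Proof. apply: inU_commutator; exact: mx_e21_e13. Qed.

Lemma e12_e21 : e12 R * e21 R = e21 R * e12 R + hgam (1 : C).
Proof. rewrite ?hgamE; apply: inU_commutator; exact: mx_e12_e21. Qed.

Lemma hgam_e21 : hgam (1 : C) * e21 R = e21 R * hgam 1 + (-2) *: e21 R.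
Proof. rewrite ?hgamE; apply: inU_commutatorZ; exact: mx_hgam_e21. Qed.

Lemma e23_e21 : e23 R * e21 R = e21 R * e23 R.
Proof. apply: inU_commute; exact: mx_e23_e21. Qed.

Lemma hperp_e21 : hperp R * e21 R = e21 R * hperp R + (- (3 / 2)) *: e21 R.
Proof. apply: inU_commutatorZ; exact: mx_hperp_e21. Qed.

Lemma e32_e13 : e32 R * e13 R = e13 R * e32 R + (-1) *: e12 R.
Proof. apply: inU_commutatorZ; exact: mx_e32_e13. Qed.

Lemma e12_e32 : e12 R * e32 R = e32 R * e12 R.
Proof. apply: inU_commute; exact: mx_e12_e32. Qed.

Lemma hgam_e32 : hgam (-1 : C) * e32 R = e32 R * hgam (-1) + (-2) *: e32 R.
Proof. rewrite ?hgamE; apply: inU_commutatorZ; exact: mx_hgam_e32. Qed.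

Lemma e23_e32 : e23 R * e32 R = e32 R * e23 R + hgam (-1 : C).
Proof. rewrite ?hgamE; apply: inU_commutator; exact: mx_e23_e32. Qed.

Lemma hperp_e32 : hperp R * e32 R = e32 R * hperp R + (3 / 2) *: e32 R.
Proof. apply: inU_commutatorZ; exact: mx_hperp_e32. Qed.

End SL3Commutators.

(** * The parabolic twists of U(sl(3)) *)

Section SL3Twists.
Variable R : realType.
Local Notation C := R[i].
Implicit Types g c : C.
Local Notation H := (Usl3 R).

Let Hm : comul_morph H := ueaOps_morph (sl C 3).

Lemma primitive_hgam g : primitive H (hgam g).
Proof. by rewrite hgamE; apply: primitive_gen. Qed.

Let P12 : primitive H (e12 R) := primitive_gen _.
Let P13 : primitive H (e13 R) := primitive_gen _.
Let P23 : primitive H (e23 R) := primitive_gen _.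
Let P21 : primitive H (e21 R) := primitive_gen _.
Let P32 : primitive H (e32 R) := primitive_gen _.
Let Pperp : primitive H (hperp R) := primitive_gen _.

Lemma primitiveZ c f : primitive H f -> primitive H (c *: f).
Proof.
have [Dm Em] := Hm; case=> Df ef.
split; first by rewrite (fmorphZ Dm) Df ctensZl ctensZr scalerDr.
by rewrite (fmorphZ Em) ef scaler0.
Qed.

Lemma FtwE g : Ftw g = ejtw (hgam g) (e13 R) (e12 R) (e23 R) (bgam g).
Proof.
rewrite /Ftw /ejtw /xtw /jtw /ybar /esig /bgam opprK ctens_xil.
reflexivity.
Qed.

Lemma Ftw_twist g : is_twist H (Ftw g).
Proof.
rewrite FtwE; apply: (ejtw_twist Hm (primitive_hgam g) P13 P12 P23).
- exact: hgam_e13.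
- exact: e12_e13.
- exact: e23_e13.
- exact: hgam_e12.
- exact: hgam_e23.
- exact: e12_e23.
Qed.

Lemma hperpZ_commutator c a f : hperp R * f = f * hperp R + a *: f ->
  (c *: hperp R) * f = f * (c *: hperp R) + (c * a) *: f.
Proof. by move=> E; rewrite -scalerAl E scalerDr scalerA scalerAr. Qed.

Lemma hperpZ_commute c f : hperp R * f = f * hperp R ->
  (c *: hperp R) * f = f * (c *: hperp R).
Proof. by move=> E; rewrite -scalerAl E scalerAr. Qed.

(** With k = 2/3 h_perp, both e32 and e12 have weight one while h(-1) has weight zero, so the
    correction xi h(-1) e12 does not spoil the weight of e32. *)
Lemma weight_one_sub (B : nzRingType) (t k v h x : B) :
  (forall f g : B, f * (t * g) = t * (f * g)) ->
  k * v = v * k + v -> k * h = h * k -> k * x = x * k + x ->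
  k * (v - t * h * x) = (v - t * h * x) * k + (v - t * h * x).
Proof.
move=> tC kv kh kx.
rewrite mulrBr mulrBl kv -[t * h * x]mulrA tC [k * (h * x)]mulrA kh.
rewrite -[h * k * x]mulrA kx.
by rewrite !mulrDr -[t * (h * x) * k]mulrA -[h * x * k]mulrA opprD addrACA.
Qed.

Lemma Ftw_parabolic g c v :
  Ftw g * comul H v = (v ⊗ fexp ((-2) *: sigma R) + 1 ⊗ v) * Ftw g ->
  (c *: hperp R) * v = v * (c *: hperp R) + v -> counit H v = 0 ->
  is_twist (twisted H (Ftw g))
    (fexp (c *: (hperp R ⊗ fln ((1 + eta * v) * fexp (2 *: sigma R))))).
Proof.
move=> Dv kv ev; rewrite FtwE -ctensZl.
have kh := hperpZ_commute c (hperp_hgam g).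
have ke := hperpZ_commute c (hperp_e13 R).
have kx := hperpZ_commutator c (hperp_e12 R).
have ky := hperpZ_commutator c (hperp_e23 R).
rewrite mulrN scaleNr in ky; rewrite FtwE in Dv.
exact: (parabolic_twist Hm P13 (hgam_e13 g) (e12_e13 R) (e23_e13 R)
  (primitiveZ c Pperp) kh ke kx ky Dv kv ev).
Qed.

Lemma FJPplus_twist : is_twist (twisted H (Ftw (1 : C))) (FJPplus R).
Proof.
apply: Ftw_parabolic; last exact: (proj2 P21).
- rewrite FtwE; apply: (ejtw_lower (e23_e13 R) (hgam_e12 1) _ P21).
  + by rewrite /bgam; field.
  + exact: e21_e13.
  + exact: e12_e21.
  + by rewrite hgam_e21 scaleNr.
  + exact: e23_e21.
(* e21 has weight -3/2 under h_perp; the factor -2/3 normalises it to one. *)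
- rewrite (hperpZ_commutator _ (hperp_e21 R)) (_ : - (2 / 3) * - (3 / 2) = 1).
    by rewrite scale1r.
  by field.
Qed.

Lemma FJPminus_twist : is_twist (twisted H (Ftw (-1 : C))) (FJPminus R).
Proof.
have [_ Em] := Hm; set z := e32 R - xi * hgam (-1) * e12 R.
have c1 : 2 / 3 * (3 / 2) = 1 :> C by field.
apply: (Ftw_parabolic (v := z)).
- rewrite FtwE /z.
  apply: (ejtw_upper Hm (primitive_hgam (-1)) P12 (hgam_e13 _) (e12_e13 R)
    (e23_e13 R) (hgam_e12 _) (hgam_e23 _) (e12_e23 R) _ P32).
  + by rewrite /bgam; field.
  + by rewrite e32_e13 scaleN1r.
  + exact: e12_e32.
  + by rewrite hgam_e32 scaleNr.
  + exact: e23_e32.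
- have k32 := hperpZ_commutator (2 / 3) (hperp_e32 R).
  have k12 := hperpZ_commutator (2 / 3) (hperp_e12 R).
  have kh := hperpZ_commute (2 / 3) (hperp_hgam (-1 : C)).
  rewrite c1 scale1r in k32; rewrite c1 scale1r in k12.
  exact: (weight_one_sub (@xi_mulr _) k32 kh k12).
- rewrite (fmorphD Em) (fmorphN Em) !(fmorphM Em) (proj2 P32) (proj2 P12).
  by rewrite mulr0 subr0.
Qed.

End SL3Twists.

Theorem mainTheorem3 (R : realType) :
  (is_twist (twisted (Usl3 R) (Ftw (1 : R[i]))) (FJPplus R)
    /\ is_twist (Usl3 R) (FJPplus R * Ftw (1 : R[i])))
  /\
  (is_twist (twisted (Usl3 R) (Ftw (-1 : R[i]))) (FJPminus R)
    /\ is_twist (Usl3 R) (FJPminus R * Ftw (-1 : R[i]))).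
Proof.
have Hm := ueaOps_morph (sl R[i] 3).
have J1 := FJPplus_twist R; have J2 := FJPminus_twist R.
split; split => //.
- exact: (is_twist_comp Hm (Ftw_twist _) J1).
- exact: (is_twist_comp Hm (Ftw_twist _) J2).
Qed.
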